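(* Let $G$ be a locally finite connected graph with at least three vertices such that $|G|$ contains a spanning topological caterpillar. Then the square $G^2$ is Hamiltonian, i.e. $|G^2|$ contains a Hamilton circle.
   Context: All graphs are simple. For a locally finite connected graph $H$, an end of $H$ is an equivalence class of rays (one-way infinite paths) of $H$, two rays being equivalent if no finite set of vertices separates them. $|H|$ denotes the Freudenthal compactification of $H$: the graph $H$ viewed as a 1-complex together with its ends, with the standard topology in which, for every finite $S\subseteq V(H)$ and end $\omega$, the set consisting of the component $C$ of $H-S$ containing tails of all rays of $\omega$, all ends whose rays have tails in $C$, and the inner points of the edges between $S$ and $C$, is an open neighbourhood of $\omega$. A circle in $|H|$ is a homeomorphic image of the unit circle $S^1$ in $|H|$; an arc is a homeomorphic image of $[0,1]$. A Hamilton circle of $H$ is a circle in $|H|$ containing all vertices of $H$; $H$ is Hamiltonian if one exists. For a subgraph $F$ of $H$, $\overline{F}$ denotes its closure in $|H|$; such closures are called standard subspaces. A topological tree is an arc-connected standard subspace of $|H|$ containing no circle. A topological caterpillar is a topological tree $\overline{T}$, where $T$ is a forest in $H$, such that $\overline{T-L}$ is an arc, where $L$ is the set of vertices of degree $1$ in $T$. It is spanning if it contains all vertices of $H$. The square $G^2$ is obtained from $G$ by adding an edge between any two vertices at distance $2$ in $G$. *)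

(* Defs.v *)
From Stdlib Require Import Reals List Relations.
Open Scope R_scope.

Section Freudenthal.
Variable V : Type.
Variable adj : V -> V -> Prop.

Definition symmetric_rel : Prop := forall u v, adj u v -> adj v u.
Definition irreflexive_rel : Prop := forall v, ~ adj v v.
Definition locally_finite : Prop :=
  forall v, exists l : list V, forall w, adj v w -> In w l.
Definition connected_graph : Prop := forall u v, clos_refl_trans V adj u v.

(* Points of the 1-complex are written in barycentric coordinates f : V -> R *)
Definition is_vpt (f : V -> R) (v : V) : Prop :=
  f v = 1 /\ forall x, x <> v -> f x = 0.
Definition is_ept (f : V -> R) (u v : V) : Prop :=
  u <> v /\ 0 < f u /\ 0 < f v /\ f u + f v = 1 /\
  forall x, x <> u -> x <> v -> f x = 0.
Definition pt1 (f : V -> R) : Prop :=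
  (exists v, is_vpt f v) \/ (exists u v, adj u v /\ is_ept f u v).

Definition stepS (S : list V) (x y : V) : Prop := adj x y /\ ~ In x S /\ ~ In y S.
Definition compS (S : list V) (c x : V) : Prop :=
  ~ In c S /\ clos_refl_trans V (stepS S) c x.

Definition eventually (P : nat -> Prop) : Prop := exists n, forall m, (n <= m)%nat -> P m.

Definition ray (r : nat -> V) : Prop :=
  (forall m n, r m = r n -> m = n) /\ forall n, adj (r n) (r (S n)).
Definition rays_equiv (r1 r2 : nat -> V) : Prop :=
  forall S : list V, exists c,
    eventually (fun m => compS S c (r1 m)) /\ eventually (fun m => compS S c (r2 m)).
Definition is_end (e : (nat -> V) -> Prop) : Prop :=
  exists r0, ray r0 /\ forall r, e r <-> (ray r /\ rays_equiv r0 r).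
End Freudenthal.
Arguments symmetric_rel {V} adj. Arguments irreflexive_rel {V} adj.
Arguments locally_finite {V} adj. Arguments connected_graph {V} adj.
Arguments is_vpt {V} f v. Arguments is_ept {V} f u v. Arguments pt1 {V} adj f.
Arguments stepS {V} adj S x y. Arguments compS {V} adj S c x.
Arguments ray {V} adj r. Arguments rays_equiv {V} adj r1 r2. Arguments is_end {V} adj e.

Inductive Pt (V : Type) : Type :=
| Inner : (V -> R) -> Pt V
| EndP : ((nat -> V) -> Prop) -> Pt V.
Arguments Inner {V} _.
Arguments EndP {V} _.

Section Topology.
Variable V : Type.
Variable adj : V -> V -> Prop.

Definition inH (p : Pt V) : Prop :=
  match p with Inner f => pt1 adj f | EndP e => is_end adj e end.

(* the set C^(S, c): component C of H - S containing c, its ends, and the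
   inner points of edges of C and between S and C *)
Definition region (S : list V) (c : V) (q : Pt V) : Prop :=
  match q with
  | Inner g => pt1 adj g /\ (exists x, 0 < g x /\ compS adj S c x) /\
               (forall x, 0 < g x -> compS adj S c x \/ In x S)
  | EndP e => is_end adj e /\
              forall r, e r -> eventually (fun m => compS adj S c (r m))
  end.

Definition nb (p : Pt V) (N : Pt V -> Prop) : Prop :=
  match p with
  | Inner f => exists eps, 0 < eps /\
      N = (fun q => match q with
                    | Inner g => pt1 adj g /\ forall x, Rabs (f x - g x) < eps
                    | EndP _ => False end)
  | EndP w => exists (S : list V) (c : V),
      (forall r, w r -> eventually (fun m => compS adj S c (r m))) /\
      N = region S c
  end.

Definition embedding {X : Type} (D : X -> Prop) (d : X -> X -> R) (f : X -> Pt V) : Prop :=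
  (forall x, D x -> inH (f x)) /\
  (forall x y, D x -> D y -> f x = f y -> x = y) /\
  (forall x, D x -> forall N, nb (f x) N ->
      exists delta, 0 < delta /\ forall y, D y -> d x y < delta -> N (f y)) /\
  (forall x, D x -> forall delta, 0 < delta ->
      exists N, nb (f x) N /\ forall y, D y -> N (f y) -> d x y < delta).

Definition S1 (z : R * R) : Prop := fst z ^ 2 + snd z ^ 2 = 1.
Definition dist2 (z w : R * R) : R :=
  sqrt ((fst z - fst w) ^ 2 + (snd z - snd w) ^ 2).
Definition unitI (t : R) : Prop := 0 <= t <= 1.
Definition dist1 (s t : R) : R := Rabs (s - t).

Definition circle (C : Pt V -> Prop) : Prop :=
  exists f, embedding S1 dist2 f /\ forall p, C p <-> exists z, S1 z /\ f z = p.
Definition arc (A : Pt V -> Prop) : Prop :=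
  exists f, embedding unitI dist1 f /\ forall p, A p <-> exists t, unitI t /\ f t = p.

Definition hamilton_circle (C : Pt V -> Prop) : Prop :=
  circle C /\ forall v, exists f, is_vpt f v /\ C (Inner f).
Definition hamiltonian : Prop := exists C, hamilton_circle C.

Definition closure (A : Pt V -> Prop) (p : Pt V) : Prop :=
  inH p /\ forall N, nb p N -> exists q, N q /\ A q.

Definition arc_connected (X : Pt V -> Prop) : Prop :=
  forall p q, X p -> X q -> p <> q ->
    exists f, embedding unitI dist1 f /\ f 0 = p /\ f 1 = q /\
              forall t, unitI t -> X (f t).

Definition topological_tree (X : Pt V -> Prop) : Prop :=
  arc_connected X /\ ~ exists C, circle C /\ forall p, C p -> X p.

Definition subgraph (VT : V -> Prop) (ET : V -> V -> Prop) : Prop :=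
  (forall u v, ET u v -> adj u v /\ VT u /\ VT v) /\ (forall u v, ET u v -> ET v u).

Fixpoint path_in (ET : V -> V -> Prop) (x : V) (l : list V) : Prop :=
  match l with nil => True | y :: l' => ET x y /\ path_in ET y l' end.

Definition forest (VT : V -> Prop) (ET : V -> V -> Prop) : Prop :=
  subgraph VT ET /\
  ~ exists x l, (2 <= length l)%nat /\ NoDup (x :: l) /\ path_in ET x l /\ ET (last l x) x.

Definition subpts (VT : V -> Prop) (ET : V -> V -> Prop) (p : Pt V) : Prop :=
  match p with
  | Inner f => (exists v, VT v /\ is_vpt f v) \/ (exists u v, ET u v /\ is_ept f u v)
  | EndP _ => False
  end.

Definition leaf (VT : V -> Prop) (ET : V -> V -> Prop) (v : V) : Prop :=
  VT v /\ exists w, ET v w /\ forall w', ET v w' -> w' = w.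

Definition topological_caterpillar (VT : V -> Prop) (ET : V -> V -> Prop) : Prop :=
  forest VT ET /\
  topological_tree (closure (subpts VT ET)) /\
  arc (closure (subpts (fun v => VT v /\ ~ leaf VT ET v)
                       (fun u v => ET u v /\ ~ leaf VT ET u /\ ~ leaf VT ET v))).

Definition spanning_topological_caterpillar (VT : V -> Prop) (ET : V -> V -> Prop) : Prop :=
  topological_caterpillar VT ET /\
  forall v, exists f, is_vpt f v /\ closure (subpts VT ET) (Inner f).
End Topology.

Arguments hamiltonian {V} adj.
Arguments spanning_topological_caterpillar {V} adj VT ET.

Definition square {V : Type} (adj : V -> V -> Prop) (u v : V) : Prop :=
  u <> v /\ (adj u v \/ exists w, adj u w /\ adj w v).

(* Main.v *)
(* Let [A] be the arc carrying the spine of the caterpillar. A Hamilton circle of the square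
   is built from two tracks joining the two extremities of [A]. The first track follows [A],
   through all ends. The second track contains no end except possibly those two extremities:
   a walk of [G] between them is loop-erased at the level of the components of the forest, so
   that it meets each component in one path of the spine. Along such a path [v_0 v_1 ...] the
   second track takes the vertex [v_0], the leaves at [v_1], the vertex [v_2], and so on, and
   the first track takes the rest, as in the square of a finite caterpillar; consecutive
   vertices of either track then have distance at most 2. Elsewhere the first
   track takes each spine vertex together with its leaves. The two tracks form a closed curve
   in [|G^2|] that is injective, hence a circle by compactness. *)

Require Import Defs.
From Stdlib Require Import Reals List Relations Lra Lia ZArith.
From Stdlib Require Import Classical ClassicalEpsilon FunctionalExtensionality PropExtensionality.
Import ListNotations.
Open Scope R_scope.

(** A circle passes an end at most once, and the first track already uses every end on the arc. So
    the second track has to change components along edges, and these exist because [G] is connected.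
    A walk may re-enter a component many times, whereas the alternation of spine vertices and leaves
    needs one stretch per component; this is why the erasure works on components and not on
    vertices. An extremity may be an end, so there need not be a finite walk between the two. Two
    walks from one vertex, each tending to an extremity, are therefore erased separately, every
    component being left at its last visit. The difficulty is to restart both at a vertex chosen so
    that they share nothing but an initial stretch in one component. Edges between components may
    join leaves, which governs the order inside the blocks. Real times carry all of this because the
    ends on the arc may form a set as rich as a Cantor set, so that the first track cannot be
    indexed by integers. *)

(** * Compactness of a real interval *)

(** Heine-Borel in additive form: the supremum of the [t] with [Q a t] cannot stop short of [b].
    Depending on [Q] it serves below as compactness, as connectedness or as an intermediate value
    theorem. *)
Lemma interval_glue (Q : R -> R -> Prop) (a b : R) :
  a <= b ->
  (forall s t u, a <= s -> s <= t -> t <= u -> u <= b -> Q s t -> Q t u -> Q s u) ->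
  (forall t, a <= t <= b -> exists d, 0 < d /\ forall s u,
      a <= s -> s <= t -> t <= u -> u <= b -> t - d < s -> u < t + d -> Q s u) ->
  Q a b.
Proof.
  intros Hab Hadd Hloc.
  set (E := fun t => a <= t <= b /\ Q a t).
  assert (Ea : E a).
  { split; [lra|]. destruct (Hloc a ltac:(lra)) as (d & Hd & H). apply H; lra. }
  destruct (completeness E) as [m [Hub Hlub]].
  { exists b. intros t [Ht _]. lra. }
  { exists a; exact Ea. }
  assert (Ham : a <= m) by (apply Hub, Ea).
  assert (Hmb : m <= b) by (apply Hlub; intros t [Ht _]; lra).
  destruct (Hloc m ltac:(lra)) as (d & Hd & H).
  assert (exists t, E t /\ m - d < t) as (t & Et & Ht).
  { apply NNPP; intro Hn. assert (m <= m - d); [|lra].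
    apply Hlub. intros t Et. destruct (Rle_dec t (m - d)); [assumption|].
    exfalso; apply Hn; exists t; split; [assumption|lra]. }
  assert (Htm : t <= m) by (apply Hub; assumption).
  destruct Et as [Htr Qat].
  set (u := Rmin b (m + d / 2)).
  assert (Hu : u <= b /\ u <= m + d / 2 /\ m <= u /\ (u = b \/ u = m + d / 2)).
  { unfold u, Rmin; destruct Rle_dec; lra. }
  assert (Qau : Q a u).
  { apply Hadd with t; try lra; auto. apply H; lra. }
  assert (u <= m) by (apply Hub; split; [lra|assumption]).
  destruct Hu as (Hu1 & Hu2 & Hu3 & [Hu4|Hu4]); [rewrite <- Hu4; assumption|lra].
Qed.

Lemma list_isolated (l : list R) (t : R) :
  exists d, 0 < d /\ forall x, In x l -> Rabs (x - t) < d -> x = t.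
Proof.
  induction l as [|y l (d & Hd & IH)].
  - exists 1; split; [lra|]. intros x [].
  - destruct (Req_dec y t) as [->|Hy].
    + exists d; split; [assumption|]. intros x [<-|Hx] Hlt; auto.
    + exists (Rmin d (Rabs (y - t))). split.
      { apply Rmin_pos; [assumption|]. apply Rabs_pos_lt; lra. }
      intros x [<-|Hx] Hlt.
      * exfalso. pose proof (Rmin_r d (Rabs (y - t))); lra.
      * apply IH; [assumption|]. pose proof (Rmin_l d (Rabs (y - t))); lra.
Qed.

(** * Marked points and accumulation points on an interval *)

(* [P] is a set of marked points whose accumulation points are exactly [K]; every
   point of [K] is approached by [P] from each side on which there is room. *)
Record good (lo hi : R) (P K : R -> Prop) : Prop := {
  good_le : lo <= hi;
  good_P : forall t, P t -> lo <= t <= hi;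
  good_K : forall t, K t -> lo <= t <= hi;
  good_dis : forall t, P t -> K t -> False;
  good_lo : P lo \/ K lo;
  good_hi : P hi \/ K hi;
  good_iso : forall t, lo <= t <= hi -> ~ K t -> exists d, 0 < d /\
    forall s, Rabs (s - t) < d -> s <> t -> ~ P s /\ ~ K s;
  good_accr : forall k e, K k -> k < hi -> 0 < e -> exists s, P s /\ k < s < k + e;
  good_accl : forall k e, K k -> lo < k -> 0 < e -> exists s, P s /\ k - e < s < k
}.
Arguments good_le {lo hi P K}.
Arguments good_P {lo hi P K}.
Arguments good_K {lo hi P K}.
Arguments good_dis {lo hi P K}.
Arguments good_lo {lo hi P K}.
Arguments good_hi {lo hi P K}.
Arguments good_iso {lo hi P K}.
Arguments good_accr {lo hi P K}.
Arguments good_accl {lo hi P K}.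

Lemma good_rev lo hi P K : good lo hi P K ->
  good (- hi) (- lo) (fun t => P (- t)) (fun t => K (- t)).
Proof.
  intros [H1 H2 H3 H4 H5 H6 H7 H8 H9]. constructor.
  - lra.
  - intros t Ht. apply H2 in Ht. lra.
  - intros t Ht. apply H3 in Ht. lra.
  - intros t. apply H4.
  - rewrite Ropp_involutive. assumption.
  - rewrite Ropp_involutive. assumption.
  - intros t Ht Hk. destruct (H7 (- t) ltac:(lra) Hk) as (d & Hd & H).
    exists d; split; [assumption|]. intros s Hs Hst. apply H; [|lra].
    replace (- s - - t) with (- (s - t)) by ring. rewrite Rabs_Ropp. assumption.
  - intros k e Hk Hlt He. destruct (H9 (- k) e Hk ltac:(lra) He) as (s & Ps & Hs).
    exists (- s). rewrite Ropp_involutive. split; [assumption|lra].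
  - intros k e Hk Hlt He. destruct (H8 (- k) e Hk ltac:(lra) He) as (s & Ps & Hs).
    exists (- s). rewrite Ropp_involutive. split; [assumption|lra].
Qed.
Arguments good_rev {lo hi P K}.

(** The supremum [m] of the free stretch after [t] is not in [K], because marks approach a point of
    [K] from the left. It is a mark, because otherwise isolation would let the stretch continue. *)
Lemma good_next lo hi P K t : good lo hi P K -> lo <= t < hi -> ~ K t ->
  exists s, P s /\ t < s /\ forall r, t < r < s -> ~ P r /\ ~ K r.
Proof.
  intros G Ht Kt.
  set (E := fun u => t <= u <= hi /\ forall r, t < r < u -> ~ P r /\ ~ K r).
  destruct (completeness E) as [m [Hub Hlub]].
  { exists hi. intros u [Hu _]. lra. }
  { exists t. split; [lra|]. intros r Hr; lra. }
  assert (Hmh : m <= hi) by (apply Hlub; intros u [Hu _]; lra).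
  assert (Hbet : forall r, t < r < m -> ~ P r /\ ~ K r).
  { intros r Hr. assert (exists u, E u /\ r < u) as (u & [Hu1 Hu2] & Hu).
    { apply NNPP; intro Hn. assert (m <= r); [|lra].
      apply Hlub. intros u Eu. destruct (Rle_dec u r); [assumption|].
      exfalso; apply Hn; exists u; split; [assumption|lra]. }
    apply Hu2; lra. }
  assert (Htm : t < m).
  { destruct (good_iso G t ltac:(lra) Kt) as (d & Hd & H).
    assert (E (Rmin hi (t + d / 2))) as HE.
    { unfold Rmin; destruct Rle_dec as [Hle|Hle]; (split; [lra|]); intros r Hr; apply H; try lra;
      apply Rabs_def1; lra. }
    apply Hub in HE. revert HE. unfold Rmin; destruct Rle_dec; lra. }
  destruct (classic (K m)) as [Km|Km].
  { destruct (good_accl G m (m - t) Km ltac:(lra) ltac:(lra)) as (s & Ps & Hs).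
    exfalso. apply (proj1 (Hbet s ltac:(lra))); assumption. }
  destruct (classic (P m)) as [Pm|Pm].
  { exists m; repeat split; auto; apply Hbet; assumption. }
  destruct (Req_dec m hi) as [->|Hne].
  { destruct (good_hi G); contradiction. }
  destruct (good_iso G m ltac:(lra) Km) as (d & Hd & H).
  assert (E (Rmin hi (m + d / 2))) as HE.
  { assert (Haux : forall r, t < r < m + d / 2 -> ~ P r /\ ~ K r).
    { intros r Hr. destruct (Rlt_dec r m); [apply Hbet; lra|].
      destruct (Req_dec r m) as [->|]; [auto|]. apply H; [|assumption].
      apply Rabs_def1; lra. }
    unfold Rmin; destruct Rle_dec as [Hle|Hle]; (split; [lra|]); intros r Hr; apply Haux; lra. }
  apply Hub in HE. revert HE. unfold Rmin; destruct Rle_dec; lra.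
Qed.
Arguments good_next {lo hi P K}.

Lemma good_prev lo hi P K t : good lo hi P K -> lo < t <= hi -> ~ K t ->
  exists s, P s /\ s < t /\ forall r, s < r < t -> ~ P r /\ ~ K r.
Proof.
  intros G Ht Kt.
  destruct (good_next (- t) (good_rev G)) as (s & Ps & Hs & H).
  - lra.
  - rewrite Ropp_involutive; assumption.
  - exists (- s). split; [assumption|]. split; [lra|].
    intros r Hr. specialize (H (- r) ltac:(lra)). rewrite Ropp_involutive in H. assumption.
Qed.
Arguments good_prev {lo hi P K}.

Definition consec (P K : R -> Prop) (r r' : R) : Prop :=
  P r /\ P r' /\ r < r' /\ forall s, r < s < r' -> ~ P s /\ ~ K s.

Lemma good_next_consec lo hi P K t : good lo hi P K -> P t -> t < hi ->
  exists s, consec P K t s.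
Proof.
  intros G Pt Ht. pose proof (good_P G _ Pt).
  destruct (good_next t G) as (s & Ps & Hs & H1); [lra| |].
  - intro. eapply good_dis; eauto.
  - exists s. repeat split; auto; apply H1; assumption.
Qed.
Arguments good_next_consec {lo hi P K}.

Lemma good_around lo hi P K t : good lo hi P K -> lo <= t <= hi -> ~ K t -> ~ P t ->
  exists l r, consec P K l r /\ l < t < r.
Proof.
  intros G Ht Kt Pt.
  assert (t <> lo) by (intros ->; destruct (good_lo G); contradiction).
  assert (t <> hi) by (intros ->; destruct (good_hi G); contradiction).
  destruct (good_next t G ltac:(lra) Kt) as (r & Pr & Hr & H1).
  destruct (good_prev t G ltac:(lra) Kt) as (l & Pl & Hl & H2).
  exists l, r. split; [|lra]. repeat split; auto; try lra;
  (destruct (Rtotal_order s t) as [|[->|]]; [apply H2; lra|assumption|apply H1; lra]).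
Qed.
Arguments good_around {lo hi P K}.

(** * Expanding marked points into finite blocks of vertices *)

Section Blocks.
Variables (V : Type) (lo hi : R) (P K : R -> Prop) (blk : R -> list V) (H : V -> V -> Prop).
Hypothesis G : good lo hi P K.
(** Blocks may be empty, but never two in a row, so that neighbours in the expansion stay within two
    marks of each other. Slots lie to the right of their mark, so a last block with several vertices
    would leave the interval. *)
Hypothesis blk_two : forall r r', consec P K r r' -> blk r = [] -> blk r' = [] -> False.
Hypothesis blk_lo : P lo -> blk lo <> [].
Hypothesis blk_hi : P hi -> length (blk hi) = 1%nat.

Definition gap (r : R) : R := epsilon (inhabits 0) (fun d => 0 < d /\
  forall s, Rabs (s - r) < d -> s <> r -> ~ P s /\ ~ K s).

Lemma gap_spec r : P r -> 0 < gap r /\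
  forall s, Rabs (s - r) < gap r -> s <> r -> ~ P s /\ ~ K s.
Proof.
  intros Pr. unfold gap. apply epsilon_spec.
  apply (good_iso G); [apply (good_P G _ Pr)|].
  intro. eapply good_dis; eauto.
Qed.

Lemma gap_le r s : P r -> P s \/ K s -> r < s -> r + gap r <= s.
Proof.
  intros Pr Hs Hlt. destruct (gap_spec r Pr) as [_ Hg].
  apply Rnot_lt_le; intro. destruct (Hg s) as [? ?]; [apply Rabs_def1; lra|lra|].
  tauto.
Qed.

Lemma gap_le' r s : P r -> P s \/ K s -> s < r -> s + gap r <= r.
Proof.
  intros Pr Hs Hlt. destruct (gap_spec r Pr) as [_ Hg].
  apply Rnot_lt_le; intro. destruct (Hg s) as [? ?]; [apply Rabs_def1; lra|lra|].
  tauto.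
Qed.

(** A block occupies the first third of the gap after its mark. The remaining two thirds keep it
    away from the next mark and bound its displacement by its distance to [K], as [slot_near]
    needs. *)
Definition slot (r : R) (j : nat) : R := r + gap r / 3 * (INR j / INR (length (blk r))).

Lemma slot_0 r : slot r 0 = r.
Proof. unfold slot. simpl INR. unfold Rdiv. ring. Qed.

Lemma slot_mono r i j : P r -> (i < j)%nat -> (j < length (blk r))%nat -> slot r i < slot r j.
Proof.
  intros Pr Hij Hj. destruct (gap_spec r Pr) as [Hg _].
  assert (0 < INR (length (blk r))) by (apply lt_0_INR; lia).
  apply lt_INR in Hij. unfold slot.
  apply Rplus_lt_compat_l, Rmult_lt_compat_l; [lra|].
  apply Rmult_lt_compat_r; [apply Rinv_0_lt_compat; assumption|assumption].
Qed.

Lemma slot_bounds r j : P r -> (j < length (blk r))%nat -> r <= slot r j < r + gap r / 3.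
Proof.
  intros Pr Hj. destruct (gap_spec r Pr) as [Hg _].
  assert (Hn : 0 < INR (length (blk r))) by (apply lt_0_INR; lia).
  pose proof (pos_INR j). apply lt_INR in Hj.
  assert (0 <= INR j / INR (length (blk r)) < 1).
  { split.
    - apply Rmult_le_pos; [assumption|]. left. apply Rinv_0_lt_compat; assumption.
    - apply Rmult_lt_reg_r with (INR (length (blk r))); [assumption|].
      unfold Rdiv. rewrite Rmult_assoc, Rinv_l by lra. lra. }
  unfold slot. nra.
Qed.

Lemma slot_lt r r' j j' : P r -> P r' -> r < r' ->
  (j < length (blk r))%nat -> (j' < length (blk r'))%nat -> slot r j < slot r' j'.
Proof.
  intros Pr Pr' Hlt Hj Hj'.
  pose proof (slot_bounds r j Pr Hj). pose proof (slot_bounds r' j' Pr' Hj').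
  pose proof (gap_le r r' Pr (or_introl Pr') Hlt). pose proof (proj1 (gap_spec r Pr)). lra.
Qed.

Lemma slot_inj r r' j j' : P r -> P r' ->
  (j < length (blk r))%nat -> (j' < length (blk r'))%nat -> slot r j = slot r' j' ->
  r = r' /\ j = j'.
Proof.
  intros Pr Pr' Hj Hj' E.
  destruct (Rtotal_order r r') as [L|[->|L]].
  - pose proof (slot_lt r r' j j' Pr Pr' L Hj Hj'). lra.
  - split; [reflexivity|]. destruct (Nat.lt_trichotomy j j') as [L|[L|L]]; [|assumption|].
    + pose proof (slot_mono r' j j' Pr L Hj'). lra.
    + pose proof (slot_mono r' j' j Pr L Hj). lra.
  - pose proof (slot_lt r' r j' j Pr' Pr L Hj' Hj). lra.
Qed.

(** If [r] lies left of [k], its whole gap fits before [k], so the slot has moved by less than a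
    third of the gap and is still more than two thirds away; this leaves room for the factor 2. *)
Lemma slot_near r j k d : P r -> K k -> (j < length (blk r))%nat ->
  Rabs (slot r j - k) < d -> Rabs (r - k) < 2 * d.
Proof.
  intros Pr Kk Hj Hd. pose proof (slot_bounds r j Pr Hj).
  apply Rabs_def2 in Hd. destruct (Rtotal_order r k) as [L|[->|L]].
  - pose proof (gap_le r k Pr (or_intror Kk) L). apply Rabs_def1; lra.
  - exfalso; eapply good_dis; eauto.
  - apply Rabs_def1; lra.
Qed.

Definition member (t : R) : Prop :=
  exists r j, P r /\ (j < length (blk r))%nat /\ t = slot r j.

Lemma member_first r : P r -> blk r <> [] -> member r.
Proof.
  intros Pr Hr. exists r, 0%nat. rewrite slot_0. repeat split; auto.
  destruct (blk r); [contradiction|simpl; lia].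
Qed.

Lemma member_range t : member t -> lo <= t <= hi.
Proof.
  intros (r & j & Pr & Hj & ->). pose proof (good_P G _ Pr) as Hr.
  pose proof (slot_bounds r j Pr Hj) as Hs. split; [lra|].
  destruct (Req_dec r hi) as [->|Hne].
  - rewrite (blk_hi Pr) in Hj. replace j with 0%nat by lia. rewrite slot_0. lra.
  - pose proof (gap_le r hi Pr (good_hi G) ltac:(lra)).
    pose proof (proj1 (gap_spec r Pr)). lra.
Qed.

Lemma member_not_K t : member t -> K t -> False.
Proof.
  intros (r & j & Pr & Hj & ->) Hk. pose proof (slot_bounds r j Pr Hj) as Hs.
  destruct (Req_dec (slot r j) r) as [E|E].
  - rewrite E in Hk. eapply good_dis; eauto.
  - pose proof (gap_le r _ Pr (or_intror Hk) ltac:(lra)).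
    pose proof (proj1 (gap_spec r Pr)). lra.
Qed.

(** Earlier blocks end well before the last mark [r] up to [t], and later ones start at [u] or
    beyond, so close to [t] only the finitely many slots of [r] occur. *)
Lemma member_iso t : lo <= t <= hi -> ~ K t -> exists d, 0 < d /\
  forall s, Rabs (s - t) < d -> s <> t -> ~ member s /\ ~ K s.
Proof.
  intros Ht Kt.
  assert (exists r, P r /\ r <= t /\ forall s, r < s <= t -> ~ P s) as (r & Pr & Hrt & Hr).
  { destruct (classic (P t)) as [Pt|Pt].
    - exists t. split; [assumption|split; [lra|]]. intros s Hs; lra.
    - destruct (good_around t G Ht Kt Pt) as (l & r & (Pl & Pr & Hlr & Hc) & Hlt).
      exists l. split; [assumption|split; [lra|]]. intros s Hs.
      destruct (Req_dec s t) as [->|]; [assumption|apply Hc; lra]. }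
  assert (exists u, t < u /\ forall s, t < s < u -> ~ P s) as (u & Hu & Hup).
  { destruct (Req_dec t hi) as [->|Hne].
    - exists (hi + 1). split; [lra|]. intros s Hs Ps. apply (good_P G) in Ps. lra.
    - destruct (good_next t G ltac:(lra) Kt) as (u & Pu & Hu & Hn).
      exists u. split; [assumption|]. intros s Hs. apply Hn; assumption. }
  destruct (good_iso G t Ht Kt) as (d0 & Hd0 & Hiso).
  destruct (list_isolated (map (slot r) (seq 0 (length (blk r)))) t) as (d1 & Hd1 & Hl).
  destruct (gap_spec r Pr) as [Hg _].
  exists (Rmin (Rmin d0 d1) (Rmin (gap r / 3) (u - t))). split.
  { repeat apply Rmin_pos; lra. }
  intros s Hs Hst.
  assert (Hs' : Rabs (s - t) < d0 /\ Rabs (s - t) < d1 /\ Rabs (s - t) < gap r / 3 /\ Rabs (s - t) < u - t).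
  { revert Hs. generalize (Rabs (s - t)). intros z. unfold Rmin; repeat destruct Rle_dec; lra. }
  destruct Hs' as (Hs0 & Hs1 & Hs2 & Hs3).
  split; [|apply Hiso; assumption].
  intros (r' & j & Pr' & Hj & ->).
  apply Rabs_def2 in Hs2. apply Rabs_def2 in Hs3.
  pose proof (slot_bounds r' j Pr' Hj) as Hb.
  destruct (Rtotal_order r' r) as [L|[->|L]].
  - pose proof (gap_le r' r Pr' (or_introl Pr) L).
    pose proof (gap_le' r r' Pr (or_introl Pr') L). lra.
  - apply Hst, Hl; [|assumption]. apply in_map, in_seq. lia.
  - destruct (Rle_dec u r') as [L'|L']; [lra|].
    destruct (Rle_dec r' t) as [M|M].
    + apply (Hr r'); [lra|assumption].
    + apply (Hup r'); [lra|assumption].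
Qed.

(** The mark found near [k] may carry an empty block. The mark before it then carries a nonempty one
    and still lies right of [k], since no point of [K] separates consecutive marks. *)
Lemma member_accr k e : K k -> k < hi -> 0 < e -> exists s, member s /\ k < s < k + e.
Proof.
  intros Kk Hk He. destruct (good_accr G k e Kk Hk He) as (s & Ps & Hs).
  destruct (classic (blk s = [])) as [E|E].
  2: { exists s. split; [apply member_first; assumption|lra]. }
  pose proof (good_K G _ Kk).
  destruct (good_prev s G) as (u & Pu & Hu & Hc).
  { split; [lra|]. apply (good_P G _ Ps). }
  { intro. eapply good_dis; eauto. }
  assert (k < u).
  { apply Rnot_le_lt. intro L. destruct (Req_dec u k) as [->|].
    - eapply good_dis; eauto.
    - exact (proj2 (Hc k ltac:(lra)) Kk). }
  exists u. split; [|lra]. apply member_first; [assumption|]. intro E'.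
  apply (blk_two u s); [|assumption|assumption]. repeat split; auto; apply Hc; assumption.
Qed.

Lemma member_accl k e : K k -> lo < k -> 0 < e -> exists s, member s /\ k - e < s < k.
Proof.
  intros Kk Hk He. destruct (good_accl G k e Kk Hk He) as (s & Ps & Hs).
  destruct (classic (blk s = [])) as [E|E].
  2: { exists s. split; [apply member_first; assumption|lra]. }
  pose proof (good_K G _ Kk).
  destruct (good_next_consec s G Ps ltac:(lra)) as (u & Hc).
  pose proof Hc as (_ & Pu & Hu & Hn).
  assert (u < k).
  { apply Rnot_le_lt. intro L. destruct (Req_dec u k) as [->|].
    - eapply good_dis; eauto.
    - exact (proj2 (Hn k ltac:(lra)) Kk). }
  exists u. split; [|lra]. apply member_first; [assumption|]. intro E'.
  apply (blk_two s u); assumption.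
Qed.

Lemma good_member : good lo hi member K.
Proof.
  constructor.
  - apply (good_le G).
  - apply member_range.
  - apply (good_K G).
  - apply member_not_K.
  - destruct (good_lo G); [left; apply member_first; auto|right; assumption].
  - destruct (good_hi G) as [Ph|Kh]; [left; apply member_first; auto|right; assumption].
    intro E. pose proof (blk_hi Ph) as L. rewrite E in L. discriminate.
  - apply member_iso.
  - intros; apply member_accr; assumption.
  - intros; apply member_accl; assumption.
Qed.

Variable v0 : V.
Definition lab (t : R) : V := epsilon (inhabits v0) (fun v =>
  exists r j, P r /\ t = slot r j /\ nth_error (blk r) j = Some v).

Lemma lab_slot r j v : P r -> nth_error (blk r) j = Some v -> lab (slot r j) = v.
Proof.
  intros Pr Hv. unfold lab.
  match goal with |- epsilon ?i ?Q = _ => pose proof (epsilon_spec i Q) as Hs end.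
  destruct Hs as (r' & j' & Pr' & E & Hv').
  { exists v, r, j. auto. }
  destruct (slot_inj r r' j j') as [<- <-]; auto.
  - apply nth_error_Some. congruence.
  - apply nth_error_Some. congruence.
  - congruence.
Qed.

Lemma member_lab t : member t -> exists r j,
  P r /\ t = slot r j /\ nth_error (blk r) j = Some (lab t).
Proof.
  intros (r & j & Pr & Hj & ->).
  destruct (nth_error (blk r) j) as [v|] eqn:E.
  - exists r, j. rewrite (lab_slot r j v); auto.
  - apply nth_error_Some in Hj. contradiction.
Qed.

Hypothesis adj_in : forall r j x y, P r ->
  nth_error (blk r) j = Some x -> nth_error (blk r) (S j) = Some y -> H x y.
Hypothesis adj_next : forall r r' l x y l', consec P K r r' ->
  blk r = l ++ [x] -> blk r' = y :: l' -> H x y.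
Hypothesis adj_skip : forall r r' r'' l x y l', consec P K r r' -> consec P K r' r'' ->
  blk r = l ++ [x] -> blk r' = [] -> blk r'' = y :: l' -> H x y.

(** Consecutive slots lie in one block, in consecutive blocks, or on both sides of a single empty
    block. [blk_two] excludes anything else, so the three adjacency hypotheses suffice. *)
Lemma member_adj t t' : consec member K t t' -> H (lab t) (lab t').
Proof.
  intros (Mt & Mt' & Hlt & Hn).
  destruct (member_lab t Mt) as (r & j & Pr & Et & Ht).
  destruct (member_lab t' Mt') as (r' & j' & Pr' & Et' & Ht').
  assert (Hj : (j < length (blk r))%nat) by (apply nth_error_Some; congruence).
  assert (Hj' : (j' < length (blk r'))%nat) by (apply nth_error_Some; congruence).
  assert (Hbet : forall s i, P s -> (i < length (blk s))%nat -> t < slot s i -> slot s i < t' -> False).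
  { intros s i Ps Hi H1 H2. apply (proj1 (Hn (slot s i) (conj H1 H2))). exists s, i; auto. }
  destruct (Rtotal_order r r') as [L|[<-|L]].
  - assert (Ej : j = (length (blk r) - 1)%nat).
    { destruct (Nat.eq_dec j (length (blk r) - 1)) as [|N]; [assumption|exfalso].
      apply (Hbet r (S j)); auto; try lia; subst t t'.
      - apply slot_mono; auto; lia.
      - apply slot_lt; auto; lia. }
    assert (Ej' : j' = 0%nat).
    { destruct j'; [reflexivity|exfalso]. apply (Hbet r' 0%nat); auto; try lia; subst t t'.
      - apply slot_lt; auto; lia.
      - apply slot_mono; auto; lia. }
    assert (exists l, blk r = l ++ [lab t]) as [l El].
    { destruct (blk r) as [|z q] using rev_ind; [simpl in Hj; lia|].
      rewrite length_app in Ej. simpl in Ej. subst j.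
      replace (length q + 1 - 1)%nat with (length q) in Ht by lia.
      rewrite nth_error_app2, Nat.sub_diag in Ht by lia. simpl in Ht.
      exists q. congruence. }
    assert (exists l, blk r' = lab t' :: l) as [l' El'].
    { subst j'. destruct (blk r') as [|z q]; [discriminate|]. simpl in Ht'. exists q. congruence. }
    pose proof (good_P G _ Pr'). 
    destruct (good_next_consec r G Pr ltac:(lra)) as (n & Hc).
    pose proof Hc as (_ & Pn & Hrn & Hcn).
    assert (Hnr : n <= r').
    { apply Rnot_lt_le; intro. exact (proj1 (Hcn r' ltac:(lra)) Pr'). }
    destruct (Req_dec n r') as [->|Hne].
    { eapply adj_next; eauto. }
    assert (Hfirst : forall s, P s -> r < s < r' -> blk s = []).
    { intros s Ps Hs. destruct (blk s) as [|z q] eqn:Es; [reflexivity|exfalso].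
      apply (Hbet s 0%nat Ps); [rewrite Es; simpl; lia| |]; subst t t'; apply slot_lt; auto;
        try lra; rewrite Es; simpl; lia. }
    destruct (good_next_consec n G Pn ltac:(lra)) as (n2 & Hc2).
    pose proof Hc2 as (_ & Pn2 & Hrn2 & Hcn2).
    assert (Hnr2 : n2 <= r').
    { apply Rnot_lt_le; intro. exact (proj1 (Hcn2 r' ltac:(lra)) Pr'). }
    destruct (Req_dec n2 r') as [->|Hne2].
    { apply (adj_skip r n r' l _ _ l' Hc Hc2 El); [apply Hfirst; [assumption|lra]|assumption]. }
    exfalso. apply (blk_two n n2 Hc2); apply Hfirst; auto; lra.
  - assert (j < j')%nat.
    { destruct (Nat.lt_trichotomy j j') as [M|[M|M]]; [assumption|subst; lra|].
      pose proof (slot_mono r j' j Pr M Hj). lra. }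
    destruct (Nat.eq_dec j' (S j)) as [->|N].
    + eapply adj_in; eauto.
    + exfalso. apply (Hbet r (S j)); auto; try lia; subst t t'; apply slot_mono; auto; lia.
  - pose proof (slot_lt r' r j' j Pr' Pr L Hj' Hj). lra.
Qed.

End Blocks.

(** * Points of the 1-complex *)

Definition vpt {V : Type} (v x : V) : R :=
  if excluded_middle_informative (x = v) then 1 else 0.

Definition mix {V : Type} (l : R) (u v x : V) : R := l * vpt u x + (1 - l) * vpt v x.

Section Points.
Variable V : Type.
Implicit Types (u v w x : V) (g : V -> R).

Lemma vpt_same v : vpt v v = 1.
Proof. unfold vpt; destruct excluded_middle_informative; congruence. Qed.

Lemma vpt_other v x : x <> v -> vpt v x = 0.
Proof. intro; unfold vpt; destruct excluded_middle_informative; congruence. Qed.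

Lemma vpt_01 v x : vpt v x = 0 \/ vpt v x = 1.
Proof. unfold vpt; destruct excluded_middle_informative; auto. Qed.

Lemma is_vpt_vpt v : is_vpt (vpt v) v.
Proof. split; [apply vpt_same|apply vpt_other]. Qed.

Lemma is_vpt_eq g v : is_vpt g v -> g = vpt v.
Proof.
  intros [H1 H2]. extensionality x. destruct (classic (x = v)) as [->|N].
  - rewrite vpt_same; assumption.
  - rewrite vpt_other, H2; auto.
Qed.

Lemma vpt_inj v w : vpt v = vpt w -> v = w.
Proof.
  intro E. apply NNPP; intro N. assert (vpt v v = vpt w v) by congruence.
  rewrite vpt_same, vpt_other in H by assumption. lra.
Qed.

Lemma mix_1 u v : mix 1 u v = vpt u.
Proof. extensionality x. unfold mix. ring. Qed.

Lemma mix_0 u v : mix 0 u v = vpt v.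
Proof. extensionality x. unfold mix. ring. Qed.

Lemma mix_sym l u v : mix l u v = mix (1 - l) v u.
Proof. extensionality x. unfold mix. ring. Qed.

Lemma mix_l l u v : u <> v -> mix l u v u = l.
Proof. intro. unfold mix. rewrite vpt_same, vpt_other by assumption. ring. Qed.

Lemma mix_r l u v : u <> v -> mix l u v v = 1 - l.
Proof. intro. unfold mix. rewrite vpt_same, (vpt_other u) by auto. ring. Qed.

Lemma mix_out l u v x : x <> u -> x <> v -> mix l u v x = 0.
Proof. intros. unfold mix. rewrite !vpt_other by assumption. ring. Qed.

Lemma is_ept_mix l u v : u <> v -> 0 < l < 1 -> is_ept (mix l u v) u v.
Proof.
  intros N Hl. repeat split; auto.
  - rewrite mix_l by assumption. lra.
  - rewrite mix_r by assumption. lra.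
  - rewrite mix_l, mix_r by assumption. lra.
  - intros. apply mix_out; assumption.
Qed.

Lemma is_ept_eq g u v : is_ept g u v -> g = mix (g u) u v /\ 0 < g u < 1.
Proof.
  intros (N & H1 & H2 & H3 & H4). split; [|lra]. extensionality x.
  destruct (classic (x = u)) as [->|Nu]; [rewrite mix_l; auto|].
  destruct (classic (x = v)) as [->|Nv]; [rewrite mix_r by auto; lra|].
  rewrite mix_out, H4; auto.
Qed.

Lemma mix_dist l l' u v x : Rabs (mix l u v x - mix l' u v x) <= Rabs (l - l').
Proof.
  replace (mix l u v x - mix l' u v x) with ((l - l') * (vpt u x - vpt v x)) by (unfold mix; ring).
  rewrite Rabs_mult. rewrite <- (Rmult_1_r (Rabs (l - l'))) at 2.
  apply Rmult_le_compat_l; [apply Rabs_pos|].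
  destruct (vpt_01 u x) as [-> | ->]; destruct (vpt_01 v x) as [-> | ->];
    unfold Rabs; destruct Rcase_abs; lra.
Qed.

Lemma pt1_vpt (H : V -> V -> Prop) v : pt1 H (vpt v).
Proof. left. exists v. apply is_vpt_vpt. Qed.

Lemma pt1_mix (H : V -> V -> Prop) l u v : u <> v -> H u v -> 0 <= l <= 1 -> pt1 H (mix l u v).
Proof.
  intros N Huv Hl. destruct (Req_dec l 0) as [->|]; [rewrite mix_0; apply pt1_vpt|].
  destruct (Req_dec l 1) as [->|]; [rewrite mix_1; apply pt1_vpt|].
  right. exists u, v. split; [assumption|]. apply is_ept_mix; [assumption|lra].
Qed.

End Points.

Lemma compS_adj {V : Type} (H : V -> V -> Prop) (S : list V) c x y :
  compS H S c x -> ~ In x S -> H x y -> ~ In y S -> compS H S c y.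
Proof.
  intros [Hc Hx] Nx Hxy Ny. split; [assumption|].
  eapply rt_trans; [eassumption|]. apply rt_step. repeat split; assumption.
Qed.

Lemma compS_notin {V : Type} (H : V -> V -> Prop) (S : list V) c x :
  compS H S c x -> ~ In x S.
Proof.
  intros [Hc Hx]. apply clos_rt_rtn1 in Hx. destruct Hx as [|y z [_ [_ Hy]]]; assumption.
Qed.

(** * Closed curves through prescribed vertices and ends *)

(** Continuity of the inverse is left out: [closed_curve_circle] recovers it from compactness and
    the Hausdorff property. *)
Definition closed_curve {V : Type} (H : V -> V -> Prop) (lo hi : R) (g : R -> Pt V) : Prop :=
  lo < hi /\ g lo = g hi /\
  (forall t, lo <= t <= hi -> inH V H (g t)) /\
  (forall t N, lo <= t <= hi -> nb V H (g t) N -> exists d, 0 < d /\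
     forall s, lo <= s <= hi -> Rabs (s - t) < d -> N (g s)) /\
  (forall s t, lo <= s < hi -> lo <= t < hi -> g s = g t -> s = t).

Section Curve.
Variables (V : Type) (H : V -> V -> Prop) (lo hi : R) (P K : R -> Prop).
Variables (lab : R -> V) (e : R -> (nat -> V) -> Prop).
Hypothesis Hsym : forall u v, H u v -> H v u.
Hypothesis Hirr : forall v, ~ H v v.
Hypothesis G : good lo hi P K.
Hypothesis lohi : lo < hi.
Hypothesis lab_adj : forall r r', consec P K r r' -> H (lab r) (lab r').
Hypothesis lab_inj : forall s t, P s -> P t -> s < hi -> t < hi -> lab s = lab t -> s = t.
Hypothesis e_end : forall t, K t -> is_end H (e t).
Hypothesis e_inj : forall s t, K s -> K t -> s < hi -> t < hi -> e s = e t -> s = t.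
Hypothesis closing : (P lo /\ P hi /\ lab lo = lab hi) \/ (K lo /\ K hi /\ e lo = e hi).
Hypothesis third : forall x y, exists r, P r /\ lab r <> x /\ lab r <> y.
Hypothesis conv : forall k S c, K k ->
  (forall r, e k r -> Defs.eventually (fun m => compS H S c (r m))) ->
  exists d, 0 < d /\ (forall s, P s -> Rabs (s - k) < d -> compS H S c (lab s)) /\
    (forall s, K s -> Rabs (s - k) < d -> region V H S c (EndP (e s))).

Definition around (t : R) : R * R :=
  epsilon (inhabits (0, 0)) (fun lr => consec P K (fst lr) (snd lr) /\ fst lr < t < snd lr).

Definition curve (t : R) : Pt V :=
  if excluded_middle_informative (K t) then EndP (e t)
  else if excluded_middle_informative (P t) then Inner (vpt (lab t))
  else let (l, r) := around t in Inner (mix ((r - t) / (r - l)) (lab l) (lab r)).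

Lemma curve_K t : K t -> curve t = EndP (e t).
Proof. intro. unfold curve. destruct excluded_middle_informative; [reflexivity|contradiction]. Qed.

Lemma curve_P t : P t -> curve t = Inner (vpt (lab t)).
Proof.
  intro Pt. unfold curve. destruct excluded_middle_informative as [k|].
  - exfalso. eapply good_dis; eauto.
  - destruct excluded_middle_informative; [reflexivity|contradiction].
Qed.

Lemma consec_unique l r l' r' t : consec P K l r -> consec P K l' r' ->
  l < t < r -> l' < t < r' -> l = l' /\ r = r'.
Proof.
  intros (Pl & Pr & L & C) (Pl' & Pr' & L' & C') Ht Ht'. split.
  - destruct (Rtotal_order l l') as [M|[M|M]]; [|assumption|].
    + exfalso. exact (proj1 (C l' ltac:(lra)) Pl').
    + exfalso. exact (proj1 (C' l ltac:(lra)) Pl).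
  - destruct (Rtotal_order r r') as [M|[M|M]]; [|assumption|].
    + exfalso. exact (proj1 (C' r ltac:(lra)) Pr).
    + exfalso. exact (proj1 (C r' ltac:(lra)) Pr').
Qed.

Lemma curve_consec l r t : consec P K l r -> l <= t <= r ->
  curve t = Inner (mix ((r - t) / (r - l)) (lab l) (lab r)).
Proof.
  intros C Ht. pose proof C as (Pl & Pr & L & Hn).
  destruct (Req_dec t l) as [->|Nl].
  { rewrite curve_P by assumption. replace ((r - l) / (r - l)) with 1 by (field; lra).
    rewrite mix_1. reflexivity. }
  destruct (Req_dec t r) as [->|Nr].
  { rewrite curve_P by assumption. replace ((r - r) / (r - l)) with 0 by (field; lra).
    rewrite mix_0. reflexivity. }
  destruct (Hn t ltac:(lra)) as [NP NK]. unfold curve.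
  destruct excluded_middle_informative; [contradiction|].
  destruct excluded_middle_informative; [contradiction|].
  unfold around.
  match goal with |- context [epsilon ?i ?Q] => pose proof (epsilon_spec i Q) as Hs end.
  destruct Hs as [C' Ht'].
  { exists (l, r). simpl. split; [assumption|lra]. }
  destruct (epsilon _ _) as [l' r']. simpl in *.
  destruct (consec_unique l r l' r' t C C' ltac:(lra) Ht') as [<- <-]. reflexivity.
Qed.

Lemma consec_range l r : consec P K l r -> lo <= l /\ l < r /\ r <= hi.
Proof.
  intros (Pl & Pr & L & _). apply (good_P G) in Pl, Pr. lra.
Qed.

Lemma consec_ne l r : consec P K l r -> lab l <> lab r.
Proof. intros C E. apply (Hirr (lab l)). rewrite E at 2. apply lab_adj; assumption. Qed.

Lemma consec_right t : lo <= t < hi -> ~ K t -> exists l r, consec P K l r /\ l <= t < r.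
Proof.
  intros Ht Kt. destruct (classic (P t)) as [Pt|Pt].
  - destruct (good_next_consec t G Pt ltac:(lra)) as (r & C).
    exists t, r. split; [assumption|]. destruct C as (_ & _ & ? & _). lra.
  - destruct (good_around t G ltac:(lra) Kt Pt) as (l & r & C & Hlr).
    exists l, r. split; [assumption|lra].
Qed.

Lemma consec_left t : lo < t <= hi -> ~ K t -> exists l r, consec P K l r /\ l < t <= r.
Proof.
  intros Ht Kt. destruct (classic (P t)) as [Pt|Pt].
  - destruct (good_prev t G ltac:(lra) Kt) as (l & Pl & L & Hn).
    exists l, t. split; [|lra]. repeat split; auto; apply Hn; assumption.
  - destruct (good_around t G ltac:(lra) Kt Pt) as (l & r & C & Hlr).
    exists l, r. split; [assumption|lra].
Qed.

Lemma curve_inH t : lo <= t <= hi -> inH V H (curve t).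
Proof.
  intro Ht. destruct (classic (K t)) as [Kt|Kt].
  { rewrite curve_K by assumption. simpl. auto. }
  destruct (classic (P t)) as [Pt|Pt].
  { rewrite curve_P by assumption. apply pt1_vpt. }
  destruct (good_around t G Ht Kt Pt) as (l & r & C & Hlr).
  rewrite (curve_consec l r t C) by lra. apply pt1_mix.
  - apply consec_ne; assumption.
  - apply lab_adj; assumption.
  - split.
    + apply Rmult_le_pos; [lra|]. left; apply Rinv_0_lt_compat; lra.
    + apply Rmult_le_reg_r with (r - l); [lra|].
      unfold Rdiv; rewrite Rmult_assoc, Rinv_l by lra; lra.
Qed.

Lemma curve_lip l r s t x g h : consec P K l r -> l <= s <= r -> l <= t <= r ->
  curve s = Inner g -> curve t = Inner h -> Rabs (h x - g x) * (r - l) <= Rabs (s - t).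
Proof.
  intros C Hs Ht Eg Eh. pose proof (consec_range l r C).
  rewrite (curve_consec l r s C Hs) in Eg. rewrite (curve_consec l r t C Ht) in Eh.
  injection Eg as <-. injection Eh as <-.
  pose proof (mix_dist V ((r - t) / (r - l)) ((r - s) / (r - l)) (lab l) (lab r) x) as D.
  replace ((r - t) / (r - l) - (r - s) / (r - l)) with ((s - t) * / (r - l)) in D by (field; lra).
  rewrite Rabs_mult, (Rabs_right (/ (r - l))) in D
    by (left; apply Rinv_0_lt_compat; lra).
  apply Rmult_le_compat_r with (r := r - l) in D; [|lra].
  rewrite Rmult_assoc, Rinv_l, Rmult_1_r in D by lra. assumption.
Qed.

Lemma curve_cont_inner t N : lo <= t <= hi -> ~ K t -> nb V H (curve t) N ->
  exists d, 0 < d /\ forall s, lo <= s <= hi -> Rabs (s - t) < d -> N (curve s).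
Proof.
  intros Ht Kt HN.
  assert (exists h, curve t = Inner h) as [h Eh].
  { unfold curve. destruct excluded_middle_informative; [contradiction|].
    destruct excluded_middle_informative; [eauto|]. destruct around; eauto. }
  rewrite Eh in HN. destruct HN as (eps & He & ->).
  (* On a closed gap the curve is Lipschitz with constant [1 / (r - l)]. The time [t] lies in at
     most one such gap on each side, so two radii are combined. *)
  assert (side : forall l r, consec P K l r -> l <= t <= r -> exists d, 0 < d /\
    forall s, l <= s <= r -> Rabs (s - t) < d ->
    match curve s with Inner g => pt1 H g /\ forall x, Rabs (h x - g x) < eps | EndP _ => False end).
  { intros l r C Hlr. pose proof (consec_range l r C).
    exists (eps * (r - l)). split; [apply Rmult_lt_0_compat; lra|].
    intros s Hs Hst. pose proof (curve_inH s ltac:(lra)) as Hin.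
    pose proof (curve_consec l r s C Hs) as Es. rewrite Es in *. split; [exact Hin|].
    intro x. pose proof (curve_lip l r s t x _ _ C Hs Hlr Es Eh) as D.
    apply Rmult_lt_reg_r with (r - l); [lra|].  eapply Rle_lt_trans; eassumption. }
  assert (exists d, 0 < d /\ forall s, t <= s <= hi -> Rabs (s - t) < d ->
    match curve s with Inner g => pt1 H g /\ forall x, Rabs (h x - g x) < eps | EndP _ => False end)
    as (d1 & Hd1 & H1).
  { destruct (Req_dec t hi) as [E|Nh].
    - exists 1. split; [lra|]. intros s Hs _. replace s with t by lra. rewrite Eh.
      pose proof (curve_inH t Ht) as Hin. rewrite Eh in Hin. split; [exact Hin|].
      intro x. unfold Rminus. rewrite Rplus_opp_r, Rabs_R0. assumption.
    - destruct (consec_right t ltac:(lra) Kt) as (l & r & C & Hlr).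
      destruct (side l r C ltac:(lra)) as (d & Hd & Hs).
      exists (Rmin d (r - t)). split; [apply Rmin_pos; lra|].
      intros s Hs1 Hs2. pose proof (Rmin_l d (r - t)). pose proof (Rmin_r d (r - t)).
      apply Hs; [|lra]. apply Rabs_def2 in Hs2. lra. }
  assert (exists d, 0 < d /\ forall s, lo <= s <= t -> Rabs (s - t) < d ->
    match curve s with Inner g => pt1 H g /\ forall x, Rabs (h x - g x) < eps | EndP _ => False end)
    as (d2 & Hd2 & H2).
  { destruct (Req_dec t lo) as [E|Nh].
    - exists d1. split; [assumption|]. intros s Hs Hd. apply H1; [lra|assumption].
    - destruct (consec_left t ltac:(lra) Kt) as (l & r & C & Hlr).
      destruct (side l r C ltac:(lra)) as (d & Hd & Hs).
      exists (Rmin d (t - l)). split; [apply Rmin_pos; lra|].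
      intros s Hs1 Hs2. pose proof (Rmin_l d (t - l)). pose proof (Rmin_r d (t - l)).
      apply Hs; [|lra]. apply Rabs_def2 in Hs2. lra. }
  exists (Rmin d1 d2). split; [apply Rmin_pos; assumption|].
  intros s Hs Hst. pose proof (Rmin_l d1 d2). pose proof (Rmin_r d1 d2).
  destruct (Rle_dec t s); [apply H1|apply H2]; lra.
Qed.

(** Positive weight at one vertex of the component is enough: the other endpoint of the edge lies in
    the same component or in [S]. *)
Lemma region_mix S c l u v : H u v -> 0 < l <= 1 -> compS H S c u ->
  region V H S c (Inner (mix l u v)).
Proof.
  intros Huv Hl Hu. assert (N : u <> v) by (intros ->; eapply Hirr; eauto).
  split; [apply pt1_mix; auto; lra|]. split.
  - exists u. split; [rewrite mix_l by assumption; lra|assumption].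
  - intros x Hx. destruct (classic (x = u)) as [->|Nu]; [left; assumption|].
    destruct (classic (x = v)) as [->|Nv].
    + destruct (classic (In v S)) as [I|I]; [right; assumption|left].
      apply (compS_adj H S c u); auto. eapply compS_notin; eauto.
    + rewrite mix_out in Hx by assumption. lra.
Qed.

(** No gap contains the end time [t], so the endpoint of a gap on the side of [t] is at least as
    close to [t] as the point considered. Its label lies in the component, and [region_mix] carries
    this over to the edge. The extreme times [lo] and [hi] bound a gap on one side only and are
    treated apart. *)
Lemma curve_cont_end t N : lo <= t <= hi -> K t -> nb V H (curve t) N ->
  exists d, 0 < d /\ forall s, lo <= s <= hi -> Rabs (s - t) < d -> N (curve s).
Proof.
  intros Ht Kt HN. rewrite curve_K in HN by assumption.
  destruct HN as (S & c & Hc & ->).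
  destruct (conv t S c Kt Hc) as (d & Hd & HP & HK).
  exists d. split; [assumption|]. intros s Hs Hst.
  destruct (classic (K s)) as [Ks|Ks].
  { rewrite curve_K by assumption. auto. }
  assert (s <> t) by (intros ->; contradiction).
  apply Rabs_def2 in Hst.
  destruct (Rlt_dec t s) as [L|L].
  - destruct (classic (s = hi)) as [E|E].
    { subst s. destruct (good_hi G) as [Ph|Kh]; [|contradiction].
      rewrite curve_P by assumption.
      destruct (consec_left hi ltac:(lra) Ks) as (l & r & C & Hlr).
      pose proof (consec_range l r C). replace r with hi in * by lra.
      rewrite <- (mix_1 V _ (lab l)). apply region_mix; [|lra|].
      - apply Hsym, lab_adj; assumption.
      - apply HP; [assumption|]. apply Rabs_def1; lra. }
    destruct (consec_right s ltac:(lra) Ks) as (l & r & C & Hlr).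
    rewrite (curve_consec l r s C) by lra. pose proof C as (Pl & Pr & Llr & Hn).
    apply region_mix.
    + apply lab_adj; assumption.
    + split.
      * apply Rmult_lt_0_compat; [lra|]. apply Rinv_0_lt_compat; lra.
      * apply Rmult_le_reg_r with (r - l); [lra|].
        unfold Rdiv; rewrite Rmult_assoc, Rinv_l by lra; lra.
    + apply HP; [assumption|].
      assert (t < l).
      { destruct (Rtotal_order t l) as [M|[M|M]]; [assumption| |].
        - exfalso. subst l. exact (good_dis G t Pl Kt).
        - exfalso. exact (proj2 (Hn t ltac:(lra)) Kt). }
      apply Rabs_def1; lra.
  - destruct (classic (s = lo)) as [E|E].
    { subst s. destruct (good_lo G) as [Ph|Kh]; [|contradiction].
      rewrite curve_P by assumption.
      destruct (consec_right lo ltac:(lra) Ks) as (l & r & C & Hlr).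
      pose proof (consec_range l r C). replace l with lo in * by lra.
      rewrite <- (mix_1 V _ (lab r)). apply region_mix; [|lra|].
      - apply lab_adj; assumption.
      - apply HP; [assumption|]. apply Rabs_def1; lra. }
    destruct (consec_left s ltac:(lra) Ks) as (l & r & C & Hlr).
    rewrite (curve_consec l r s C) by lra. pose proof C as (Pl & Pr & Llr & Hn).
    rewrite mix_sym. apply region_mix.
    + apply Hsym, lab_adj; assumption.
    + replace (1 - (r - s) / (r - l)) with ((s - l) / (r - l)) by (field; lra). split.
      * apply Rmult_lt_0_compat; [lra|]. apply Rinv_0_lt_compat; lra.
      * apply Rmult_le_reg_r with (r - l); [lra|].
        unfold Rdiv; rewrite Rmult_assoc, Rinv_l by lra; lra.
    + apply HP; [assumption|].
      assert (r < t).
      { destruct (Rtotal_order r t) as [M|[M|M]]; [assumption| |].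
        - exfalso. subst r. exact (good_dis G t Pr Kt).
        - exfalso. exact (proj2 (Hn t ltac:(lra)) Kt). }
      apply Rabs_def1; lra.
Qed.

(** Left endpoints are below [hi], where labels are injective, so an edge read twice in the same
    direction is read in the same gap. Read in both directions, it would make the whole curve
    consist of two gaps over one edge, which a third vertex excludes. *)
Lemma consec_lab_unique l r l' r' : consec P K l r -> consec P K l' r' ->
  (lab l = lab l' /\ lab r = lab r') \/ (lab l = lab r' /\ lab r = lab l') -> l = l' /\ r = r'.
Proof.
  intros C C' HE. pose proof (consec_range _ _ C). pose proof (consec_range _ _ C').
  pose proof C as (Pl & Pr & L & Hn). pose proof C' as (Pl' & Pr' & L' & Hn').
  assert (same : lab l = lab l' -> l = l' /\ r = r').
  { intro E. assert (l = l') as <- by (apply lab_inj; auto; lra). split; [reflexivity|].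
    destruct (Rtotal_order r r') as [M|[M|M]]; [|assumption|].
    - exfalso. exact (proj1 (Hn' r ltac:(lra)) Pr).
    - exfalso. exact (proj1 (Hn r' ltac:(lra)) Pr'). }
  destruct HE as [[E _]|[E1 E2]]; [auto|].
  assert (two : forall m, consec P K lo m -> consec P K m hi -> P lo -> P hi -> lab lo = lab hi -> False).
  { intros m (_ & _ & M1 & Hm1) (_ & _ & M2 & Hm2) _ _ E.
    destruct (third (lab lo) (lab m)) as (q & Pq & N1 & N2).
    pose proof (good_P G _ Pq).
    destruct (Rtotal_order q m) as [M|[->|M]]; [|congruence|].
    - destruct (Req_dec q lo) as [->|]; [congruence|].
      exact (proj1 (Hm1 q ltac:(lra)) Pq).
    - destruct (Req_dec q hi) as [->|]; [congruence|].
      exact (proj1 (Hm2 q ltac:(lra)) Pq). }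
  assert (cl : P hi -> P lo /\ lab lo = lab hi).
  { intro Ph. destruct closing as [(?&?&?)|(_&Kh&_)]; [auto|].
    exfalso; eapply good_dis; eauto. }
  destruct (Req_dec r hi) as [Eh|Nh].
  - destruct (cl ltac:(subst; assumption)) as [Plo Elh]. subst r.
    assert (l' = lo) by (apply lab_inj; auto; [lra|congruence]). subst l'.
    destruct (Req_dec r' hi) as [->|Nh'].
    + apply same. congruence.
    + assert (l = r') by (apply lab_inj; auto; lra). subst r'. exfalso. eauto.
  - destruct (Req_dec r' hi) as [Eh'|Nh'].
    + destruct (cl ltac:(subst; assumption)) as [Plo Elh]. subst r'.
      assert (l = lo) by (apply lab_inj; auto; [lra|congruence]). subst l.
      assert (r = l') by (apply lab_inj; auto; lra). subst l'. exfalso; eauto.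
    + assert (l = r') by (apply lab_inj; auto; lra).
      assert (r = l') by (apply lab_inj; auto; lra). lra.
Qed.

Lemma curve_inj s t : lo <= s < hi -> lo <= t < hi -> curve s = curve t -> s = t.
Proof.
  assert (VE : forall l r q, P q -> q < hi -> consec P K l r -> forall x, l < x < r ->
            curve q = curve x -> False).
  { intros l r q Pq Hq C x Hx E. rewrite curve_P, (curve_consec l r x C) in E by (auto; lra).
    injection E as E. pose proof (consec_ne _ _ C) as N.
    assert (Hl : 0 < (r - x) / (r - l) < 1).
    { split; [apply Rmult_lt_0_compat; [lra|apply Rinv_0_lt_compat; lra]|].
      apply Rmult_lt_reg_r with (r - l); [lra|].
      unfold Rdiv; rewrite Rmult_assoc, Rinv_l by lra; lra. }
    assert (E1 : vpt (lab q) (lab l) = (r - x) / (r - l)) by (rewrite E; apply mix_l; assumption).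
    destruct (vpt_01 V (lab q) (lab l)); lra. }
  intros Hs Ht E.
  destruct (classic (K s)) as [Ks|Ks].
  { rewrite curve_K in E by assumption. destruct (classic (K t)) as [Kt|Kt].
    - rewrite curve_K in E by assumption. injection E as E. apply e_inj; auto; lra.
    - destruct (consec_right t Ht Kt) as (l & r & C & Hlr).
      rewrite (curve_consec l r t C) in E by lra. discriminate. }
  destruct (classic (K t)) as [Kt|Kt].
  { rewrite (curve_K t) in E by assumption.
    destruct (consec_right s Hs Ks) as (l & r & C & Hlr).
    rewrite (curve_consec l r s C) in E by lra. discriminate. }
  destruct (classic (P s)) as [Ps|Ps]; destruct (classic (P t)) as [Pt|Pt].
  - rewrite !curve_P in E by assumption. injection E as E. apply vpt_inj in E.
    apply lab_inj; auto; lra.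
  - destruct (good_around t G ltac:(lra) Kt Pt) as (l & r & C & Hlr).
    exfalso. apply (VE l r s Ps ltac:(lra) C t Hlr E).
  - destruct (good_around s G ltac:(lra) Ks Ps) as (l & r & C & Hlr).
    exfalso. apply (VE l r t Pt ltac:(lra) C s Hlr). congruence.
  - destruct (good_around s G ltac:(lra) Ks Ps) as (l & r & C & Hlr).
    destruct (good_around t G ltac:(lra) Kt Pt) as (l' & r' & C' & Hlr').
    rewrite (curve_consec l r s C), (curve_consec l' r' t C') in E by lra.
    injection E as E.
    pose proof (consec_ne _ _ C) as N. pose proof (consec_ne _ _ C') as N'.
    assert (frac : forall a b x, a < x < b -> 0 < (b - x) / (b - a) < 1).
    { intros a b x Hx. split; [apply Rmult_lt_0_compat; [lra|apply Rinv_0_lt_compat; lra]|].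
      apply Rmult_lt_reg_r with (b - a); [lra|].
      unfold Rdiv; rewrite Rmult_assoc, Rinv_l by lra; lra. }
    pose proof (frac _ _ _ Hlr) as F. pose proof (frac _ _ _ Hlr') as F'.
    set (a := (r - s) / (r - l)) in *. set (b := (r' - t) / (r' - l')) in *.
    assert (in1 : lab l = lab l' \/ lab l = lab r').
    { apply NNPP; intro Q. apply not_or_and in Q as [Q1 Q2].
      assert (mix a (lab l) (lab r) (lab l) = 0) by (rewrite E; apply mix_out; assumption).
      rewrite mix_l in H0 by assumption. lra. }
    assert (in2 : lab r = lab l' \/ lab r = lab r').
    { apply NNPP; intro Q. apply not_or_and in Q as [Q1 Q2].
      assert (mix a (lab l) (lab r) (lab r) = 0) by (rewrite E; apply mix_out; assumption).
      rewrite mix_r in H0 by assumption. lra. }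
    destruct (consec_lab_unique l r l' r' C C') as [<- <-].
    { destruct in1, in2; auto; exfalso; congruence. }
    assert (Eab : a = b).
    { rewrite <- (mix_l V a (lab l) (lab r)), <- (mix_l V b (lab l) (lab r)) by assumption.
      congruence. }
    unfold a, b in Eab. apply Rmult_eq_reg_r in Eab; [lra|].
    apply Rinv_neq_0_compat; lra.
Qed.

Theorem curve_closed : closed_curve H lo hi curve.
Proof.
  split; [assumption|]. split; [|split; [|split]].
  - destruct closing as [(?&?&E)|(?&?&E)].
    + rewrite !curve_P by assumption. congruence.
    + rewrite !curve_K by assumption. congruence.
  - apply curve_inH.
  - intros t N Ht HN. destruct (classic (K t)).
    + apply curve_cont_end; assumption.
    + apply curve_cont_inner; assumption.
  - apply curve_inj.
Qed.

End Curve.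

(** * Ends and the Hausdorff property *)

Lemma eventually_and (P Q : nat -> Prop) :
  Defs.eventually P -> Defs.eventually Q -> Defs.eventually (fun m => P m /\ Q m).
Proof.
  intros [n Hn] [m Hm]. exists (max n m). intros k Hk. split; [apply Hn|apply Hm]; lia.
Qed.

Lemma eventually_imp (P Q : nat -> Prop) :
  (forall m, P m -> Q m) -> Defs.eventually P -> Defs.eventually Q.
Proof. intros H [n Hn]. exists n. auto. Qed.

Lemma eventually_ex (P : nat -> Prop) : Defs.eventually P -> exists m, P m.
Proof. intros [n Hn]. exists n. apply Hn. lia. Qed.

Section Ends.
Variables (V : Type) (H : V -> V -> Prop).
Hypothesis Hsym : symmetric_rel H.

Lemma compS_sym S c x : compS H S c x -> compS H S x c.
Proof.
  intros Hc. split; [eapply compS_notin; eassumption|]. destruct Hc as [_ Hc].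
  induction Hc as [u v (A & B & C)| |u v w _ IH1 _ IH2].
  - apply rt_step. repeat split; auto.
  - apply rt_refl.
  - eapply rt_trans; eassumption.
Qed.

Lemma compS_trans S c x y : compS H S c x -> compS H S x y -> compS H S c y.
Proof. intros [Hc H1] [_ H2]. split; [assumption|]. eapply rt_trans; eassumption. Qed.

Lemma ray_leaves_list r : ray H r -> forall S : list V,
  Defs.eventually (fun m => ~ In (r m) S).
Proof.
  intros [Hinj _] S. induction S as [|a S IH].
  - exists 0%nat. intros m _ [].
  - destruct (classic (exists m, r m = a)) as [[m Hm]|N].
    + destruct IH as [n Hn]. exists (max n (Datatypes.S m)). intros k Hk [E|E].
      * rewrite E in Hm. apply Hinj in Hm. lia.
      * revert E. apply Hn. lia.
    + revert IH. apply eventually_imp. intros m Hm [E|E]; eauto.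
Qed.

Lemma ray_compS r : ray H r -> forall S, exists c, Defs.eventually (fun m => compS H S c (r m)).
Proof.
  intros Hr S. destruct (ray_leaves_list r Hr S) as [n Hn].
  exists (r n), n. intros m Hm. induction Hm as [|m Hm IH].
  - split; [apply Hn; lia|apply rt_refl].
  - apply (compS_adj H S _ (r m)); auto; try (apply Hn; lia). apply Hr.
Qed.

Lemma end_rep e : is_end H e -> exists r0, ray H r0 /\ e r0 /\
  forall r, e r -> ray H r /\ rays_equiv H r0 r.
Proof.
  intros (r0 & Hr0 & He). exists r0. split; [assumption|]. split.
  - apply He. split; [assumption|]. intro S. destruct (ray_compS r0 Hr0 S) as [c Hc]. eauto.
  - intros r Hr. apply He; assumption.
Qed.

Lemma rays_equiv_compS r0 r S c : rays_equiv H r0 r ->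
  Defs.eventually (fun m => compS H S c (r0 m)) -> Defs.eventually (fun m => compS H S c (r m)).
Proof.
  intros HE Hc. destruct (HE S) as (c' & H1 & H2).
  destruct (eventually_ex _ (eventually_and _ _ Hc H1)) as (m & A & B).
  revert H2. apply eventually_imp. intros k Hk.
  apply compS_trans with (r0 m); [assumption|].
  apply compS_trans with c'; [apply compS_sym; assumption|assumption].
Qed.

Lemma end_compS e : is_end H e -> forall S, exists c,
  forall r, e r -> Defs.eventually (fun m => compS H S c (r m)).
Proof.
  intros He S. destruct (end_rep e He) as (r0 & Hr0 & _ & Hall).
  destruct (ray_compS r0 Hr0 S) as [c Hc]. exists c. intros r Hr.
  apply (rays_equiv_compS r0 r S c); [apply Hall; assumption|assumption].
Qed.

Lemma rays_equiv_sym r1 r2 : rays_equiv H r1 r2 -> rays_equiv H r2 r1.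
Proof. intros E S. destruct (E S) as (c & A & B). eauto. Qed.

Lemma rays_equiv_trans r1 r2 r3 :
  rays_equiv H r1 r2 -> rays_equiv H r2 r3 -> rays_equiv H r1 r3.
Proof.
  intros E1 E2 S. destruct (E1 S) as (c & A & B). exists c. split; [assumption|].
  apply (rays_equiv_compS r2 r3 S c E2 B).
Qed.

(** For an end the union of the two separators works: a component of the smaller graph that contains
    tails of the end lies inside both given components. *)
Lemma nb_inter p N1 N2 : inH V H p -> nb V H p N1 -> nb V H p N2 ->
  exists N, nb V H p N /\ forall q, N q -> N1 q /\ N2 q.
Proof.
  destruct p as [f|e]; intros Hp HN1 HN2.
  - destruct HN1 as (e1 & He1 & ->). destruct HN2 as (e2 & He2 & ->).
    eexists. split.
    { exists (Rmin e1 e2). split; [apply Rmin_pos; assumption|reflexivity]. }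
    intros [g|w]; [|tauto]. simpl. intros [Hg Hx].
    split; (split; [assumption|]); intro x; specialize (Hx x);
      pose proof (Rmin_l e1 e2); pose proof (Rmin_r e1 e2); lra.
  - destruct HN1 as (S1 & c1 & Hc1 & ->). destruct HN2 as (S2 & c2 & Hc2 & ->).
    simpl in Hp. destruct (end_compS e Hp (S1 ++ S2)) as [c Hc].
    destruct (end_rep e Hp) as (r0 & Hr0 & Er0 & _).
    assert (sub : forall S' c', incl S' (S1 ++ S2) ->
      (forall r, e r -> Defs.eventually (fun m => compS H S' c' (r m))) ->
      forall x, compS H (S1 ++ S2) c x -> compS H S' c' x).
    { intros S' c' Hi Hc' x Hx.
      assert (inc : forall a b, compS H (S1 ++ S2) a b -> compS H S' a b).
      { intros a b [Ha Hab]. split; [intro I; apply Ha, Hi, I|].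
        induction Hab as [u v (A & B & C)| |u v w Huv IH1 Hvw IH2].
        - apply rt_step. split; [assumption|]. split; intro I; [apply B|apply C]; apply Hi, I.
        - apply rt_refl.
        - eapply rt_trans; [apply IH1; assumption|]. apply IH2.
          apply (compS_notin H _ u). split; assumption. }
      destruct (eventually_ex _ (eventually_and _ _ (Hc r0 Er0) (Hc' r0 Er0))) as (m & A & B).
      apply compS_trans with (r0 m); [assumption|].
      apply compS_trans with c; [apply compS_sym, inc; assumption|apply inc; assumption]. }
    exists (region V H (S1 ++ S2) c). split; [exists (S1 ++ S2), c; auto|].
    assert (main : forall S' c' , incl S' (S1 ++ S2) ->
      (forall r, e r -> Defs.eventually (fun m => compS H S' c' (r m))) ->
      forall q, region V H (S1 ++ S2) c q -> region V H S' c' q).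
    { intros S' c' Hi Hc' [g|w].
      - intros (Hg & (x & Hx & Cx) & Hall). split; [assumption|]. split.
        + exists x. split; [assumption|]. apply sub; assumption.
        + intros y Hy. destruct (classic (In y S')) as [I|I]; [right; assumption|left].
          destruct (classic (y = x)) as [->|Nyx]; [apply sub; assumption|].
          apply (compS_adj H S' c' x); [apply sub; assumption| | |assumption].
          * intro I'. apply (compS_notin _ _ _ _ Cx), Hi, I'.
          * destruct Hg as [[v [Hv1 Hv2]]|(u & v & Huv & (Nuv & _ & _ & _ & Hz))].
            -- assert (forall z, 0 < g z -> z = v) as Q.
               { intros z Hz. apply NNPP; intro. rewrite Hv2 in Hz by assumption. lra. }
               exfalso. apply Nyx. rewrite (Q y), (Q x); auto.
            -- assert (forall z, 0 < g z -> z = u \/ z = v) as Q.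
               { intros z Hz'. apply NNPP; intro Z. apply not_or_and in Z.
                 rewrite Hz in Hz' by tauto. lra. }
               destruct (Q x Hx), (Q y Hy); subst; auto; contradiction.
      - intros (Hw & Hr). split; [assumption|]. intros r Wr.
        specialize (Hr r Wr). revert Hr. apply eventually_imp.
        intros m. apply sub; assumption. }
    intros q Hq. split; (apply main; [|assumption|assumption]);
      intros x Hx; apply in_or_app; auto.
Qed.

Hypothesis Hlf : locally_finite H.

Lemma nb_ex p : inH V H p -> exists N, nb V H p N.
Proof.
  destruct p as [f|e]; intro Hp.
  - eexists. exists 1. split; [lra|reflexivity].
  - destruct (end_compS e Hp []) as [c Hc]. eexists. exists [], c. split; [assumption|reflexivity].
Qed.

Lemma pt1_pos f : pt1 H f -> exists u, 0 < f u.
Proof.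
  intros [[v [Hv _]]|(u & v & _ & (_ & Hu & _))].
  - exists v. lra.
  - exists u. assumption.
Qed.

(** The separator consists of [u] and its neighbours, finite by local finiteness. A point within
    [f u] of [f] still has positive weight at [u], so all vertices carrying it are deleted. *)
Lemma separate_inner_end f e : pt1 H f -> is_end H e ->
  exists N M, nb V H (Inner f) N /\ nb V H (EndP e) M /\ forall z, N z -> M z -> False.
Proof.
  intros Hf He. destruct (pt1_pos f Hf) as [u Hu]. destruct (Hlf u) as [l Hl].
  destruct (end_compS e He (u :: l)) as [c Hc].
  eexists; eexists. split; [|split].
  - exists (f u). split; [assumption|reflexivity].
  - exists (u :: l), c. split; [assumption|reflexivity].
  - intros [g|w]; [|simpl; tauto]. intros [Hg Hd] (_ & (x & Hx & Cx) & _).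
    specialize (Hd u). apply Rabs_def2 in Hd.
    apply compS_notin in Cx. apply Cx.
    destruct (classic (x = u)) as [->|N]; [left; reflexivity|right].
    destruct Hg as [[v [Hv1 Hv2]]|(a & b & Hab & (_ & _ & _ & _ & Hz))].
    + exfalso. apply N. transitivity v.
      * apply NNPP; intro Z. rewrite Hv2 in Hx by assumption. lra.
      * apply NNPP; intro Z. rewrite (Hv2 u) in Hd by auto. lra.
    + assert (forall z, 0 < g z -> z = a \/ z = b) as Q.
      { intros z Hz'. apply NNPP; intro Z. apply not_or_and in Z.
        rewrite Hz in Hz' by tauto. lra. }
      apply Hl. destruct (Q x Hx), (Q u ltac:(lra)); subst; auto; contradiction.
Qed.

Lemma separate_end_end e e' : is_end H e -> is_end H e' -> e <> e' ->
  exists N M, nb V H (EndP e) N /\ nb V H (EndP e') M /\ forall z, N z -> M z -> False.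
Proof.
  intros He He' Hne.
  pose proof He as (r & Hr & Er). pose proof He' as (r' & Hr' & Er').
  assert (NE : ~ rays_equiv H r r').
  { intro E. apply Hne. extensionality q. apply propositional_extensionality.
    rewrite Er, Er'. split; intros [Q1 Q2]; split; auto.
    - eapply rays_equiv_trans; [apply rays_equiv_sym; eassumption|assumption].
    - eapply rays_equiv_trans; eassumption. }
  apply not_all_ex_not in NE as [S NS].
  destruct (end_compS e He S) as [c Hc]. destruct (end_compS e' He' S) as [c' Hc'].
  assert (Err : e r).
  { apply Er. split; [assumption|]. intro T. destruct (ray_compS r Hr T); eauto. }
  assert (Err' : e' r').
  { apply Er'. split; [assumption|]. intro T. destruct (ray_compS r' Hr' T); eauto. }
  assert (D : forall x, compS H S c x -> compS H S c' x -> False).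
  { intros x Hx Hx'. apply NS. exists c. split; [apply Hc; assumption|].
    specialize (Hc' r' Err'). revert Hc'. apply eventually_imp. intros m Hm.
    apply compS_trans with x; [assumption|]. apply compS_trans with c'; [|assumption].
    apply compS_sym; assumption. }
  exists (region V H S c), (region V H S c'). split; [exists S, c; auto|].
  split; [exists S, c'; auto|].
  intros [g|w].
  - intros (_ & _ & Hall) (_ & (x & Hx & Cx) & _).
    destruct (Hall x Hx) as [Cx'|I]; [eauto|]. apply compS_notin in Cx. contradiction.
  - intros (Hw & A) (_ & B). destruct (end_rep w Hw) as (r1 & _ & W1 & _).
    destruct (eventually_ex _ (eventually_and _ _ (A r1 W1) (B r1 W1))) as (m & M1 & M2). eauto.
Qed.

Lemma hausdorff p q : inH V H p -> inH V H q -> p <> q ->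
  exists N M, nb V H p N /\ nb V H q M /\ forall z, N z -> M z -> False.
Proof.
  destruct p as [f|e], q as [g|e']; intros Hp Hq Hne.
  - assert (exists x, f x <> g x) as [x Hx].
    { apply NNPP; intro N. apply Hne. f_equal. extensionality x. apply NNPP. intro. eauto. }
    assert (0 < Rabs (f x - g x)) by (apply Rabs_pos_lt; lra).
    eexists; eexists. split; [|split].
    + exists (Rabs (f x - g x) / 2). split; [lra|reflexivity].
    + exists (Rabs (f x - g x) / 2). split; [lra|reflexivity].
    + intros [h|w]; [|tauto]. intros [_ A] [_ B]. specialize (A x). specialize (B x).
      revert A B. unfold Rabs; repeat destruct Rcase_abs; lra.
  - apply separate_inner_end; assumption.
  - destruct (separate_inner_end g e Hq Hp) as (N & M & A & B & C). exists M, N.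
    repeat split; eauto.
  - apply separate_end_end; auto. congruence.
Qed.

(** * From closed curves to circles *)

(** A bijection from the circle to [[0, 1)] that is affine in the first coordinate on each half
    circle. It replaces the angle and avoids trigonometry. *)
Definition theta (z : R * R) : R :=
  if Rle_dec 0 (snd z) then (1 - fst z) / 4 else (3 + fst z) / 4.

Lemma S1_bounds z : S1 z -> -1 <= fst z <= 1 /\ -1 <= snd z <= 1.
Proof. unfold S1. intros. split; split; nra. Qed.

Lemma theta_range z : S1 z -> 0 <= theta z < 1.
Proof.
  intros Hz. pose proof (S1_bounds z Hz). unfold theta, S1 in *.
  destruct Rle_dec; [lra|]. assert (fst z < 1) by nra. lra.
Qed.

Lemma theta_inj z w : S1 z -> S1 w -> theta z = theta w -> z = w.
Proof.
  destruct z as [x y], w as [x' y']. intros Hz Hw E.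
  pose proof (S1_bounds _ Hz). pose proof (S1_bounds _ Hw).
  unfold theta, S1 in *. simpl in *.
  destruct (Rle_dec 0 y), (Rle_dec 0 y').
  - assert (x = x') by lra. subst x'. f_equal. nra.
  - exfalso. assert (-1 < x') by nra. lra.
  - exfalso. assert (-1 < x) by nra. lra.
  - assert (x = x') by lra. subst x'. f_equal. nra.
Qed.

Lemma theta_surj t : 0 <= t < 1 -> exists z, S1 z /\ theta z = t.
Proof.
  intros Ht. destruct (Rle_dec t (1 / 2)) as [L|L].
  - exists (1 - 4 * t, sqrt (1 - (1 - 4 * t) ^ 2)). split.
    + unfold S1. cbn [fst snd]. rewrite pow2_sqrt by nra. ring.
    + unfold theta. cbn [fst snd]. destruct Rle_dec as [|N]; [lra|].
      exfalso; apply N, sqrt_pos.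
  - exists (4 * t - 3, - sqrt (1 - (4 * t - 3) ^ 2)).
    assert (0 < sqrt (1 - (4 * t - 3) ^ 2)) by (apply sqrt_lt_R0; nra). split.
    + unfold S1. cbn [fst snd].
      replace ((- sqrt (1 - (4 * t - 3) ^ 2)) ^ 2) with (sqrt (1 - (4 * t - 3) ^ 2) ^ 2) by ring.
      rewrite pow2_sqrt by nra. ring.
    + unfold theta. cbn [fst snd]. destruct Rle_dec as [|N]; lra.
Qed.

Lemma dist2_coord z w d : dist2 z w < d -> Rabs (fst z - fst w) < d /\ Rabs (snd z - snd w) < d.
Proof.
  unfold dist2. intro Hd.
  assert (forall a b, Rabs a <= sqrt (a ^ 2 + b ^ 2)) as Q.
  { intros a b. rewrite <- sqrt_Rsqr_abs. apply sqrt_le_1_alt. unfold Rsqr. nra. }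
  split; (eapply Rle_lt_trans; [apply Q|]); [eassumption|].
  rewrite Rplus_comm. eassumption.
Qed.

(** The second alternative is the drop of [theta] from 1 to 0 at the point [(1, 0)]; it is harmless
    for a function with equal values at 0 and 1. *)
Lemma theta_cont z0 d : S1 z0 -> 0 < d -> exists h, 0 < h /\ forall z, S1 z -> dist2 z0 z < h ->
  Rabs (theta z - theta z0) < d \/ (theta z0 = 0 /\ 1 - theta z < d).
Proof.
  destruct z0 as [x0 y0]. intros H0 Hd. unfold theta, S1 in *. simpl in H0.
  destruct (Rtotal_order y0 0) as [L|[->|L]].
  - exists (Rmin d (- y0)). split; [apply Rmin_pos; lra|]. intros [x y] Hz D.
    apply dist2_coord in D. simpl in *. destruct D as [D1 D2].
    pose proof (Rmin_l d (- y0)). pose proof (Rmin_r d (- y0)).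
    apply Rabs_def2 in D1. apply Rabs_def2 in D2. left.
    destruct (Rle_dec 0 y0); [lra|]. destruct (Rle_dec 0 y); [lra|].
    apply Rabs_def1; lra.
  - exists d. split; [assumption|]. intros [x y] Hz D.
    apply dist2_coord in D. simpl in *. destruct D as [D1 D2].
    apply Rabs_def2 in D1. destruct (Rle_dec 0 0); [|lra].
    assert (E : x0 = 1 \/ x0 = -1).
    { assert ((x0 - 1) * (x0 + 1) = 0) as Z by nra. apply Rmult_integral in Z. lra. }
    destruct E as [-> | ->]; destruct (Rle_dec 0 y).
    + left. apply Rabs_def1; lra.
    + right. lra.
    + left. apply Rabs_def1; lra.
    + left. apply Rabs_def1; lra.
  - exists (Rmin d y0). split; [apply Rmin_pos; lra|]. intros [x y] Hz D.
    apply dist2_coord in D. simpl in *. destruct D as [D1 D2].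
    pose proof (Rmin_l d y0). pose proof (Rmin_r d y0).
    apply Rabs_def2 in D1. apply Rabs_def2 in D2. left.
    destruct (Rle_dec 0 y0); [|lra]. destruct (Rle_dec 0 y); [|lra].
    apply Rabs_def1; lra.
Qed.

(** On one half circle the square of [y - y'] is at most [|y^2 - y'^2| = |x^2 - x'^2|]. This and the
    square of [x - x'] are each at most [2 |x - x'|], hence the constant 4. *)
Lemma dist2_same_side z w : S1 z -> S1 w -> 0 <= snd z * snd w ->
  dist2 z w ^ 2 <= 4 * Rabs (fst z - fst w).
Proof.
  destruct z as [x y], w as [x' y']. intros Hz Hw Hs.
  pose proof (S1_bounds _ Hz). pose proof (S1_bounds _ Hw).
  unfold dist2, S1 in *. cbn [fst snd] in *.
  rewrite pow2_sqrt by (apply Rplus_le_le_0_compat; apply pow2_ge_0).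
  assert ((y - y') ^ 2 <= Rabs (y ^ 2 - y' ^ 2)).
  { replace (y ^ 2 - y' ^ 2) with ((y - y') * (y + y')) by ring.
    rewrite Rabs_mult. replace ((y - y') ^ 2) with (Rabs (y - y') * Rabs (y - y')).
    - apply Rmult_le_compat_l; [apply Rabs_pos|].
      apply Rsqr_le_abs_0. unfold Rsqr. nra.
    - rewrite <- Rabs_mult, Rabs_right by (apply Rle_ge, Rle_0_sqr). ring. }
  replace (y ^ 2 - y' ^ 2) with ((x' - x) * (x' + x)) in H2 by nra.
  unfold Rabs in *. repeat destruct Rcase_abs; nra.
Qed.

(** The radius [d ^ 2 / 16] turns, through the slope 1/4 of [theta], into the bound required by
    [dist2_same_side]. The number [(1 + x0) / 4] is the distance from [theta z0] to 1/2 and keeps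
    [z] on the same half circle. *)
Lemma theta_open z0 d : S1 z0 -> 0 < d -> exists h, 0 < h /\ forall z, S1 z ->
  Rabs (theta z - theta z0) < h \/ (theta z0 = 0 /\ 1 - theta z < h) -> dist2 z0 z < d.
Proof.
  intros H0 Hd.
  assert (crit : forall z, S1 z -> 0 <= snd z0 * snd z -> 4 * Rabs (fst z0 - fst z) < d ^ 2 ->
            dist2 z0 z < d).
  { intros z Hz Hs Hx. pose proof (dist2_same_side z0 z H0 Hz Hs).
    assert (0 <= dist2 z0 z) by apply sqrt_pos. nra. }
  pose proof (theta_range z0 H0) as T0.
  destruct z0 as [x0 y0]. unfold theta in *. cbn [fst snd] in *.
  pose proof H0 as H0'. unfold S1 in H0'. simpl in H0'.
  assert (Hd2 : 0 < d ^ 2 / 16) by nra.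
  destruct (Rtotal_order y0 0) as [L|[->|L]].
  - destruct (Rle_dec 0 y0); [lra|]. assert (-1 < x0) by nra.
    exists (Rmin (d ^ 2 / 16) ((1 + x0) / 4)). split; [apply Rmin_pos; lra|].
    intros [x y] Hz Hc. pose proof (S1_bounds _ Hz). cbn [fst snd] in *.
    pose proof (Rmin_l (d ^ 2 / 16) ((1 + x0) / 4)). pose proof (Rmin_r (d ^ 2 / 16) ((1 + x0) / 4)).
    destruct Hc as [Hc|Hc]; [|lra]. apply Rabs_def2 in Hc.
    destruct (Rle_dec 0 y); [lra|]. apply crit; [assumption|simpl; nra|].
    cbn [fst snd]. cut (Rabs (x0 - x) < d ^ 2 / 4); [lra|]. apply Rabs_def1; lra.
  - exists (Rmin (d ^ 2 / 16) (1 / 2)). split; [apply Rmin_pos; lra|].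
    intros [x y] Hz Hc. pose proof (S1_bounds _ Hz). cbn [fst snd] in *.
    pose proof (Rmin_l (d ^ 2 / 16) (1 / 2)). pose proof (Rmin_r (d ^ 2 / 16) (1 / 2)).
    apply crit; [assumption|simpl; nra|]. cbn [fst snd].
    cut (Rabs (x0 - x) < d ^ 2 / 4); [lra|].
    destruct (Rle_dec 0 0); [|lra].
    assert (E : x0 = 1 \/ x0 = -1).
    { assert ((x0 - 1) * (x0 + 1) = 0) as Z by nra. apply Rmult_integral in Z. lra. }
    destruct E as [-> | ->]; destruct (Rle_dec 0 y); destruct Hc as [Hc|Hc];
      try (apply Rabs_def2 in Hc); apply Rabs_def1; lra.
  - destruct (Rle_dec 0 y0); [|lra]. assert (-1 < x0 < 1) by nra.
    exists (Rmin (d ^ 2 / 16) ((1 + x0) / 4)). split; [apply Rmin_pos; lra|].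
    intros [x y] Hz Hc. pose proof (S1_bounds _ Hz). cbn [fst snd] in *.
    pose proof (Rmin_l (d ^ 2 / 16) ((1 + x0) / 4)). pose proof (Rmin_r (d ^ 2 / 16) ((1 + x0) / 4)).
    destruct Hc as [Hc|Hc]; [|lra]. apply Rabs_def2 in Hc.
    destruct (Rle_dec 0 y); [|lra]. apply crit; [assumption|simpl; nra|].
    cbn [fst snd]. cut (Rabs (x0 - x) < d ^ 2 / 4); [lra|]. apply Rabs_def1; lra.
Qed.

Lemma closed_curve_unit lo hi g : closed_curve H lo hi g ->
  closed_curve H 0 1 (fun t => g (lo + (hi - lo) * t)).
Proof.
  intros (L & E & Hin & Hc & Hi).
  assert (rng : forall t, 0 <= t <= 1 -> lo <= lo + (hi - lo) * t <= hi) by (intros; nra).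
  split; [lra|]. split; [|split; [|split]].
  - replace (lo + (hi - lo) * 0) with lo by ring. replace (lo + (hi - lo) * 1) with hi by ring.
    assumption.
  - intros t Ht. apply Hin, rng, Ht.
  - intros t N Ht HN. destruct (Hc _ N (rng t Ht) HN) as (d & Hd & Hs).
    exists (d / (hi - lo)). split; [apply Rmult_lt_0_compat; [lra|apply Rinv_0_lt_compat; lra]|].
    intros s Hs1 Hs2. apply Hs; [apply rng; assumption|].
    replace (lo + (hi - lo) * s - (lo + (hi - lo) * t)) with ((s - t) * (hi - lo)) by ring.
    rewrite Rabs_mult, (Rabs_right (hi - lo)) by lra.
    apply Rmult_lt_compat_r with (r := hi - lo) in Hs2; [|lra].
    unfold Rdiv in Hs2. rewrite Rmult_assoc, Rinv_l in Hs2 by lra. lra.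
  - intros s t Hs Ht Est. apply Hi in Est; [|nra|nra].
    apply Rmult_eq_reg_l with (hi - lo); lra.
Qed.

(* Continuity of the inverse is compactness of the parameter interval. *)
Lemma closed_curve_embedding g : closed_curve H 0 1 g ->
  embedding V H S1 dist2 (fun z => g (theta z)).
Proof.
  intros (_ & E01 & Hin & Hc & Hi). split; [|split; [|split]].
  - intros z Hz. apply Hin. pose proof (theta_range z Hz). lra.
  - intros z w Hz Hw E. apply theta_inj; auto. apply Hi; auto using theta_range.
  - intros z Hz N HN. pose proof (theta_range z Hz) as Hr.
    destruct (Hc (theta z) N ltac:(lra) HN) as (d & Hd & Hs).
    assert (exists d', 0 < d' /\ (theta z = 0 -> forall s, 0 <= s <= 1 -> 1 - s < d' -> N (g s)))
      as (d' & Hd' & Hs').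
    { destruct (Req_dec (theta z) 0) as [E|NE]; [|exists 1; split; [lra|contradiction]].
      rewrite E, E01 in HN. destruct (Hc 1 N ltac:(lra) HN) as (d' & Hd' & Hs').
      exists d'. split; [assumption|]. intros _ s Hs1 Hs2. apply Hs'; [assumption|].
      apply Rabs_def1; lra. }
    destruct (theta_cont z (Rmin d d') Hz (Rmin_pos _ _ Hd Hd')) as (h & Hh & Hz').
    exists h. split; [assumption|]. intros w Hw D. pose proof (theta_range w Hw).
    pose proof (Rmin_l d d'). pose proof (Rmin_r d d').
    destruct (Hz' w Hw D) as [A|[A B]]; [apply Hs|apply Hs']; auto; lra.
  - intros z Hz d Hd. pose proof (theta_range z Hz) as Hr.
    destruct (theta_open z d Hz Hd) as (h & Hh & Hopen).
    assert (Hp : inH V H (g (theta z))) by (apply Hin; lra).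
    cut (exists N, nb V H (g (theta z)) N /\ forall w, S1 w -> 0 <= theta w <= 1 ->
           N (g (theta w)) -> dist2 z w < d).
    { intros (N & HN & Hw). exists N. split; [assumption|]. intros w Sw HNw.
      apply Hw; auto. pose proof (theta_range w Sw). lra. }
    (* The property asks for a neighbourhood that controls the parameters in [[s, u]]. Intersecting
       neighbourhoods makes it additive; Hausdorff separation provides it away from [theta z]. *)
    apply (interval_glue (fun s u => exists N, nb V H (g (theta z)) N /\
      forall w, S1 w -> s <= theta w <= u -> N (g (theta w)) -> dist2 z w < d) 0 1); [lra| |].
    + intros s t u _ _ _ _ (N1 & A1 & B1) (N2 & A2 & B2).
      destruct (nb_inter _ N1 N2 Hp A1 A2) as (N & A & B). exists N. split; [assumption|].
      intros w Sw Hw HNw. destruct (B _ HNw).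
      destruct (Rle_dec (theta w) t); [apply B1|apply B2]; auto; lra.
    + intros t Ht.
      (* The time 1 stands for the same point as 0. Near either representative of [z] no separation
         is possible, and [theta_open] gives the closeness directly. *)
      destruct (classic (t = theta z \/ (t = 1 /\ theta z = 0))) as [C|C].
      * destruct (nb_ex _ Hp) as [N HN]. exists h. split; [assumption|].
        intros s u Hs1 Hs2 Hu1 Hu2 Hsd Hud. exists N. split; [assumption|]. intros w Sw Hw _.
        apply Hopen; [assumption|]. pose proof (theta_range w Sw).
        destruct C as [-> | [-> C]]; [left; apply Rabs_def1; lra|right; lra].
      * assert (NE : g (theta z) <> g t).
        { intro E. destruct (Req_dec t 1) as [->|N1].
          - rewrite <- E01 in E. apply Hi in E; [|lra|lra]. tauto.
          - apply Hi in E; [|lra|lra]. apply C. left. congruence. }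
        destruct (hausdorff _ _ Hp (Hin t Ht) NE) as (N & M & A & B & D).
        destruct (Hc t M Ht B) as (d' & Hd' & Hs'). exists d'. split; [assumption|].
        intros s u Hs1 Hs2 Hu1 Hu2 Hsd Hud. exists N. split; [assumption|]. intros w Sw Hw HNw.
        exfalso. apply (D (g (theta w)) HNw). pose proof (theta_range w Sw).
        apply Hs'; [lra|]. apply Rabs_def1; lra.
Qed.

Theorem closed_curve_circle lo hi g : closed_curve H lo hi g ->
  circle V H (fun p => exists t, lo <= t <= hi /\ g t = p).
Proof.
  intro C. pose proof (closed_curve_unit lo hi g C) as C1.
  exists (fun z => g (lo + (hi - lo) * theta z)). split.
  - apply (closed_curve_embedding _ C1).
  - destruct C as (L & E & _). intro p. split.
    + intros (t & Ht & <-).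
      destruct (Req_dec t hi) as [->|N].
      * destruct (theta_surj 0 ltac:(lra)) as (z & Hz & Ez). exists z. split; [assumption|].
        rewrite Ez, <- E. f_equal. ring.
      * destruct (theta_surj ((t - lo) / (hi - lo))) as (z & Hz & Ez).
        { split.
          - apply Rmult_le_pos; [lra|]. left. apply Rinv_0_lt_compat. lra.
          - apply Rmult_lt_reg_r with (hi - lo); [lra|].
            unfold Rdiv. rewrite Rmult_assoc, Rinv_l by lra. lra. }
        exists z. split; [assumption|]. rewrite Ez. f_equal. field. lra.
    + intros (z & Hz & <-). pose proof (theta_range z Hz).
      exists (lo + (hi - lo) * theta z). split; [nra|reflexivity].
Qed.

End Ends.

(** * The spine of a topological caterpillar as a linear order *)

Definition betw (a b t : R) : Prop := a < t < b \/ b < t < a.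

(* The vertices [Sp] of an arc, visited at the times [p]; [K] is the set of times at
   which the arc is at an end, and [EB] are the edges contained in the arc. *)
Record line {V : Type} (Sp : V -> Prop) (p : V -> R) (K : R -> Prop) (EB : V -> V -> Prop) : Prop := {
  line_good : good 0 1 (fun t => exists v, Sp v /\ p v = t) K;
  line_inj : forall u v, Sp u -> Sp v -> p u = p v -> u = v;
  line_sym : forall u v, EB u v -> EB v u;
  line_edge : forall u v, EB u v -> Sp u /\ Sp v /\ u <> v /\
    forall t, betw (p u) (p v) t -> ~ K t /\ forall w, Sp w -> p w <> t;
  line_next : forall v, Sp v -> p v < 1 -> exists w, EB v w /\ p v < p w;
  line_prev : forall v, Sp v -> 0 < p v -> exists w, EB v w /\ p w < p v
}.
Arguments line_good {V Sp p K EB}.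
Arguments line_inj {V Sp p K EB}.
Arguments line_sym {V Sp p K EB}.
Arguments line_edge {V Sp p K EB}.
Arguments line_next {V Sp p K EB}.
Arguments line_prev {V Sp p K EB}.

Lemma subpts_closure V (adj : V -> V -> Prop) VB EB q :
  subgraph V adj VB EB -> subpts V VB EB q -> closure V adj (subpts V VB EB) q.
Proof.
  intros [Hsub _] Hq. destruct q as [g|e]; [|destruct Hq].
  assert (Hg : pt1 adj g).
  { destruct Hq as [(v & _ & Hv)|(u & v & Huv & He)]; [left; eauto|right].
    exists u, v. split; [apply Hsub, Huv|assumption]. }
  split; [exact Hg|]. intros N (eps & He & ->). exists (Inner g). split; [|exact Hq].
  split; [assumption|]. intro x. unfold Rminus. rewrite Rplus_opp_r, Rabs_R0. assumption.
Qed.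

(** Within 1/2 of a vertex every point keeps positive weight at that vertex. Within the smaller
    weight of a point inside an edge every point has positive weight at both endpoints and so lies
    on that edge. Hence a closure adds nothing but ends. *)
Lemma closure_inner V (adj : V -> V -> Prop) VB EB g :
  subgraph V adj VB EB -> closure V adj (subpts V VB EB) (Inner g) -> subpts V VB EB (Inner g).
Proof.
  intros [Hsub Hsym] [Hg Hcl].
  assert (pos2 : forall (h : V -> R) u v a b, is_ept h u v -> a <> b -> 0 < h a -> 0 < h b ->
            (a = u /\ b = v) \/ (a = v /\ b = u)).
  { intros h u v a b (_ & _ & _ & _ & Hz) Hab Ha Hb.
    assert (forall z, 0 < h z -> z = u \/ z = v) as Q.
    { intros z Hz'. apply NNPP; intro Z. apply not_or_and in Z. rewrite Hz in Hz' by tauto. lra. }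
    destruct (Q a Ha), (Q b Hb); subst; auto; contradiction. }
  assert (posv : forall (h : V -> R) v a, is_vpt h v -> 0 < h a -> a = v).
  { intros h v a [_ Hz] Ha. apply NNPP; intro Z. rewrite Hz in Ha by assumption. lra. }
  destruct Hg as [[v Hv]|(u & v & Huv & He)].
  - assert (Hhalf : 0 < 1 / 2) by lra.
    destruct (Hcl _ (ex_intro _ (1 / 2) (conj Hhalf eq_refl))) as ([h|w] & HN & Hh); [|destruct Hh].
    destruct HN as [_ HN]. specialize (HN v). rewrite (proj1 Hv) in HN. apply Rabs_def2 in HN.
    left. exists v. split; [|assumption].
    destruct Hh as [(a & Va & Ha)|(a & b & Eab & Hab)].
    + rewrite (posv h a v Ha) by lra. assumption.
    + assert (v = a \/ v = b) as [-> | ->]; [|apply Hsub in Eab; tauto|apply Hsub in Eab; tauto].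
      apply NNPP; intro Z. apply not_or_and in Z. destruct Hab as (_ & _ & _ & _ & Hz).
      rewrite Hz in HN by tauto. lra.
  - pose proof He as (Nuv & Hu & Hv & _).
    destruct (Hcl _ (ex_intro _ (Rmin (g u) (g v)) (conj (Rmin_pos _ _ Hu Hv) eq_refl)))
      as ([h|w] & HN & Hh); [|destruct Hh].
    destruct HN as [_ HN]. pose proof (HN u) as Du. pose proof (HN v) as Dv.
    pose proof (Rmin_l (g u) (g v)). pose proof (Rmin_r (g u) (g v)).
    apply Rabs_def2 in Du, Dv.
    right. exists u, v. split; [|assumption].
    destruct Hh as [(a & Va & Ha)|(a & b & Eab & Hab)].
    + exfalso. apply Nuv. rewrite (posv h a u), (posv h a v); auto; lra.
    + destruct (pos2 h a b u v Hab Nuv ltac:(lra) ltac:(lra)) as [[-> ->]|[-> ->]]; auto.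
Qed.

(** * The order of vertices and ends along an arc *)

Section Arc.
Variables (V : Type) (adj : V -> V -> Prop) (VB : V -> Prop) (EB : V -> V -> Prop).
Variable (f : R -> Pt V).
Hypothesis Hirr : irreflexive_rel adj.
Hypothesis Hsub : subgraph V adj VB EB.
Hypothesis Hemb : embedding V adj unitI dist1 f.
Hypothesis Himg : forall q, closure V adj (subpts V VB EB) q <-> exists t, unitI t /\ f t = q.

Lemma EB_ne u v : EB u v -> u <> v.
Proof. intros E ->. apply (Hirr v). apply (proj1 Hsub _ _ E). Qed.

Lemma f_inj s t : unitI s -> unitI t -> f s = f t -> s = t.
Proof. apply Hemb. Qed.

Lemma arc_inner t g : unitI t -> f t = Inner g -> subpts V VB EB (Inner g).
Proof. intros Ht E. apply (closure_inner V adj); [assumption|]. apply Himg. eauto. Qed.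

Lemma arc_cases t : unitI t -> (exists e, f t = EndP e) \/
  (exists v, VB v /\ f t = Inner (vpt v)) \/
  (exists u v l, EB u v /\ 0 < l < 1 /\ f t = Inner (mix l u v)).
Proof.
  intros Ht. destruct (f t) as [g|e] eqn:E; [right|left; eauto].
  destruct (arc_inner t g Ht E) as [(v & Hv & Hg)|(u & v & Huv & Hg)].
  - left. exists v. rewrite (is_vpt_eq _ _ _ Hg). auto.
  - right. destruct (is_ept_eq _ _ _ _ Hg) as [Eg Hl]. exists u, v, (g u).
    rewrite <- Eg. auto.
Qed.

Definition vtime (v : V) : R :=
  epsilon (inhabits 0) (fun t => unitI t /\ f t = Inner (vpt v)).

Lemma vtime_spec v : VB v -> unitI (vtime v) /\ f (vtime v) = Inner (vpt v).
Proof.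
  intro Hv. unfold vtime. apply epsilon_spec. apply Himg, subpts_closure; [assumption|].
  left. exists v. split; [assumption|apply is_vpt_vpt].
Qed.

Lemma vtime_eq v t : VB v -> unitI t -> f t = Inner (vpt v) -> t = vtime v.
Proof.
  intros Hv Ht E. destruct (vtime_spec v Hv). apply f_inj; auto. congruence.
Qed.

(** The inverse of [f] along an edge: the time at which the arc passes the point with weight [l] at
    [u]. *)
Definition psi (u v : V) (l : R) : R :=
  epsilon (inhabits 0) (fun t => unitI t /\ f t = Inner (mix l u v)).

Lemma psi_spec u v l : EB u v -> 0 <= l <= 1 ->
  unitI (psi u v l) /\ f (psi u v l) = Inner (mix l u v).
Proof.
  intros E Hl. unfold psi. apply epsilon_spec. apply Himg, subpts_closure; [assumption|].
  pose proof (proj1 Hsub _ _ E) as (_ & Hu & Hv). pose proof (EB_ne u v E) as N.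
  destruct (Req_dec l 0) as [->|N0].
  { rewrite mix_0. left. exists v. split; [assumption|apply is_vpt_vpt]. }
  destruct (Req_dec l 1) as [->|N1].
  { rewrite mix_1. left. exists u. split; [assumption|apply is_vpt_vpt]. }
  right. exists u, v. split; [assumption|]. apply is_ept_mix; [assumption|lra].
Qed.

Lemma psi_1 u v : EB u v -> psi u v 1 = vtime u.
Proof.
  intro E. destruct (psi_spec u v 1 E ltac:(lra)) as [A B]. rewrite mix_1 in B.
  apply vtime_eq; auto. apply (proj1 Hsub _ _ E).
Qed.

Lemma psi_0 u v : EB u v -> psi u v 0 = vtime v.
Proof.
  intro E. destruct (psi_spec u v 0 E ltac:(lra)) as [A B]. rewrite mix_0 in B.
  apply vtime_eq; auto. apply (proj1 Hsub _ _ E).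
Qed.

Lemma psi_inj u v l l' : EB u v -> 0 <= l <= 1 -> 0 <= l' <= 1 -> psi u v l = psi u v l' -> l = l'.
Proof.
  intros E Hl Hl' Eq. destruct (psi_spec u v l E Hl) as [_ A].
  destruct (psi_spec u v l' E Hl') as [_ B]. rewrite Eq, B in A. injection A as A.
  rewrite <- (mix_l V l u v), <- (mix_l V l' u v) by (apply EB_ne; assumption). congruence.
Qed.

(** The inverse of the embedding is continuous, so the side of [t] on which [psi] lies is locally
    constant as long as [t] is not attained. *)
Lemma psi_ivt u v l1 l2 t : EB u v -> 0 <= l1 -> l1 < l2 -> l2 <= 1 ->
  betw (psi u v l1) (psi u v l2) t -> exists l, l1 < l < l2 /\ psi u v l = t.
Proof.
  intros E H1 H12 H2 Hb. apply NNPP; intro Hn.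
  assert (Hne : forall l, l1 <= l <= l2 -> psi u v l <> t).
  { intros l Hl El. destruct (Req_dec l l1) as [->|N1]; [unfold betw in Hb; lra|].
    destruct (Req_dec l l2) as [->|N2]; [unfold betw in Hb; lra|].
    apply Hn. exists l. split; [lra|assumption]. }
  assert (Q : psi u v l1 < t <-> psi u v l2 < t); [|unfold betw in Hb; lra].
  apply (interval_glue (fun s s' => psi u v s < t <-> psi u v s' < t)); [lra|tauto|].
  intros l Hl. destruct (psi_spec u v l E ltac:(lra)) as [A B].
  destruct Hemb as (_ & _ & _ & H4).
  destruct (H4 _ A (Rabs (psi u v l - t))) as (N & HN & Hclose).
  { apply Rabs_pos_lt. pose proof (Hne l Hl). lra. }
  rewrite B in HN. destruct HN as (eps & He & ->).
  exists eps. split; [assumption|].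
  assert (side : forall s, l1 <= s <= l2 -> l - eps < s < l + eps ->
                   (psi u v s < t <-> psi u v l < t)).
  { intros s Hs Hse. destruct (psi_spec u v s E ltac:(lra)) as [A' B'].
    specialize (Hclose _ A'). rewrite B' in Hclose.
    assert (D : dist1 (psi u v l) (psi u v s) < Rabs (psi u v l - t)).
    { apply Hclose. split.
      - apply pt1_mix; [apply EB_ne; assumption|apply (proj1 Hsub _ _ E)|lra].
      - intro x. eapply Rle_lt_trans; [apply mix_dist|]. apply Rabs_def1; lra. }
    unfold dist1 in D. revert D. pose proof (Hne l Hl). pose proof (Hne s Hs).
    unfold Rabs. repeat destruct Rcase_abs; lra. }
  intros s s' Hs1 Hs2 Hs3 Hs4 Hd1 Hd2. rewrite (side s), (side s'); [tauto| | | |]; lra.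
Qed.

Lemma edge_between u v t : EB u v -> betw (vtime u) (vtime v) t ->
  exists l, 0 < l < 1 /\ f t = Inner (mix l u v).
Proof.
  intros E Hb. destruct (psi_ivt u v 0 1 t E) as (l & Hl & El); try lra.
  - rewrite psi_0, psi_1 by assumption. unfold betw in *. lra.
  - exists l. split; [assumption|]. rewrite <- El. apply psi_spec; [assumption|lra].
Qed.

(** An injective function with intermediate values is monotone: if the inner value lay outside, the
    value at one end of the edge would be attained a second time. *)
Lemma between_edge u v l t : EB u v -> 0 < l < 1 -> unitI t -> f t = Inner (mix l u v) ->
  betw (vtime u) (vtime v) t.
Proof.
  intros E Hl Ht Ef. destruct (psi_spec u v l E ltac:(lra)) as [A B].
  assert (t = psi u v l) as -> by (apply f_inj; auto; congruence).
  rewrite <- (psi_1 u v), <- (psi_0 u v) by assumption.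
  assert (N0 : psi u v l <> psi u v 0) by (intro Q; apply psi_inj in Q; auto; lra).
  assert (N1 : psi u v l <> psi u v 1) by (intro Q; apply psi_inj in Q; auto; lra).
  assert (N2 : psi u v 1 <> psi u v 0) by (intro Q; apply psi_inj in Q; auto; lra).
  apply NNPP; intro Hn. unfold betw in Hn.
  assert (Q : betw (psi u v 0) (psi u v l) (psi u v 1) \/ betw (psi u v l) (psi u v 1) (psi u v 0)).
  { unfold betw. lra. }
  destruct Q as [Q|Q].
  - destruct (psi_ivt u v 0 l _ E ltac:(lra) ltac:(lra) ltac:(lra) Q) as (l' & Hl' & El').
    apply psi_inj in El'; auto; lra.
  - destruct (psi_ivt u v l 1 _ E ltac:(lra) ltac:(lra) ltac:(lra) Q) as (l' & Hl' & El').
    apply psi_inj in El'; auto; lra.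
Qed.

Definition atend (t : R) : Prop := unitI t /\ exists e, f t = EndP e.

Lemma vtime_not_end v : VB v -> ~ atend (vtime v).
Proof. intros Hv [_ [e E]]. destruct (vtime_spec v Hv). congruence. Qed.

Lemma vtime_inj u v : VB u -> VB v -> vtime u = vtime v -> u = v.
Proof.
  intros Hu Hv E. destruct (vtime_spec u Hu) as [_ A], (vtime_spec v Hv) as [_ B].
  rewrite E, B in A. injection A as A. symmetry. apply vpt_inj; assumption.
Qed.

Lemma f_near t g : unitI t -> f t = Inner g -> forall eps, 0 < eps -> exists d, 0 < d /\
  forall s, unitI s -> Rabs (s - t) < d ->
  exists h, f s = Inner h /\ forall x, Rabs (g x - h x) < eps.
Proof.
  intros Ht E eps He. destruct Hemb as (_ & _ & H3 & _).
  destruct (H3 t Ht (fun q => match q with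
     | Inner h => pt1 adj h /\ forall x, Rabs (g x - h x) < eps | EndP _ => False end))
    as (d & Hd & Hs).
  { rewrite E. exists eps. auto. }
  exists d. split; [assumption|]. intros s Us Hst. specialize (Hs s Us).
  unfold dist1 in Hs. rewrite Rabs_minus_sym in Hs. specialize (Hs Hst).
  destruct (f s) as [h|]; [|contradiction]. exists h. tauto.
Qed.

(** Around an inner point the arc meets no end. Another vertex is not within 1/2 of a vertex, and no
    vertex is within [Rmin l (1 - l)] of the edge point with weight [l]. *)
Lemma arc_iso t : unitI t -> ~ atend t -> exists d, 0 < d /\ forall s, Rabs (s - t) < d -> s <> t ->
  ~ (exists v, VB v /\ vtime v = s) /\ ~ atend s.
Proof.
  intros Ht Kt.
  assert (main : exists g d, f t = Inner g /\ 0 < d /\ forall s, unitI s -> Rabs (s - t) < d ->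
    exists h, f s = Inner h /\ forall v, h = vpt v -> h = g).
  { destruct (arc_cases t Ht) as [He|[(v & Hv & E)|(u & v & l & Huv & Hl & E)]].
    - exfalso. apply Kt. split; assumption.
    - destruct (f_near t _ Ht E (1 / 2) ltac:(lra)) as (d & Hd & Hs).
      exists (vpt v), d. repeat split; auto. intros s Us Hst.
      destruct (Hs s Us Hst) as (h & Eh & Hh). exists h. split; [assumption|].
      intros w ->. f_equal. apply NNPP; intro N. specialize (Hh v).
      rewrite vpt_same, (vpt_other _ w v) in Hh by auto. apply Rabs_def2 in Hh. lra.
    - pose proof (EB_ne u v Huv) as Nuv.
      destruct (f_near t _ Ht E (Rmin l (1 - l)) (Rmin_pos l (1 - l) ltac:(lra) ltac:(lra))) as (d & Hd & Hs).
      exists (mix l u v), d. repeat split; auto. intros s Us Hst.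
      destruct (Hs s Us Hst) as (h & Eh & Hh). exists h. split; [assumption|].
      intros w ->. exfalso. pose proof (Hh u) as Du. pose proof (Hh v) as Dv.
      rewrite mix_l in Du by assumption. rewrite mix_r in Dv by assumption.
      pose proof (Rmin_l l (1 - l)). pose proof (Rmin_r l (1 - l)).
      apply Rabs_def2 in Du, Dv. destruct (classic (u = w)) as [->|Nu].
      + rewrite (vpt_other _ w v) in Dv by auto. lra.
      + rewrite (vpt_other _ w u) in Du by auto. lra. }
  destruct main as (g & d & E & Hd & Hs). exists d. split; [assumption|].
  intros s Hst Nst. split.
  - intros (v & Hv & <-). destruct (vtime_spec v Hv) as [U F].
    destruct (Hs _ U Hst) as (h & Eh & Hh). apply Nst, f_inj; auto.
    rewrite E, Eh. f_equal. apply (Hh v). congruence.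
  - intros [Us [e Ee]]. destruct (Hs s Us Hst) as (h & Eh & _). congruence.
Qed.

(** Closer than 1 to [v] means positive weight at [v], so right beside a vertex the arc runs on one
    of the edges at that vertex. *)
Lemma arc_neighbour v t : VB v -> unitI t -> t <> vtime v ->
  (exists d, 0 < d /\ (forall s, unitI s -> Rabs (s - vtime v) < d ->
     exists h, f s = Inner h /\ forall x, Rabs (vpt v x - h x) < 1) /\ Rabs (t - vtime v) < d) ->
  exists w, EB v w /\ betw (vtime v) (vtime w) t.
Proof.
  intros Hv Ht Nt (d & Hd & Hs & Htd).
  destruct (Hs t Ht Htd) as (h & Eh & Hh). specialize (Hh v). rewrite vpt_same in Hh.
  apply Rabs_def2 in Hh.
  destruct (arc_cases t Ht) as [[e Ee]|[(w & Hw & Ew)|(a & b & l & Eab & Hl & El)]].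
  - congruence.
  - exfalso. rewrite Ew in Eh. injection Eh as <-. destruct (classic (v = w)) as [->|N].
    + apply Nt, vtime_eq; assumption.
    + rewrite vpt_other in Hh by assumption. lra.
  - pose proof El as El'. rewrite Eh in El. injection El as ->.
    pose proof (between_edge a b l t Eab Hl Ht El') as Hb.
    assert (v = a \/ v = b) as [-> | ->].
    { apply NNPP; intro Z. apply not_or_and in Z. rewrite mix_out in Hh by tauto. lra. }
    + exists b. auto.
    + exists a. split; [apply (proj2 Hsub); assumption|]. unfold betw in *. lra.
Qed.

Lemma arc_next v : VB v -> vtime v < 1 -> exists w, EB v w /\ vtime v < vtime w.
Proof.
  intros Hv Hlt. destruct (vtime_spec v Hv) as [U F].
  destruct (f_near _ _ U F 1 ltac:(lra)) as (d & Hd & Hs). unfold unitI in *.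
  set (t := Rmin 1 (vtime v + d / 2)).
  assert (Ht : vtime v < t <= 1 /\ t < vtime v + d) by (unfold t, Rmin; destruct Rle_dec; lra).
  destruct (arc_neighbour v t Hv) as (w & E & Hb); unfold unitI; try lra.
  - exists d. repeat split; auto. apply Rabs_def1; lra.
  - exists w. split; [assumption|]. unfold betw in Hb. lra.
Qed.

Lemma arc_prev v : VB v -> 0 < vtime v -> exists w, EB v w /\ vtime w < vtime v.
Proof.
  intros Hv Hlt. destruct (vtime_spec v Hv) as [U F].
  destruct (f_near _ _ U F 1 ltac:(lra)) as (d & Hd & Hs). unfold unitI in *.
  set (t := Rmax 0 (vtime v - d / 2)).
  assert (Ht : 0 <= t < vtime v /\ vtime v - d < t) by (unfold t, Rmax; destruct Rle_dec; lra).
  destruct (arc_neighbour v t Hv) as (w & E & Hb); unfold unitI; try lra.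
  - exists d. repeat split; auto. apply Rabs_def1; lra.
  - exists w. split; [assumption|]. unfold betw in Hb. lra.
Qed.

(** The arc is the closure of a subgraph, so no stretch of it consists of ends alone. *)
Lemma arc_dense t d : unitI t -> 0 < d -> exists s, unitI s /\ Rabs (s - t) < d /\ ~ atend s.
Proof.
  intros Ht Hd. destruct Hemb as (_ & _ & _ & H4). destruct (H4 t Ht d Hd) as (N & HN & Hc).
  assert (Hcl0 : closure V adj (subpts V VB EB) (f t)) by (apply Himg; eauto).
  destruct Hcl0 as [_ Hcl].
  destruct (Hcl N HN) as (q & Nq & Sq).
  assert (exists s, unitI s /\ f s = q) as (s & Us & Es).
  { apply Himg, subpts_closure; assumption. }
  exists s. split; [assumption|]. split.
  - rewrite Rabs_minus_sym. apply Hc; [assumption|]. congruence.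
  - intros [_ [e Ee]]. rewrite Es in Ee. rewrite Ee in Sq. exact Sq.
Qed.

(** If the arc is inside an edge at time [s], that edge contains no end and does not run past [k].
    Its endpoint with the smaller time then lies between [k] and [s]. *)
Lemma arc_vertex_near s k e : unitI s -> atend k -> ~ atend s -> k < s < k + e ->
  exists v, VB v /\ k < vtime v < k + e.
Proof.
  intros Us Kk Ks Hs.
  destruct (arc_cases s Us) as [He|[(v & Hv & E)|(u & v & l & Huv & Hl & E)]].
  - exfalso. apply Ks. split; assumption.
  - exists v. split; [assumption|]. rewrite <- (vtime_eq v s); auto.
  - pose proof (between_edge u v l s Huv Hl Us E) as Hb.
    pose proof (proj1 Hsub _ _ Huv) as (_ & Vu & Vv).
    assert (~ betw (vtime u) (vtime v) k).
    { intro B. destruct (edge_between u v k Huv B) as (l' & _ & El').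
      destruct Kk as [_ [e' Ee']]. congruence. }
    assert (vtime u <> k) by (intros Q; apply (vtime_not_end u Vu); rewrite Q; assumption).
    assert (vtime v <> k) by (intros Q; apply (vtime_not_end v Vv); rewrite Q; assumption).
    unfold betw in *. destruct (Rlt_dec (vtime u) (vtime v)); [exists u|exists v]; (split; [assumption|]); lra.
Qed.

Lemma arc_vertex_near' s k e : unitI s -> atend k -> ~ atend s -> k - e < s < k ->
  exists v, VB v /\ k - e < vtime v < k.
Proof.
  intros Us Kk Ks Hs.
  destruct (arc_cases s Us) as [He|[(v & Hv & E)|(u & v & l & Huv & Hl & E)]].
  - exfalso. apply Ks. split; assumption.
  - exists v. split; [assumption|]. rewrite <- (vtime_eq v s); auto.
  - pose proof (between_edge u v l s Huv Hl Us E) as Hb.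
    pose proof (proj1 Hsub _ _ Huv) as (_ & Vu & Vv).
    assert (~ betw (vtime u) (vtime v) k).
    { intro B. destruct (edge_between u v k Huv B) as (l' & _ & El').
      destruct Kk as [_ [e' Ee']]. congruence. }
    assert (vtime u <> k) by (intros Q; apply (vtime_not_end u Vu); rewrite Q; assumption).
    assert (vtime v <> k) by (intros Q; apply (vtime_not_end v Vv); rewrite Q; assumption).
    unfold betw in *. destruct (Rlt_dec (vtime u) (vtime v)); [exists v|exists u]; (split; [assumption|]); lra.
Qed.

Lemma arc_end_point t : unitI t -> t = 0 \/ t = 1 -> (exists v, VB v /\ vtime v = t) \/ atend t.
Proof.
  intros Ut Ht.
  destruct (arc_cases t Ut) as [He|[(v & Hv & E)|(u & v & l & Huv & Hl & E)]].
  - right. split; assumption.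
  - left. exists v. split; [assumption|]. symmetry. apply vtime_eq; assumption.
  - exfalso. pose proof (between_edge u v l t Huv Hl Ut E) as Hb.
    pose proof (proj1 Hsub _ _ Huv) as (_ & Vu & Vv).
    destruct (vtime_spec u Vu) as [A _]. destruct (vtime_spec v Vv) as [B _].
    unfold betw, unitI in *. lra.
Qed.

Theorem arc_line : line VB vtime atend EB.
Proof.
  constructor.
  - constructor.
    + lra.
    + intros t (v & Hv & <-). apply vtime_spec; assumption.
    + intros t [Ht _]. assumption.
    + intros t (v & Hv & <-). apply vtime_not_end; assumption.
    + apply arc_end_point; unfold unitI; lra.
    + apply arc_end_point; unfold unitI; lra.
    + intros t Ht Kt. apply arc_iso; assumption.
    + intros k e Kk Hk He. pose proof Kk as [Uk _]. unfold unitI in Uk.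
      set (m := Rmin e (1 - k)).
      assert (0 < m /\ m <= e /\ m <= 1 - k) by (unfold m, Rmin; destruct Rle_dec; lra).
      destruct (arc_dense (k + m / 2) (m / 2)) as (s & Us & Hs & Ks); [unfold unitI; lra|lra|].
      apply Rabs_def2 in Hs.
      destruct (arc_vertex_near s k e Us Kk Ks ltac:(lra)) as (v & Hv & Hr).
      exists (vtime v). split; [eauto|lra].
    + intros k e Kk Hk He. pose proof Kk as [Uk _]. unfold unitI in Uk.
      set (m := Rmin e k).
      assert (0 < m /\ m <= e /\ m <= k) by (unfold m, Rmin; destruct Rle_dec; lra).
      destruct (arc_dense (k - m / 2) (m / 2)) as (s & Us & Hs & Ks); [unfold unitI; lra|lra|].
      apply Rabs_def2 in Hs.
      destruct (arc_vertex_near' s k e Us Kk Ks ltac:(lra)) as (v & Hv & Hr).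
      exists (vtime v). split; [eauto|lra].
  - apply vtime_inj.
  - apply (proj2 Hsub).
  - intros u v E. pose proof (proj1 Hsub _ _ E) as (_ & Vu & Vv).
    split; [assumption|]. split; [assumption|]. split; [apply EB_ne; assumption|].
    intros t Hb. destruct (edge_between u v t E Hb) as (l & Hl & El). split.
    + intros [_ [e Ee]]. congruence.
    + intros w Hw <-. destruct (vtime_spec w Hw) as [_ F]. rewrite F in El. injection El as El.
      pose proof (EB_ne u v E) as N.
      assert (Q : vpt w u = l) by (rewrite El; apply mix_l; assumption).
      destruct (vpt_01 _ w u); lra.
  - apply arc_next.
  - apply arc_prev.
Qed.

End Arc.

(* [sp v] is the vertex of the spine that [v] lies on or is a leaf of;
   [w k] is the end that the spine passes at time [k]. *)
Record spine {V : Type} (adj : V -> V -> Prop) (Sp : V -> Prop) (p : V -> R) (K : R -> Prop)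
    (EB : V -> V -> Prop) (sp : V -> V) (w : R -> (nat -> V) -> Prop) : Prop := {
  spine_line : line Sp p K EB;
  spine_Sp : forall v, Sp (sp v);
  spine_id : forall v, Sp v -> sp v = v;
  spine_adj : forall v, ~ Sp v -> adj v (sp v);
  spine_EB : forall u v, EB u v -> adj u v;
  spine_leaf : forall v, Sp v -> p v = 0 \/ p v = 1 -> exists x, ~ Sp x /\ sp x = v;
  spine_end : forall k, K k -> is_end adj (w k);
  spine_end_inj : forall k k', K k -> K k' -> w k = w k' -> k = k';
  spine_cont : forall k S c, K k ->
    (forall r, w k r -> Defs.eventually (fun m => compS adj S c (r m))) ->
    exists d, 0 < d /\ (forall v, Sp v -> Rabs (p v - k) < d -> compS adj S c v) /\
      (forall k', K k' -> Rabs (k' - k) < d -> region V adj S c (EndP (w k')));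
  spine_open : forall k d, K k -> 0 < d -> exists S c,
    (forall r, w k r -> Defs.eventually (fun m => compS adj S c (r m))) /\
    forall v, Sp v -> compS adj S c v -> Rabs (p v - k) < d
}.
Arguments spine_line {V adj Sp p K EB sp w}.
Arguments spine_Sp {V adj Sp p K EB sp w}.
Arguments spine_id {V adj Sp p K EB sp w}.
Arguments spine_adj {V adj Sp p K EB sp w}.
Arguments spine_EB {V adj Sp p K EB sp w}.
Arguments spine_leaf {V adj Sp p K EB sp w}.
Arguments spine_end {V adj Sp p K EB sp w}.
Arguments spine_end_inj {V adj Sp p K EB sp w}.
Arguments spine_cont {V adj Sp p K EB sp w}.
Arguments spine_open {V adj Sp p K EB sp w}.

Lemma third_vertex (V : Type) : (exists a b c : V, a <> b /\ b <> c /\ a <> c) ->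
  forall x y : V, exists z, z <> x /\ z <> y.
Proof.
  intros (a & b & c & A & B & C) x y.
  destruct (classic (a = x \/ a = y)) as [Da|Da]; [|exists a; tauto].
  destruct (classic (b = x \/ b = y)) as [Db|Db]; [|exists b; tauto].
  exists c. destruct Da, Db; split; congruence.
Qed.

(** * From a topological caterpillar to its spine *)

Section Caterpillar.
Variables (V : Type) (adj : V -> V -> Prop) (VT : V -> Prop) (ET : V -> V -> Prop).
Hypothesis Hsym : symmetric_rel adj.
Hypothesis Hirr : irreflexive_rel adj.
Hypothesis Hthree : exists a b c : V, a <> b /\ b <> c /\ a <> c.
Hypothesis Hsub : subgraph V adj VT ET.
Hypothesis Htree : topological_tree V adj (closure V adj (subpts V VT ET)).
Hypothesis Hall : forall v, VT v.

(* A component of [T] consisting of a single edge would be open and closed in the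
   closure of [T], which is arc-connected. *)
Lemma leaf_not_leaf x y : leaf V VT ET x -> ET x y -> ~ leaf V VT ET y.
Proof.
  intros (_ & y' & Ey' & Uy) Exy (_ & x' & Ex' & Ux).
  assert (y' = y) by (symmetry; apply Uy; assumption). subst y'.
  assert (x' = x) by (symmetry; apply Ux; apply (proj2 Hsub); assumption). subst x'.
  destruct (third_vertex V Hthree x y) as (z & Nx & Ny).
  set (X := closure V adj (subpts V VT ET)) in *.
  assert (inX : forall v, X (Inner (vpt v))).
  { intro v. apply subpts_closure; [assumption|]. left. exists v.
    split; [apply Hall|apply is_vpt_vpt]. }
  destruct Htree as [Hcon _].
  destruct (Hcon (Inner (vpt x)) (Inner (vpt z)) (inX x) (inX z)) as (h & Hemb & H0 & H1 & HX).
  { intro E. injection E as E. apply vpt_inj in E. congruence. }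
  (* [D] is the closed edge between [x] and [y]. Membership in it is locally constant along the
     connecting path [h]; near an end this is seen by deleting [x] and [y]. *)
  set (D := fun q : Pt V => match q with Inner g => forall v, v <> x -> v <> y -> g v = 0
                                     | EndP _ => False end).
  assert (Q : D (h 0) <-> D (h 1)).
  2: { rewrite H0, H1 in Q. simpl in Q.
       assert (vpt z z = 0); [|rewrite vpt_same in H; lra].
       apply Q; [|assumption|assumption]. intros v N _. apply vpt_other; assumption. }
  apply (interval_glue (fun s u => D (h s) <-> D (h u))); [lra|tauto|].
  intros t Ht.
  cut (exists d, 0 < d /\ forall s, unitI s -> Rabs (s - t) < d -> (D (h s) <-> D (h t))).
  { intros (d & Hd & Hs). exists d. split; [assumption|]. unfold unitI in Hs.
    intros s u A1 A2 A3 A4 A5 A6. rewrite (Hs s), (Hs u); [tauto|lra| |lra|]; apply Rabs_def1; lra. }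
  assert (Xin : forall s g, unitI s -> h s = Inner g -> subpts V VT ET (Inner g)).
  { intros s g Us E. apply (closure_inner V adj); [assumption|]. fold X. rewrite <- E. apply HX, Us. }
  destruct (h t) as [g|e] eqn:Et.
  - destruct (classic (D (Inner g))) as [DE|DE].
    + assert (exists a, (a = x \/ a = y) /\ 0 < g a) as (a & Ha & Pa).
      { assert (Pt : pt1 adj g).
        { destruct Hemb as (Hin & _). specialize (Hin t Ht). rewrite Et in Hin. exact Hin. }
        destruct (pt1_pos _ _ _ Pt) as [a Pa]. exists a. split; [|assumption].
        apply NNPP; intro Z. apply not_or_and in Z. simpl in DE. rewrite DE in Pa by tauto. lra. }
      destruct (f_near V adj h Hemb t g Ht Et (g a) Pa) as (d & Hd & Hs).
      exists d. split; [assumption|]. intros s Us Hst. split; [tauto|intros _].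
      destruct (Hs s Us Hst) as (k & Ek & Hk). specialize (Hk a). apply Rabs_def2 in Hk.
      rewrite Ek. simpl.
      destruct (Xin s k Us Ek) as [(v & _ & [Hv1 Hv2])|(u & v & Euv & (_ & _ & _ & _ & Hz))].
      * assert (a = v) by (apply NNPP; intro N; rewrite Hv2 in Hk by assumption; lra). subst v.
        intros v N1 N2. apply Hv2. destruct Ha; congruence.
      * assert (xy : forall q r, q = x \/ q = y -> ET q r -> (q = x /\ r = y) \/ (q = y /\ r = x)).
        { intros q r [-> | ->] Eqr; [left|right]; split; auto. }
        assert (a = u \/ a = v) as [-> | ->].
        { apply NNPP; intro Z. apply not_or_and in Z. rewrite Hz in Hk by tauto. lra. }
        -- destruct (xy u v Ha Euv) as [[-> ->]|[-> ->]]; intros; apply Hz; assumption.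
        -- destruct (xy v u Ha (proj2 Hsub _ _ Euv)) as [[-> ->]|[-> ->]]; intros; apply Hz; assumption.
    + simpl in DE. apply not_all_ex_not in DE as [a Ha].
      apply imply_to_and in Ha as [N1 Ha]. apply imply_to_and in Ha as [N2 Ha].
      destruct (f_near V adj h Hemb t g Ht Et (Rabs (g a)) (Rabs_pos_lt _ Ha)) as (d & Hd & Hs).
      exists d. split; [assumption|]. intros s Us Hst.
      destruct (Hs s Us Hst) as (k & Ek & Hk). specialize (Hk a).
      rewrite Ek. simpl. split; intro Q; exfalso.
      * rewrite (Q a N1 N2), Rminus_0_r in Hk. lra.
      * auto.
  - destruct Hemb as (Hin & _ & H3 & _).
    assert (He : is_end adj e) by (specialize (Hin t Ht); rewrite Et in Hin; exact Hin).
    destruct (end_compS V adj Hsym e He [x; y]) as [c Hc].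
    destruct (H3 t Ht (region V adj [x; y] c)) as (d & Hd & Hs).
    { rewrite Et. exists [x; y], c. auto. }
    exists d. split; [assumption|]. intros s Us Hst.
    specialize (Hs s Us). unfold dist1 in Hs. rewrite Rabs_minus_sym in Hs. specialize (Hs Hst).
    split; [|intros []]. destruct (h s) as [k|e']; [|tauto].
    destruct Hs as (_ & (a & Pa & Ca) & _). intro Q. apply compS_notin in Ca. simpl in Ca, Q.
    rewrite Q in Pa; [lra| |]; intros ->; tauto.
Qed.

Let VB (v : V) : Prop := VT v /\ ~ leaf V VT ET v.
Let EB (u v : V) : Prop := ET u v /\ ~ leaf V VT ET u /\ ~ leaf V VT ET v.

Lemma spine_subgraph : subgraph V adj VB EB.
Proof.
  destruct Hsub as [H1 H2]. split.
  - intros u v (E & Lu & Lv). unfold VB. pose proof (H1 u v E). tauto.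
  - intros u v (E & Lu & Lv). repeat split; auto.
Qed.

Definition attach (v : V) : V :=
  if excluded_middle_informative (leaf V VT ET v) then epsilon (inhabits v) (ET v) else v.

Lemma attach_leaf v x : leaf V VT ET v -> ET v x -> attach v = x.
Proof.
  intros L E. unfold attach. destruct excluded_middle_informative; [|contradiction].
  destruct L as (_ & y & Ey & U). rewrite (U x E). apply U.
  apply epsilon_spec. eauto.
Qed.

Theorem caterpillar_spine :
  arc V adj (closure V adj (subpts V VB EB)) ->
  exists Sp p K EB sp w, @spine V adj Sp p K EB sp w.
Proof.
  intros (f & Hemb & Himg).
  pose proof (arc_line V adj VB EB f Hirr spine_subgraph Hemb Himg) as L.
  set (w := fun k => epsilon (inhabits (fun _ : nat -> V => True)) (fun e => f k = EndP e)).
  assert (Hw : forall k, atend V f k -> f k = EndP (w k)).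
  { intros k [_ He]. unfold w. apply epsilon_spec. assumption. }
  assert (Hat : forall v, leaf V VT ET v -> exists x, ET v x /\ attach v = x /\ VB x).
  { intros v Lv. pose proof Lv as (_ & x & Ex & _). exists x. split; [assumption|].
    split; [apply attach_leaf; assumption|]. split; [apply Hall|].
    apply (leaf_not_leaf v); assumption. }
  assert (Hnl : forall v, ~ VB v -> leaf V VT ET v).
  { intros v N. apply NNPP. intro Q. apply N. split; [apply Hall|assumption]. }
  (* A spine vertex with one neighbour on the spine is not a leaf of the forest, so it has another
     neighbour, and that one is a leaf. This is applied at the extremities of the arc. *)
  assert (Hout : forall v x, VB v -> EB v x -> (forall y, EB v y -> y = x) ->
            exists y, ~ VB y /\ attach y = v).
  { intros v x [_ Hv] (Evx & _ & Lx) U.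
    assert (exists y, ET v y /\ y <> x) as (y & Ey & Ny).
    { apply NNPP; intro Q. apply Hv. split; [apply Hall|]. exists x. split; [assumption|].
      intros y Ey. apply NNPP; intro. eauto. }
    assert (Ly : leaf V VT ET y).
    { apply NNPP; intro Q. apply Ny, U. repeat split; assumption. }
    exists y. split; [intros [_ Q]; contradiction|].
    apply attach_leaf; [assumption|]. apply (proj2 Hsub); assumption. }
  exists VB, (vtime V f), (atend V f), EB, attach, w. constructor.
  - exact L.
  - intro v. destruct (classic (leaf V VT ET v)) as [Lv|Lv].
    + destruct (Hat v Lv) as (x & _ & -> & Hx). assumption.
    + unfold attach. destruct excluded_middle_informative; [contradiction|]. split; auto.
  - intros v [_ Lv]. unfold attach. destruct excluded_middle_informative; [contradiction|reflexivity].
  - intros v N. destruct (Hat v (Hnl v N)) as (x & Ex & -> & _). apply (proj1 Hsub _ _ Ex).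
  - intros u v (E & _). apply (proj1 Hsub _ _ E).
  - intros v Hv Hp.
    assert (same : forall x y, EB v x -> EB v y ->
      (vtime V f v < vtime V f x /\ vtime V f v < vtime V f y) \/ (vtime V f x < vtime V f v /\ vtime V f y < vtime V f v) ->
      y = x).
    { intros x y Ex Ey Hs.
      pose proof (line_edge L _ _ Ex) as (_ & Sx & _ & Bx).
      pose proof (line_edge L _ _ Ey) as (_ & Sy & _ & By).
      apply (line_inj L); auto. unfold betw in *.
      destruct (Rtotal_order (vtime V f x) (vtime V f y)) as [M|[M|M]]; [|auto|].
      - destruct Hs; exfalso.
        + destruct (By (vtime V f x)) as [_ Q]; [lra|]. apply (Q x Sx); reflexivity.
        + destruct (Bx (vtime V f y)) as [_ Q]; [lra|]. apply (Q y Sy); reflexivity.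
      - destruct Hs; exfalso.
        + destruct (Bx (vtime V f y)) as [_ Q]; [lra|]. apply (Q y Sy); reflexivity.
        + destruct (By (vtime V f x)) as [_ Q]; [lra|]. apply (Q x Sx); reflexivity. }
    assert (rng : forall y, EB v y -> 0 <= vtime V f y <= 1 /\ vtime V f y <> vtime V f v).
    { intros y Ey. pose proof (line_edge L _ _ Ey) as (Sv & Sy & N & _). split.
      - apply (good_P (line_good L)). eauto.
      - intro Q. apply N. symmetry. apply (line_inj L); assumption. }
    destruct Hp as [Hp|Hp].
    + destruct (line_next L v Hv ltac:(lra)) as (x & Ex & Lx).
      apply (Hout v x Hv Ex). intros y Ey. apply same; auto. left.
      pose proof (rng y Ey). lra.
    + destruct (line_prev L v Hv ltac:(lra)) as (x & Ex & Lx).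
      apply (Hout v x Hv Ex). intros y Ey. apply same; auto. right.
      pose proof (rng y Ey). lra.
  - intros k Kk. destruct Hemb as (Hin & _). specialize (Hin k (proj1 Kk)).
    rewrite (Hw k Kk) in Hin. exact Hin.
  - intros k k' Kk Kk' E. destruct Hemb as (_ & Hinj & _).
    apply Hinj; [apply Kk|apply Kk'|]. rewrite (Hw k Kk), (Hw k' Kk'). congruence.
  - intros k S c Kk Hc. destruct Hemb as (_ & _ & H3 & _).
    destruct (H3 k (proj1 Kk) (region V adj S c)) as (d & Hd & Hs).
    { rewrite (Hw k Kk). exists S, c. auto. }
    exists d. split; [assumption|]. split.
    + intros v Hv Hk. destruct (vtime_spec V adj VB EB f spine_subgraph Himg v Hv) as [U F].
      specialize (Hs _ U). unfold dist1 in Hs. rewrite Rabs_minus_sym in Hs.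
      specialize (Hs Hk). rewrite F in Hs. destruct Hs as (_ & (x & Px & Cx) & _).
      assert (x = v) as <-; [|assumption].
      apply NNPP; intro N. rewrite vpt_other in Px by assumption. lra.
    + intros k' Kk' Hk. rewrite <- (Hw k' Kk'). apply Hs; [apply Kk'|].
      unfold dist1. rewrite Rabs_minus_sym. assumption.
  - intros k d Kk Hd. destruct Hemb as (_ & _ & _ & H4).
    destruct (H4 k (proj1 Kk) d Hd) as (N & HN & Hs). rewrite (Hw k Kk) in HN.
    destruct HN as (S & c & Hc & ->). exists S, c. split; [assumption|].
    intros v Hv Cv. destruct (vtime_spec V adj VB EB f spine_subgraph Himg v Hv) as [U F].
    rewrite Rabs_minus_sym. apply Hs; [assumption|]. rewrite F. split; [apply pt1_vpt|]. split.
    + exists v. split; [rewrite vpt_same; lra|assumption].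
    + intros x Px. left. assert (x = v) as ->; [|assumption].
      apply NNPP; intro Q. rewrite vpt_other in Px by assumption. lra.
Qed.

End Caterpillar.

(** * Loop-erased walks along the spine *)

(** In contrast to [good_rev] this reversal preserves the interval from 0 to 1. A line read
    backwards is again a line, and only convergence to time 0 has to be studied. *)
Lemma good_flip P K : good 0 1 P K -> good 0 1 (fun t => P (1 - t)) (fun t => K (1 - t)).
Proof.
  intros [H1 H2 H3 H4 H5 H6 H7 H8 H9]. constructor.
  - lra.
  - intros t Ht. apply H2 in Ht. lra.
  - intros t Ht. apply H3 in Ht. lra.
  - intros t. apply H4.
  - rewrite Rminus_0_r. assumption.
  - replace (1 - 1) with 0 by ring. assumption.
  - intros t Ht Hk. destruct (H7 (1 - t) ltac:(lra) Hk) as (d & Hd & H).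
    exists d; split; [assumption|]. intros s Hs Hst. apply H; [|lra].
    replace (1 - s - (1 - t)) with (- (s - t)) by ring. rewrite Rabs_Ropp. assumption.
  - intros k e Hk Hlt He. destruct (H9 (1 - k) e Hk ltac:(lra) He) as (s & Ps & Hs).
    exists (1 - s). replace (1 - (1 - s)) with s by ring. split; [assumption|lra].
  - intros k e Hk Hlt He. destruct (H8 (1 - k) e Hk ltac:(lra) He) as (s & Ps & Hs).
    exists (1 - s). replace (1 - (1 - s)) with s by ring. split; [assumption|lra].
Qed.

Lemma line_flip V (Sp : V -> Prop) p K EB : line Sp p K EB ->
  line Sp (fun v => 1 - p v) (fun t => K (1 - t)) EB.
Proof.
  intros [H1 H2 H3 H4 H5 H6]. constructor.
  - apply good_flip in H1.
    replace (fun t => exists v, Sp v /\ 1 - p v = t) with (fun t => exists v, Sp v /\ p v = 1 - t);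
      [assumption|].
    extensionality t. apply propositional_extensionality.
    split; intros (v & Hv & E); exists v; (split; [assumption|lra]).
  - intros u v Hu Hv E. apply H2; auto. lra.
  - assumption.
  - intros u v E. destruct (H4 u v E) as (A & B & C & D). repeat split; auto.
    + apply D. unfold betw in *. lra.
    + intros x Hx Q. apply (proj2 (D (1 - t) ltac:(unfold betw in *; lra)) x Hx). lra.
  - intros v Hv Hl. destruct (H6 v Hv ltac:(lra)) as (x & E & L). exists x. split; [assumption|lra].
  - intros v Hv Hl. destruct (H5 v Hv ltac:(lra)) as (x & E & L). exists x. split; [assumption|lra].
Qed.

Lemma last_time (P : nat -> Prop) N : (exists m, P m) -> (forall n, (N <= n)%nat -> ~ P n) ->
  exists m, P m /\ forall n, (m < n)%nat -> ~ P n.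
Proof.
  intros [m Pm]. revert m Pm. induction N as [|N IH]; intros m Pm HN.
  - exfalso. apply (HN m); [lia|assumption].
  - destruct (classic (P N)) as [PN|PN].
    + exists N. split; [assumption|]. intros n Hn. apply HN. lia.
    + apply (IH m Pm). intros n Hn. destruct (Nat.eq_dec n N) as [->|]; [assumption|]. apply HN. lia.
Qed.

Section Line.
Variables (V : Type) (Sp : V -> Prop) (p : V -> R) (K : R -> Prop) (EB : V -> V -> Prop).
Hypothesis L : line Sp p K EB.

(* For the spine, [sep u v] says that [u] and [v] lie in different components of the forest. *)
Definition sep (u v : V) : Prop := exists k, K k /\ betw (p u) (p v) k.

Lemma sep_sym u v : sep u v -> sep v u.
Proof. intros (k & Hk & B). exists k. split; [assumption|]. unfold betw in *. lra. Qed.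

Lemma p_range v : Sp v -> 0 <= p v <= 1.
Proof. intro Hv. apply (good_P (line_good L)). eauto. Qed.

Lemma p_not_K v : Sp v -> ~ K (p v).
Proof. intros Hv Hk. apply (good_dis (line_good L) (p v)); eauto. Qed.

Lemma p_neq_K v k : Sp v -> K k -> p v <> k.
Proof. intros Hv Hk <-. apply (p_not_K v); assumption. Qed.

(** No spine vertex has the time of an end, so [v] falls on one side of the separating end.
    Consequently not being separated is an equivalence relation on the spine. *)
Lemma sep_mid u v x : Sp v -> sep u x -> sep u v \/ sep v x.
Proof.
  intros Hv (k & Hk & B). pose proof (p_neq_K v k Hv Hk). unfold sep, betw in *.
  destruct (Rlt_dec (p v) k).
  - destruct B as [B|B]; [right|left]; exists k; (split; [assumption|lra]).
  - destruct B as [B|B]; [left|right]; exists k; (split; [assumption|lra]).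
Qed.

Lemma same_trans u v x : Sp v -> ~ sep u v -> ~ sep v x -> ~ sep u x.
Proof. intros Hv A B C. destruct (sep_mid u v x Hv C); contradiction. Qed.

Lemma sep_refl v : ~ sep v v.
Proof. intros (k & _ & B). unfold betw in B. lra. Qed.

Lemma sep_EB u v : EB u v -> ~ sep u v.
Proof.
  intros E (k & Hk & B). destruct (line_edge L u v E) as (_ & _ & _ & H).
  exact (proj1 (H k B) Hk).
Qed.

Lemma EB_Sp u v : EB u v -> Sp u /\ Sp v.
Proof. intro E. destruct (line_edge L u v E) as (A & B & _). auto. Qed.

Lemma EB_between u v x : EB u v -> Sp x -> ~ betw (p u) (p v) (p x).
Proof.
  intros E Hx B. destruct (line_edge L u v E) as (_ & _ & _ & H).
  exact (proj2 (H _ B) x Hx eq_refl).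
Qed.

(** Away from [K] the marks are isolated, so a compact interval that avoids [K] contains finitely
    many. *)
Lemma finite_between a b : 0 <= a -> b <= 1 -> (forall k, K k -> a <= k <= b -> False) ->
  exists l : list V, forall v, Sp v -> a <= p v <= b -> In v l.
Proof.
  intros Ha Hb HK. destruct (Rle_dec a b) as [Hab|Hab].
  2: { exists []. intros v _ Hv. lra. }
  apply (interval_glue (fun s u => exists l : list V, forall v, Sp v -> s <= p v <= u -> In v l));
    [assumption| |].
  - intros s t u _ _ _ _ [l1 H1] [l2 H2]. exists (l1 ++ l2). intros v Hv Hp.
    apply in_or_app. destruct (Rle_dec (p v) t); [left; apply H1|right; apply H2]; auto; lra.
  - intros t Ht.
    destruct (good_iso (line_good L) t ltac:(lra)) as (d & Hd & Hs).
    { intro Q. apply (HK t Q Ht). }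
    exists d. split; [assumption|]. intros s u H1 H2 H3 H4 H5 H6.
    assert (iso : forall v, Sp v -> s <= p v <= u -> p v = t).
    { intros v Hv Hp. apply NNPP; intro N. destruct (Hs (p v)) as [Q _]; [|assumption|].
      - apply Rabs_def1; lra.
      - apply Q. eauto. }
    destruct (classic (exists v, Sp v /\ p v = t)) as [(v & Hv & Ev)|N].
    + exists [v]. intros x Hx Hp. left. apply (line_inj L); auto.
      rewrite Ev. symmetry. auto.
    + exists []. intros v Hv Hp. apply N. eauto.
Qed.

Lemma injective_not_finite (o : nat -> V) n (l : list V) :
  (forall i j, (n <= i)%nat -> (i < j)%nat -> o i <> o j) ->
  exists i, (n <= i)%nat /\ ~ In (o i) l.
Proof.
  intro Hinj. apply NNPP; intro Hn.
  assert (incl (map o (seq n (S (length l)))) l) as Hi.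
  { intros x Hx. apply in_map_iff in Hx as (i & <- & Hi). apply in_seq in Hi.
    apply NNPP; intro. apply Hn. exists i. split; [lia|assumption]. }
  assert (NoDup (map o (seq n (S (length l))))) as Hnd.
  { apply NoDup_map_NoDup_ForallPairs; [|apply seq_NoDup].
    intros i j Hi' Hj E. apply in_seq in Hi', Hj. destruct (Nat.lt_trichotomy i j) as [Q|[Q|Q]]; auto.
    - exfalso. apply (Hinj i j); auto; lia.
    - exfalso. apply (Hinj j i); auto; lia. }
  pose proof (NoDup_incl_length Hnd Hi) as Q. rewrite length_map, length_seq in Q. lia.
Qed.

Definition nextv (v : V) : V := epsilon (inhabits v) (fun x => EB v x /\ p v < p x).
Definition prevv (v : V) : V := epsilon (inhabits v) (fun x => EB v x /\ p x < p v).

Lemma nextv_spec v : Sp v -> p v < 1 -> EB v (nextv v) /\ p v < p (nextv v).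
Proof. intros Hv Hl. unfold nextv. apply epsilon_spec. apply (line_next L); assumption. Qed.

Lemma prevv_spec v : Sp v -> 0 < p v -> EB v (prevv v) /\ p (prevv v) < p v.
Proof. intros Hv Hl. unfold prevv. apply epsilon_spec. apply (line_prev L); assumption. Qed.

Section Orbit.
Variable U : nat -> V.
Hypothesis USp : forall n, Sp (U n).
Hypothesis Ulim : forall e, 0 < e -> exists N, forall n, (N <= n)%nat -> p (U n) < e.

(** The component of [v] is the last one towards time 0. The time 0 itself may be an end, which the
    strict inequality permits. *)
Definition ext0 (v : V) : Prop := forall k, K k -> ~ 0 < k < p v.

Definition last_visit (v : V) (m : nat) : Prop :=
  ~ sep (U m) v /\ forall n, (m < n)%nat -> sep (U n) v.

Definition lastv (v : V) : nat := epsilon (inhabits 0%nat) (last_visit v).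

(* Walk inside the component of [v] to the place where the walk [U] leaves it for the
   last time, then jump with [U]. *)
Definition advance (v : V) : V :=
  if Req_dec_T (p v) 0 then v
  else if excluded_middle_informative (ext0 v) then prevv v
  else if excluded_middle_informative (v = U (lastv v)) then U (S (lastv v))
  else if Rlt_dec (p v) (p (U (lastv v))) then nextv v else prevv v.

(** The invariant of the orbit: outside the last component it guarantees that [lastv] is
    meaningful. *)
Definition visited (v : V) : Prop := Sp v /\ (ext0 v \/ exists m, ~ sep (U m) v).

(** An end between time 0 and [v] separates [v] from all late terms of [U], which tend to time 0. *)
Lemma last_visit_ex v : visited v -> ~ ext0 v -> exists m, last_visit v m.
Proof.
  intros [Hv [E|[m Hm]]] N; [contradiction|].
  apply not_all_ex_not in N as [k Hk]. apply imply_to_and in Hk as [Kk Hk]. apply NNPP in Hk.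
  destruct (Ulim k ltac:(lra)) as [n Hn].
  destruct (last_time (fun m => ~ sep (U m) v) n) as (q & Q1 & Q2); [eauto| |].
  - intros i Hi Q. apply Q. exists k. split; [assumption|]. specialize (Hn i Hi). unfold betw. lra.
  - exists q. split; [assumption|]. intros i Hi. apply NNPP. apply Q2; assumption.
Qed.

Lemma lastv_spec v : visited v -> ~ ext0 v -> last_visit v (lastv v).
Proof. intros Hv N. unfold lastv. apply epsilon_spec. apply last_visit_ex; assumption. Qed.

Lemma lastv_ge v m : visited v -> ~ ext0 v -> ~ sep (U m) v -> (m <= lastv v)%nat.
Proof.
  intros Hv N Hm. apply Nat.le_ngt. intro Q. apply Hm, (lastv_spec v Hv N), Q.
Qed.

Lemma ext0_same u v : Sp u -> Sp v -> ~ sep u v -> ext0 u -> ext0 v.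
Proof.
  intros Hu Hv S E k Kk Hk. pose proof (p_neq_K u k Hu Kk).
  destruct (Rlt_dec k (p u)); [apply (E k Kk); lra|].
  apply S. exists k. split; [assumption|]. unfold betw. lra.
Qed.

Lemma visited_same u v : Sp v -> visited u -> ~ sep u v -> visited v.
Proof.
  intros Hv [Hu [E|[m Hm]]] S; (split; [assumption|]).
  - left. apply (ext0_same u); assumption.
  - right. exists m. apply same_trans with u; assumption.
Qed.

Lemma lastv_same u v : Sp v -> visited u -> ~ ext0 u -> ~ sep u v -> lastv u = lastv v.
Proof.
  intros Hv Vu N S. pose proof (visited_same u v Hv Vu S) as Vv.
  assert (Nv : ~ ext0 v).
  { intro E. apply N, (ext0_same v u); auto; [apply Vu|]. intro Q. apply S, sep_sym, Q. }
  apply Nat.le_antisymm; apply lastv_ge; auto.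
  - apply same_trans with u; auto; [apply Vu|]. apply lastv_spec; assumption.
  - apply same_trans with v; auto. { apply lastv_spec; assumption. }
    intro Q. apply S, sep_sym, Q.
Qed.

Definition jump (v : V) : Prop := ~ ext0 v /\ v = U (lastv v).

(** The distance to this time is the measure that decreases with each move inside a component. *)
Definition target (v : V) : R :=
  if excluded_middle_informative (ext0 v) then 0 else p (U (lastv v)).

Lemma ext0_0 v : p v = 0 -> ext0 v.
Proof. intros E k _ H. lra. Qed.

Lemma advance_stop v : p v = 0 -> advance v = v.
Proof. intro E. unfold advance. destruct Req_dec_T; [reflexivity|contradiction]. Qed.

Lemma advance_jump v : jump v -> advance v = U (S (lastv v)).
Proof.
  intros [N E]. unfold advance. destruct Req_dec_T as [Q|Q].
  - exfalso. apply N, ext0_0, Q.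
  - destruct excluded_middle_informative; [contradiction|].
    destruct excluded_middle_informative; [reflexivity|contradiction].
Qed.

Lemma advance_move v : visited v -> p v <> 0 -> ~ jump v -> EB v (advance v) /\
  Rabs (p (advance v) - target v) < Rabs (p v - target v) /\
  p (advance v) <= Rmax (p v) (target v) /\ (ext0 v -> p (advance v) < p v).
Proof.
  intros Vv N0 Nj. pose proof (proj1 Vv) as Hv. pose proof (p_range v Hv) as Rv.
  unfold advance, target. destruct Req_dec_T as [Q|Q]; [contradiction|].
  destruct excluded_middle_informative as [E|E].
  - destruct (prevv_spec v Hv ltac:(lra)) as [A B]. pose proof (p_range _ (proj2 (EB_Sp _ _ A))).
    split; [assumption|]. split.
    + rewrite !Rminus_0_r, !Rabs_right; lra.
    + split; [|auto]. apply Rle_trans with (p v); [lra|apply Rmax_l].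
  - destruct excluded_middle_informative as [E'|E'].
    { exfalso. apply Nj. split; assumption. }
    set (g := U (lastv v)) in *. pose proof (p_range g (USp _)) as Rg.
    assert (p v <> p g).
    { intro Q'. apply E'. apply (line_inj L); auto. apply USp. }
    destruct (Rlt_dec (p v) (p g)) as [Hlt|Hlt].
    + destruct (nextv_spec v Hv ltac:(lra)) as [A B].
      pose proof (EB_between v (nextv v) g A (USp _)) as C. unfold betw in C.
      split; [assumption|]. split; [|split; [|contradiction]].
      * rewrite !Rabs_left1; lra.
      * apply Rle_trans with (p g); [lra|apply Rmax_r].
    + destruct (prevv_spec v Hv ltac:(lra)) as [A B].
      pose proof (EB_between v (prevv v) g A (USp _)) as C. unfold betw in C.
      split; [assumption|]. split; [|split; [|contradiction]].
      * rewrite !Rabs_right; lra.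
      * apply Rle_trans with (p v); [lra|apply Rmax_l].
Qed.

Lemma advance_visited v : visited v -> visited (advance v).
Proof.
  intros Vv. destruct (Req_dec (p v) 0) as [E|N].
  { rewrite advance_stop; assumption. }
  destruct (classic (jump v)) as [J|J].
  - rewrite advance_jump by assumption. split; [apply USp|]. right. eexists. apply sep_refl.
  - destruct (advance_move v Vv N J) as (A & _). apply (visited_same v); auto.
    + apply (EB_Sp _ _ A).
    + apply sep_EB; assumption.
Qed.

Lemma jump_sep v : visited v -> jump v -> sep v (U (S (lastv v))).
Proof.
  intros Vv [N _]. apply sep_sym. apply (lastv_spec v Vv N). lia.
Qed.

Lemma target_same u v : Sp v -> visited u -> ~ sep u v -> target u = target v.
Proof.
  intros Hv Vu S. unfold target.
  assert (ext0 u <-> ext0 v).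
  { split; intro E; [apply (ext0_same u v)|apply (ext0_same v u)]; auto; try apply Vu.
    intro Q. apply S, sep_sym, Q. }
  destruct excluded_middle_informative, excluded_middle_informative; try tauto.
  rewrite (lastv_same u v); auto.
Qed.

Fixpoint orbit (v : V) (n : nat) : V :=
  match n with O => v | S n => advance (orbit v n) end.

Variable v0 : V.
Hypothesis Vv0 : visited v0.
Let o := orbit v0.

Lemma orbit_visited n : visited (o n).
Proof. induction n; [assumption|]. apply advance_visited; assumption. Qed.

Lemma orbit_Sp n : Sp (o n).
Proof. apply orbit_visited. Qed.

Lemma orbit_step n : (p (o n) = 0 /\ o (S n) = o n) \/ EB (o n) (o (S n)) \/
  (exists m, o n = U m /\ o (S n) = U (S m) /\ sep (o n) (o (S n))).
Proof.
  pose proof (orbit_visited n) as Vn. change (o (S n)) with (advance (o n)).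
  destruct (Req_dec (p (o n)) 0) as [E|N]; [left; split; auto using advance_stop|right].
  destruct (classic (jump (o n))) as [J|J].
  - right. exists (lastv (o n)). rewrite advance_jump by assumption. split; [apply J|].
    split; [reflexivity|]. apply jump_sep; assumption.
  - left. apply advance_move; assumption.
Qed.

Lemma orbit_step_same n : ~ jump (o n) -> ~ sep (o n) (o (S n)).
Proof.
  intro J. pose proof (orbit_visited n) as Vn. change (o (S n)) with (advance (o n)).
  destruct (Req_dec (p (o n)) 0) as [E|N].
  - rewrite advance_stop by assumption. apply sep_refl.
  - apply sep_EB. apply advance_move; assumption.
Qed.

(** A jump lands one index beyond the last visit, so the indices at which [U] meets the current
    component can be chosen never to decrease. *)
Lemma orbit_follows n m : (exists i, (m <= i)%nat /\ ~ sep (U i) (o n)) ->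
  forall j, (n <= j)%nat -> exists i, (m <= i)%nat /\ ~ sep (U i) (o j).
Proof.
  intros Hn j Hj. induction Hj as [|j Hj (i & Hi & Si)]; [assumption|].
  destruct (classic (jump (o j))) as [J|J].
  - exists (S (lastv (o j))). split.
    + pose proof (lastv_ge (o j) i (orbit_visited j) (proj1 J) Si). lia.
    + change (o (S j)) with (advance (o j)). rewrite advance_jump by assumption. apply sep_refl.
  - exists i. split; [assumption|]. apply same_trans with (o j); auto using orbit_Sp, orbit_step_same.
Qed.

Lemma orbit_after_jump n : jump (o n) -> forall j, (n < j)%nat ->
  exists i, (lastv (o n) < i)%nat /\ ~ sep (U i) (o j).
Proof.
  intros J j Hj. apply (orbit_follows (S n) (S (lastv (o n)))); [|lia].
  exists (S (lastv (o n))). split; [lia|].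
  change (o (S n)) with (advance (o n)). rewrite advance_jump by assumption. apply sep_refl.
Qed.

(** Every later component is met by [U] after the last visit of [U] to the component of [o n]. *)
Lemma orbit_no_return n : jump (o n) -> forall j, (n < j)%nat -> sep (o n) (o j).
Proof.
  intros J j Hj. destruct (orbit_after_jump n J j Hj) as (i & Hi & Si).
  apply NNPP; intro Q.
  assert (sep (U i) (o n)) as C.
  { apply (lastv_spec (o n) (orbit_visited n) (proj1 J)). assumption. }
  destruct (sep_mid (U i) (o j) (o n) (orbit_Sp j) C) as [C'|C']; [contradiction|].
  apply Q, sep_sym, C'.
Qed.

Lemma orbit_contiguous i j : (i < j)%nat -> ~ sep (o i) (o j) ->
  forall k, (i <= k)%nat -> (k < j)%nat -> ~ jump (o k).
Proof.
  intros Hij S k Hik Hkj.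
  assert (Q : forall k, (i <= k)%nat -> (k < j)%nat -> ~ sep (o i) (o k) /\ ~ jump (o k)).
  { intros q Hq. induction Hq as [|q Hq IH]; intro Hqj.
    - split; [apply sep_refl|]. intro J. apply S, orbit_no_return; assumption.
    - destruct IH as [Sq Jq]; [lia|].
      assert (S' : ~ sep (o i) (o (Datatypes.S q))).
      { apply same_trans with (o q); auto using orbit_Sp, orbit_step_same. }
      split; [assumption|]. intro J.
      destruct (sep_mid _ (o i) _ (orbit_Sp i) (orbit_no_return _ J j Hqj)) as [Z|Z];
        [apply S', sep_sym, Z|contradiction]. }
  apply Q; assumption.
Qed.

Lemma orbit_stop n j : p (o n) = 0 -> (n <= j)%nat -> o j = o n.
Proof.
  intros E Hj. induction Hj as [|j Hj IH]; [reflexivity|].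
  change (o (S j)) with (advance (o j)). rewrite IH. apply advance_stop, E.
Qed.

(** Equal terms lie in one component with no jump between them. There each move comes strictly
    closer to the common target, so only the stopped orbit can repeat a vertex. *)
Lemma orbit_inj i j : (i < j)%nat -> o i = o j -> p (o i) = 0.
Proof.
  intros Hij E. apply NNPP; intro N.
  pose proof (orbit_contiguous i j Hij) as C. rewrite <- E in C. specialize (C (sep_refl _)).
  assert (Q : forall k, (i < k)%nat -> (k <= j)%nat -> ~ sep (o i) (o k) /\
            Rabs (p (o k) - target (o i)) < Rabs (p (o i) - target (o i))).
  { assert (st : forall k, (i <= k)%nat -> (k < j)%nat -> ~ sep (o i) (o k) ->
      ~ sep (o i) (o (S k)) /\
      Rabs (p (o (S k)) - target (o i)) < Rabs (p (o k) - target (o i))).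
    { intros k H1 H2 Hs. split.
      - apply same_trans with (o k); auto using orbit_Sp, orbit_step_same.
      - rewrite (target_same (o i) (o k)); auto using orbit_Sp, orbit_visited.
        apply (advance_move (o k)); auto using orbit_visited.
        intro Z. apply N. rewrite E, (orbit_stop k j Z); [assumption|lia]. }
    intros k Hk. induction Hk as [|k Hk IH]; intro Hkj.
    - apply st; [lia|lia|apply sep_refl].
    - destruct IH as [S1 D1]; [lia|]. destruct (st k ltac:(lia) ltac:(lia) S1) as [S2 D2].
      split; [assumption|lra]. }
  destruct (Q j Hij (le_n j)) as [_ D]. rewrite <- E in D. lra.
Qed.

(** Without a jump the orbit would be injective and confined to the finitely many spine vertices
    between [o n] and its target. *)
Lemma orbit_leaves n : ~ ext0 (o n) -> exists m, (n <= m)%nat /\ jump (o m).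
Proof.
  intro N. apply NNPP; intro Hn.
  assert (NJ : forall m, (n <= m)%nat -> ~ jump (o m)) by (intros m Hm J; eauto).
  assert (Sm : forall m, (n <= m)%nat -> ~ sep (o n) (o m)).
  { intros m Hm. induction Hm as [|m Hm IH]; [apply sep_refl|].
    apply same_trans with (o m); auto using orbit_Sp, orbit_step_same. }
  assert (Nm : forall m, (n <= m)%nat -> ~ ext0 (o m)).
  { intros m Hm E. apply N, (ext0_same (o m)); auto using orbit_Sp.
    intro Q. apply (Sm m Hm), sep_sym, Q. }
  set (g := U (lastv (o n))).
  assert (Hg : ~ sep (o n) g).
  { intro Q. apply (lastv_spec (o n) (orbit_visited n) N), sep_sym, Q. }
  assert (D : forall m, (n <= m)%nat -> Rabs (p (o m) - p g) <= Rabs (p (o n) - p g)).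
  { intros m Hm. induction Hm as [|m Hm IH]; [lra|].
    destruct (advance_move (o m) (orbit_visited m)) as (_ & A & _).
    - intro Z. apply (Nm m Hm), ext0_0, Z.
    - apply NJ; assumption.
    - change (o (S m)) with (advance (o m)).
      assert (target (o m) = p g) as T.
      { rewrite <- (target_same (o n)); auto using orbit_Sp, orbit_visited.
        unfold target. destruct excluded_middle_informative; [contradiction|reflexivity]. }
      rewrite T in A. lra. }
  pose proof (p_range _ (orbit_Sp n)) as Rn. pose proof (p_range g (USp _)) as Rg.
  set (r := Rabs (p (o n) - p g)) in *.
  destruct (finite_between (Rmin (p (o n)) (p g)) (Rmax (p (o n)) (p g))) as [l Hl].
  { unfold Rmin; destruct Rle_dec; lra. }
  { unfold Rmax; destruct Rle_dec; lra. }
  { intros k Kk Hk. pose proof (p_neq_K _ k (orbit_Sp n) Kk). pose proof (p_neq_K g k (USp _) Kk).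
    apply Hg. exists k. split; [assumption|]. revert Hk. unfold betw, Rmin, Rmax.
    destruct Rle_dec; lra. }
  destruct (injective_not_finite o n l) as (i & Hi & Ni).
  { intros i j Hi Hij E. apply (Nm i Hi), ext0_0, (orbit_inj i j); assumption. }
  apply Ni, Hl; [apply orbit_Sp|].
  (* The target is itself a spine vertex, so a move along a spine edge cannot step over it. *)
  assert (side : forall m, (n <= m)%nat -> (p (o n) <= p g -> p (o m) <= p g) /\
                   (p g <= p (o n) -> p g <= p (o m))).
  { intros m Hm. induction Hm as [|m Hm [IH1 IH2]]; [split; auto|].
    destruct (advance_move (o m) (orbit_visited m)) as (A & B & _).
    - intro Z. apply (Nm m Hm), ext0_0, Z.
    - apply NJ; assumption.
    - change (o (S m)) with (advance (o m)).
      pose proof (EB_between _ _ g A (USp _)) as C. unfold betw in C.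
      assert (p (o m) <> p g).
      { intro Z. apply (NJ m Hm). split; [apply Nm; assumption|].
        rewrite <- (lastv_same (o n)); auto using orbit_Sp, orbit_visited.
        apply (line_inj L); auto using orbit_Sp. }
      split; intro; [specialize (IH1 ltac:(assumption))|specialize (IH2 ltac:(assumption))]; lra. }
  destruct (side i Hi) as [S1 S2]. specialize (D i Hi). unfold r in D. revert D.
  unfold Rmin, Rmax. destruct Rle_dec as [Q|Q].
  - specialize (S1 Q). rewrite !Rabs_left1 by lra. lra.
  - specialize (S2 ltac:(lra)). rewrite !Rabs_right by lra. lra.
Qed.

Lemma orbit_ext_down n m : ext0 (o n) -> (n <= m)%nat -> ext0 (o m) /\ p (o m) <= p (o n).
Proof.
  intros E Hm. induction Hm as [|m Hm [IH1 IH2]]; [split; [assumption|lra]|].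
  change (o (S m)) with (advance (o m)).
  destruct (Req_dec (p (o m)) 0) as [Z|Z].
  - rewrite advance_stop by assumption. auto.
  - destruct (advance_move (o m) (orbit_visited m) Z) as (A & _ & _ & B).
    { intros [Q _]. contradiction. }
    split; [|specialize (B IH1); lra].
    apply (ext0_same (o m)); auto using orbit_Sp, sep_EB. apply (EB_Sp _ _ A).
Qed.

Lemma orbit_lastv_mono n m : (forall i, ~ ext0 (o i)) -> (n <= m)%nat ->
  (lastv (o n) <= lastv (o m))%nat.
Proof.
  intros N Hm. induction Hm as [|m Hm IH]; [lia|].
  destruct (classic (jump (o m))) as [J|J].
  - transitivity (S (lastv (o m))); [lia|].
    apply lastv_ge; auto using orbit_visited.
    change (o (S m)) with (advance (o m)). rewrite advance_jump by assumption. apply sep_refl.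
  - rewrite <- (lastv_same (o m) (o (S m))); auto using orbit_visited, orbit_Sp, orbit_step_same.
Qed.

Lemma orbit_lastv_unbounded : (forall i, ~ ext0 (o i)) -> forall M, exists n, (M <= lastv (o n))%nat.
Proof.
  intros N M. induction M as [|M [n IH]].
  - exists 0%nat. lia.
  - destruct (orbit_leaves n (N n)) as (m & Hm & J). exists (S m).
    pose proof (orbit_lastv_mono n m N Hm).
    enough (S (lastv (o m)) <= lastv (o (S m)))%nat by lia.
    apply lastv_ge; auto using orbit_visited.
    change (o (S m)) with (advance (o m)). rewrite advance_jump by assumption. apply sep_refl.
Qed.

(** In the last component the orbit descends, and only finitely many of its vertices lie above [e].
    If it never gets there, the indices [lastv] grow without bound, and from a late jump onwards
    both landing places and targets are late terms of [U]. *)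
Theorem orbit_lim e : 0 < e -> exists N, forall n, (N <= n)%nat -> p (o n) < e.
Proof.
  intro He. destruct (classic (exists N, ext0 (o N))) as [[N EN]|NE].
  - apply NNPP; intro Hn.
    assert (big : forall n, (N <= n)%nat -> e <= p (o n)).
    { intros n Hnn. apply Rnot_lt_le. intro Q. apply Hn. exists n. intros m Hm.
      destruct (orbit_ext_down N n EN Hnn) as [En _].
      destruct (orbit_ext_down n m En Hm). lra. }
    pose proof (p_range _ (orbit_Sp N)) as RN.
    destruct (finite_between e (p (o N))) as [l Hl]; [lra|lra| |].
    { intros k Kk Hk. pose proof (p_neq_K _ k (orbit_Sp N) Kk). apply (EN k Kk). lra. }
    destruct (injective_not_finite o N l) as (i & Hi & Ni).
    { intros i j Hi Hij E. pose proof (orbit_inj i j Hij E). pose proof (big i Hi). lra. }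
    apply Ni, Hl; [apply orbit_Sp|]. split; [apply big, Hi|].
    apply (orbit_ext_down N i EN Hi).
  - assert (NE' : forall i, ~ ext0 (o i)) by (intros i Q; eauto).
    destruct (Ulim e He) as [M HM].
    destruct (orbit_lastv_unbounded NE' M) as [n1 Hn1].
    destruct (orbit_leaves n1 (NE' n1)) as (m & Hm & J).
    pose proof (orbit_lastv_mono n1 m NE' Hm).
    exists (S m). intros n Hn.
    assert (Q : p (o n) < e /\ (M <= lastv (o n))%nat); [|tauto].
    induction Hn as [|n Hn [IH1 IH2]].
    + split; [|pose proof (orbit_lastv_mono m (S m) NE' (Nat.le_succ_diag_r m)); lia].
      change (o (S m)) with (advance (o m)). rewrite advance_jump by assumption. apply HM. lia.
    + split; [|pose proof (orbit_lastv_mono n (S n) NE' (Nat.le_succ_diag_r n)); lia].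
      change (o (S n)) with (advance (o n)).
      destruct (classic (jump (o n))) as [Jn|Jn].
      * rewrite advance_jump by assumption. apply HM. lia.
      * destruct (advance_move (o n) (orbit_visited n)) as (_ & _ & B & _); auto.
        { intro Z. apply (NE' n), ext0_0, Z. }
        assert (target (o n) < e).
        { unfold target. destruct excluded_middle_informative; [lra|]. apply HM. assumption. }
        eapply Rle_lt_trans; [exact B|]. apply Rmax_lub_lt; assumption.
Qed.

End Orbit.
End Line.
Arguments p_range {V Sp p K EB}.
Arguments p_neq_K {V Sp p K EB}.
Arguments sep_mid {V Sp p K EB}.
Arguments same_trans {V Sp p K EB}.
Arguments sep_EB {V Sp p K EB}.
Arguments EB_Sp {V Sp p K EB}.
Arguments EB_between {V Sp p K EB}.
Arguments ext0_same {V Sp p K EB}.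
Arguments visited_same {V Sp p K EB}.
Arguments lastv_same {V Sp p K EB}.
Arguments orbit_Sp {V Sp p K EB}.
Arguments orbit_visited {V Sp p K EB}.
Arguments orbit_step {V Sp p K EB}.
Arguments orbit_step_same {V Sp p K EB}.
Arguments orbit_contiguous {V Sp p K EB}.
Arguments orbit_inj {V Sp p K EB}.
Arguments orbit_lim {V Sp p K EB}.
Arguments orbit_leaves {V Sp p K EB}.
Arguments orbit_ext_down {V Sp p K EB}.
Arguments orbit_no_return {V Sp p K EB}.
Arguments orbit_after_jump {V Sp p K EB}.

Lemma sep_flip V (p : V -> R) K u v :
  sep V (fun v => 1 - p v) (fun t => K (1 - t)) u v <-> sep V p K u v.
Proof.
  split; intros (k & Hk & B); exists (1 - k).
  - split; [assumption|]. unfold betw in *. lra.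
  - replace (1 - (1 - k)) with k by ring. split; [assumption|]. unfold betw in *. lra.
Qed.

(** * Two erased walks in opposite directions *)

Section Arms.
Variables (V : Type) (adj : V -> V -> Prop) (Sp : V -> Prop) (EB : V -> V -> Prop) (sp : V -> V).
Hypothesis Hsym : symmetric_rel adj.

(** An edge of the graph as seen from the spine: its endpoints may be leaves at [u] and [v], which
    matters when blocks are ordered. *)
Definition link (u v : V) : Prop := exists y x, sp y = u /\ sp x = v /\ adj y x.

Lemma link_sym u v : link u v -> link v u.
Proof. intros (y & x & A & B & C). exists x, y. auto. Qed.

(** An erased orbit stays for ever at a vertex of time 0 once it is there, so steps are constrained
    only before that time and repetitions are allowed only at it. *)
Record arm (p : V -> R) (K : R -> Prop) (o : nat -> V) : Prop := {
  arm_Sp : forall n, Sp (o n);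
  arm_step : forall n, p (o n) <> 0 ->
    EB (o n) (o (S n)) \/ (link (o n) (o (S n)) /\ sep V p K (o n) (o (S n)));
  arm_contig : forall i j, (i < j)%nat -> ~ sep V p K (o i) (o j) ->
    forall k, (i <= k)%nat -> (k < j)%nat -> ~ sep V p K (o k) (o (S k));
  arm_inj : forall i j, (i < j)%nat -> o i = o j -> p (o i) = 0;
  arm_lim : forall e, 0 < e -> exists N, forall n, (N <= n)%nat -> p (o n) < e
}.
Arguments arm_Sp {p K o}.
Arguments arm_step {p K o}.
Arguments arm_contig {p K o}.
Arguments arm_inj {p K o}.
Arguments arm_lim {p K o}.

Lemma orbit_arm p K (W : nat -> V) v : line Sp p K EB ->
  (forall x, Sp (sp x)) ->
  (forall n, W n = W (S n) \/ adj (W n) (W (S n))) ->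
  (forall e, 0 < e -> exists N, forall n, (N <= n)%nat -> p (sp (W n)) < e) ->
  visited V Sp p K (fun n => sp (W n)) v -> arm p K (orbit V p K EB (fun n => sp (W n)) v).
Proof.
  intros L Hsp Hst Hlim Vv.
  assert (USp : forall n, Sp (sp (W n))) by (intro; apply Hsp).
  constructor.
  - intro n. apply (orbit_Sp L _ USp v Vv).
  - intros n N. destruct (orbit_step L _ USp Hlim v Vv n) as [[Z _]|[E|(m & A & B & C)]].
    + contradiction.
    + left. assumption.
    + right. split; [|assumption]. destruct (Hst m) as [Q|Q].
      * exfalso. rewrite A, B in C. rewrite Q in C. apply (sep_refl V p K _ C).
      * exists (W m), (W (S m)). auto.
  - intros i j Hij S k Hik Hkj.
    apply (orbit_step_same L _ USp v Vv).
    apply (orbit_contiguous L _ USp Hlim v Vv i j); assumption.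
  - intros i j Hij E. apply (orbit_inj L _ USp Hlim v Vv i j); assumption.
  - apply (orbit_lim L _ USp Hlim v Vv).
Qed.

Variables (p : V -> R) (K : R -> Prop).
Hypothesis L : line Sp p K EB.
Hypothesis HspSp : forall x, Sp (sp x).
Let p' := fun v => 1 - p v.
Let K' := fun t => K (1 - t).
Let L' : line Sp p' K' EB := line_flip V Sp p K EB L.

(** The steps before the next jump do not leave the component, so that jump starts in the component
    of the term [n]. *)
Lemma orbit_leaves_first (q : V -> R) (Q : R -> Prop) (Lq : line Sp q Q EB) U
  (USp : forall n, Sp (U n))
  (Ulim : forall e, 0 < e -> exists N, forall n, (N <= n)%nat -> q (U n) < e)
  v (Vv : visited V Sp q Q U v) n :
  ~ ext0 V q Q (orbit V q Q EB U v n) ->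
  exists m, (n <= m)%nat /\ jump V q Q U (orbit V q Q EB U v m) /\
    ~ sep V q Q (orbit V q Q EB U v n) (orbit V q Q EB U v m).
Proof.
  intro N. destruct (orbit_leaves Lq U USp Ulim v Vv n N) as (m & Hm & J).
  remember (m - n)%nat as d eqn:Hd. revert n m Hm J N Hd. induction d as [|d IH]; intros n m Hm J N Hd.
  - replace n with m by lia. exists m. split; [lia|]. split; [assumption|apply sep_refl].
  - destruct (classic (jump V q Q U (orbit V q Q EB U v n))) as [Jn|Jn].
    { exists n. split; [lia|]. split; [assumption|apply sep_refl]. }
    pose proof (orbit_step_same Lq U USp v Vv n Jn) as Sn.
    destruct (IH (S n) m) as (m' & A & B & C); auto; try lia.
    { intro E. apply N. apply (ext0_same Lq (orbit V q Q EB U v (S n))); auto.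
      - apply (orbit_Sp Lq U USp v Vv).
      - apply (orbit_Sp Lq U USp v Vv).
      - intro Z. apply Sn, sep_sym, Z. }
    exists m'. split; [lia|]. split; [assumption|].
    apply (same_trans Lq _ (orbit V q Q EB U v (S n))); auto.
    apply (orbit_Sp Lq U USp v Vv).
Qed.

Section TwoWalks.
Variables (W0 W1 : nat -> V).
Hypothesis W00 : W0 0%nat = W1 0%nat.
Hypothesis st0 : forall n, W0 n = W0 (S n) \/ adj (W0 n) (W0 (S n)).
Hypothesis st1 : forall n, W1 n = W1 (S n) \/ adj (W1 n) (W1 (S n)).
Hypothesis lim0 : forall e, 0 < e -> exists N, forall n, (N <= n)%nat -> p (sp (W0 n)) < e.
Hypothesis lim1 : forall e, 0 < e -> exists N, forall n, (N <= n)%nat -> p' (sp (W1 n)) < e.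

Let U0 := fun n => sp (W0 n).
Let U1 := fun n => sp (W1 n).
Let S0 : forall n, Sp (U0 n) := fun n => HspSp (W0 n).
Let S1 : forall n, Sp (U1 n) := fun n => HspSp (W1 n).
Let o0 := orbit V p K EB U0.
Let o1 := orbit V p' K' EB U1.

(* Both arms start in the same component, and they leave it at different places. *)
Definition arms_ok (a b : nat -> V) : Prop :=
  a 0%nat = b 0%nat /\ arm p K a /\ arm p' K' b /\
  (forall i j, ~ sep V p K (a i) (b j) ->
     (forall k, (k < i)%nat -> ~ sep V p K (a k) (a (S k))) /\
     (forall k, (k < j)%nat -> ~ sep V p K (b k) (b (S k)))) /\
  (forall i j, (forall m, (m < i)%nat -> p (a m) <> 0) -> (forall m, (m < j)%nat -> p' (b m) <> 0) ->
     a i = b j -> i = 0%nat /\ j = 0%nat).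

Lemma live_start (q : V -> R) (Q : R -> Prop) a i : arm q Q a ->
  (forall m, (m < i)%nat -> q (a m) <> 0) -> a i = a 0%nat -> i = 0%nat.
Proof.
  intros A Hl E. destruct i as [|i]; [reflexivity|exfalso].
  apply (Hl 0%nat); [lia|]. apply (arm_inj A 0%nat (S i)); [lia|auto].
Qed.

(** The walk towards time 1 is erased first. If its orbit meets the last component towards 0, the
    arm to 0 can stay in that component, and both arms start where the other one leaves it.
    Otherwise they start at the last term of the walk towards 0 that lies in a component of the
    orbit, so that the arm to 0 leaves at once and never meets these components again. *)
Lemma arms_exist : exists a b, arms_ok a b.
Proof.
  pose proof (fun v Vv => orbit_arm p K W0 v L HspSp st0 lim0 Vv) as A0.
  pose proof (fun v Vv => orbit_arm p' K' W1 v L' HspSp st1 lim1 Vv) as A1.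
  fold U0 in A0. fold U1 in A1.
  set (u := sp (W1 0%nat)).
  assert (Vu : visited V Sp p' K' U1 u).
  { split; [apply HspSp|]. right. exists 0%nat. apply sep_refl. }
  pose proof (orbit_Sp L' U1 S1 u Vu) as OSp.
  pose proof (orbit_visited L' U1 S1 u Vu) as OV.
  assert (flip : forall x y, sep V p' K' x y <-> sep V p K x y) by (intros; apply sep_flip).
  destruct (classic (exists n, ext0 V p K (orbit V p' K' EB U1 u n))) as [[n En]|NE].
  - set (x := orbit V p' K' EB U1 u n) in *.
    destruct (classic (ext0 V p' K' x)) as [E1|E1].
    + exists (o0 x), (o1 x).
      assert (V0 : visited V Sp p K U0 x) by (split; [apply OSp|left; assumption]).
      assert (V1 : visited V Sp p' K' U1 x) by apply OV.
      (* The component of [x] is the last one in both directions, so the whole spine is one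
         component. The arms move apart from [x] in opposite directions. *)
      assert (none : forall a b, Sp a -> Sp b -> ~ sep V p K a b).
      { intros a b Ha Hb (k & Kk & B).
        pose proof (p_range L a Ha). pose proof (p_range L b Hb).
        pose proof (p_neq_K L x k (OSp n) Kk).
        destruct (Rlt_dec k (p x)).
        - apply (En k Kk). unfold betw in B. lra.
        - apply (E1 (1 - k)); [|unfold p', betw in *; lra].
          unfold K'. replace (1 - (1 - k)) with k by ring. assumption. }
      pose proof (A0 x V0) as B0. pose proof (A1 x V1) as B1. fold o0 in B0. fold o1 in B1.
      split; [reflexivity|]. split; [assumption|]. split; [assumption|]. split.
      * intros i j _. split; intros k _; apply none; first [apply (arm_Sp B0)|apply (arm_Sp B1)].
      * intros i j Hi Hj E.
        destruct (orbit_ext_down L U0 S0 x V0 0 i En) as [_ D0]; [lia|].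
        destruct (orbit_ext_down L' U1 S1 x V1 0 j E1) as [_ D1]; [lia|].
        fold o0 in D0. fold o1 in D1. change (o0 x 0) with x in D0. change (o1 x 0) with x in D1.
        rewrite <- E in D1. unfold p' in D1.
        assert (Ex : o0 x i = x).
        { apply (line_inj L); [apply (arm_Sp B0)|apply OSp|lra]. }
        split.
        -- apply (live_start p K (o0 x)); auto.
        -- apply (live_start p' K' (o1 x)); auto. change (o1 x 0) with x. congruence.
    (* Restarting at the last visit makes the arm towards 1 jump in its first step, so the arm
       towards 0 has the component to itself apart from [y]. *)
    + set (m := lastv V p' K' U1 x). set (y := U1 m).
      pose proof (lastv_spec V Sp p' K' U1 lim1 x (OV n) E1) as [My Ml]. fold m in My, Ml.
      fold y in My.
      assert (Sy : ~ sep V p K y x) by (rewrite <- flip; assumption).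
      assert (Sxy : ~ sep V p' K' x y) by (intro Q; apply My, sep_sym, Q).
      assert (Ey : ext0 V p K y).
      { apply (ext0_same L x y (OSp n) (S1 m)); auto.
        intro Q. apply Sy, sep_sym, Q. }
      assert (V0 : visited V Sp p K U0 y) by (split; [apply S1|left; assumption]).
      assert (V1 : visited V Sp p' K' U1 y) 
        by exact (visited_same L' U1 x y (S1 m) (OV n) Sxy).
      assert (J : jump V p' K' U1 y).
      { split.
        - intro Q. apply E1. apply (ext0_same L' y x (S1 m) (OSp n)); auto.
        - rewrite <- (lastv_same L' U1 lim1 x y (S1 m) (OV n) E1 Sxy). reflexivity. }
      pose proof (A0 y V0) as B0. pose proof (A1 y V1) as B1. fold o0 in B0. fold o1 in B1.
      assert (near : forall i, ~ sep V p K y (o0 y i)).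
      { intro i. induction i as [|i IH]; [apply sep_refl|].
        apply (same_trans L _ (o0 y i)); auto; [apply (arm_Sp B0)|].
        apply (orbit_step_same L U0 S0 y V0). intros [Q _]. apply Q.
        apply (orbit_ext_down L U0 S0 y V0 0 i Ey). lia. }
      assert (far : forall i j, ~ sep V p K (o0 y i) (o1 y j) -> j = 0%nat).
      { intros i j Q. destruct j as [|j]; [reflexivity|exfalso].
        pose proof (orbit_no_return L' U1 S1 lim1 y V1 0 J (S j) ltac:(lia)) as Z.
        fold o1 in Z. change (o1 y 0) with y in Z. rewrite flip in Z.
        destruct (sep_mid L y (o0 y i) _ (arm_Sp B0 i) Z); [|contradiction].
        apply (near i); assumption. }
      exists (o0 y), (o1 y).
      split; [reflexivity|]. split; [assumption|]. split; [assumption|]. split.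
      * intros i j Q. apply far in Q. subst j. split; [|intros k Hk; lia].
        intros k _ Z. destruct (sep_mid L _ y _ (S1 m) Z) as [Z'|Z'].
        -- apply (near k), sep_sym, Z'.
        -- apply (near (S k)), Z'.
      * intros i j Hi Hj E. assert (j = 0%nat) as ->.
        { apply (far i). rewrite <- E. apply sep_refl. }
        split; [|reflexivity]. apply (live_start p K (o0 y)); auto.
  - set (O := orbit V p' K' EB U1 u) in *.
    assert (NE' : forall n, ~ ext0 V p K (O n)) by (intros n Q; eauto).
    (* The terms of [O] are uniformly cut off from time 0: all late ones by [k0], because they
       approach time 1, and the finitely many others by ends of their own. *)
    assert (bd : exists e, 0 < e /\ forall n, exists k, K k /\ e <= k /\ k < p (O n)).
    { assert (wit : forall n, exists k, K k /\ 0 < k < p (O n)).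
      { intro n. specialize (NE' n). apply not_all_ex_not in NE' as [k Hk].
        apply imply_to_and in Hk as [Kk Hk]. apply NNPP in Hk. eauto. }
      destruct (wit 0%nat) as (k0 & Kk0 & Hk0).
      pose proof (p_range L _ (OSp 0%nat)) as R0.
      destruct (orbit_lim L' U1 S1 lim1 u Vu (1 - k0) ltac:(lra)) as [N HN].
      fold O in HN.
      assert (fin : forall M, exists e, 0 < e /\ forall n, (n < M)%nat -> exists k, K k /\ e <= k /\ k < p (O n)).
      { induction M as [|M (e & He & IH)].
        - exists 1. split; [lra|]. intros n Hn. lia.
        - destruct (wit M) as (k & Kk & Hk). exists (Rmin e k). split; [apply Rmin_pos; lra|].
          intros n Hn. pose proof (Rmin_l e k). pose proof (Rmin_r e k).
          destruct (Nat.eq_dec n M) as [->|].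
          + exists k. repeat split; auto; lra.
          + destruct (IH n ltac:(lia)) as (k' & A & B & C). exists k'. repeat split; auto; lra. }
      destruct (fin N) as (e & He & HM). exists (Rmin e k0). split; [apply Rmin_pos; lra|].
      intro n. pose proof (Rmin_l e k0). pose proof (Rmin_r e k0).
      destruct (Nat.lt_ge_cases n N) as [Q|Q].
      + destruct (HM n Q) as (k' & A & B & C). exists k'. repeat split; auto; lra.
      + exists k0. specialize (HN n Q). unfold p' in HN. repeat split; auto; lra. }
    destruct bd as (e & He & Hb). destruct (lim0 e He) as [M HM].
    (* Below the time [e] the walk towards 0 is separated from all of [O], so there is a last index
       at which it meets a component of [O]. *)
    destruct (last_time (fun m => exists n, ~ sep V p K (U0 m) (O n)) M) as (m & (n & Hn) & Hl).
    { exists 0%nat, 0%nat. replace (U0 0%nat) with (O 0%nat); [apply sep_refl|].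
      unfold O, U0. simpl. unfold u. rewrite W00. reflexivity. }
    { intros q Hq (n & Q). apply Q. destruct (Hb n) as (k & Kk & K1 & K2).
      exists k. split; [assumption|]. specialize (HM q Hq). unfold betw, U0. lra. }
    set (y := U0 m).
    assert (Sy : ~ sep V p' K' (O n) y).
    { rewrite flip. intro Q. apply Hn, sep_sym, Q. }
    assert (Ny : ~ ext0 V p K y).
    { intro Q. apply (NE' n). apply (ext0_same L y (O n) (S0 m) (OSp n)); assumption. }
    assert (V0 : visited V Sp p K U0 y) by (split; [apply S0|right; exists m; apply sep_refl]).
    assert (V1 : visited V Sp p' K' U1 y).
    { apply (visited_same L' U1 (O n) y); [apply S0|apply OV|assumption]. }
    assert (Lm : lastv V p K U0 y = m).
    { apply Nat.le_antisymm.
      - apply Nat.le_ngt. intro Q. apply (Hl _ Q). exists n.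
        apply (same_trans L _ y); [apply S0| |assumption].
        apply (lastv_spec V Sp p K U0 lim0 y V0 Ny).
      - apply (lastv_ge V Sp p K U0 lim0 y m V0 Ny), sep_refl. }
    assert (J : jump V p K U0 y) by (split; [assumption|rewrite Lm; reflexivity]).
    pose proof (A0 y V0) as B0. pose proof (A1 y V1) as B1. fold o0 in B0. fold o1 in B1.
    (* The jump out of a component depends only on the component, so the arm restarted at [y] visits
       only components of [O]. *)
    assert (inO : forall j, exists n', ~ sep V p' K' (o1 y j) (O n')).
    { intro j. induction j as [|j (n' & IH)].
      - exists n. intro Q. apply Sy, sep_sym, Q.
      - destruct (classic (jump V p' K' U1 (o1 y j))) as [Jj|Jj].
        + assert (VO : visited V Sp p' K' U1 (o1 y j)).
          { apply (orbit_visited L' U1 S1 y V1). }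
          assert (NO : ~ ext0 V p' K' (O n')).
          { intro Q. apply (proj1 Jj). apply (ext0_same L' (O n') (o1 y j)); auto.
            - apply (arm_Sp B1).
            - intro Z. apply IH, sep_sym, Z. }
          destruct (orbit_leaves_first p' K' L' U1 S1 lim1 u Vu n' NO) as (q & Hq & Jq & Sq).
          fold O in Jq, Sq. exists (S q).
          assert (Eq : o1 y (S j) = O (S q)); [|rewrite Eq; apply sep_refl].
          change (o1 y (S j)) with (advance V p' K' EB U1 (o1 y j)).
          change (O (S q)) with (advance V p' K' EB U1 (O q)).
          rewrite (advance_jump V p' K' EB U1 _ Jj), (advance_jump V p' K' EB U1 _ Jq).
          rewrite (lastv_same L' U1 lim1 (o1 y j) (O q)); auto; [apply Jj|].
          apply (same_trans L' _ (O n')); auto.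
        + exists n'. pose proof (orbit_step_same L' U1 S1 y V1 j Jj) as Q.
          fold o1 in Q. apply (same_trans L' _ (o1 y j)); auto.
          * apply (arm_Sp B1).
          * intro Z. apply Q, sep_sym, Z. }
    assert (far : forall i j, ~ sep V p K (o0 y i) (o1 y j) -> i = 0%nat).
    { intros i j Q. destruct i as [|i]; [reflexivity|exfalso].
      destruct (orbit_after_jump L U0 S0 lim0 y V0 0 J (S i) ltac:(lia)) as (q & Hq & Sq).
      fold o0 in Hq, Sq. change (o0 y 0) with y in Hq. rewrite Lm in Hq.
      destruct (inO j) as (n' & Sn). apply (Hl q Hq). exists n'.
      apply (same_trans L _ (o0 y (S i))); auto; [apply (arm_Sp B0)|].
      apply (same_trans L _ (o1 y j)); auto; [apply (arm_Sp B1)|].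
      rewrite <- flip. assumption. }
    exists (o0 y), (o1 y).
    split; [reflexivity|]. split; [assumption|]. split; [assumption|]. split.
    + intros i j Q. pose proof (far _ _ Q) as ->. split; [intros k Hk; lia|].
      intros k Hk. rewrite <- flip. change (o0 y 0) with y in Q.
      apply (arm_contig B1 0%nat j); try lia. change (o1 y 0) with y. rewrite flip. assumption.
    + intros i j Hi Hj E. assert (i = 0%nat) as ->.
      { apply (far i j). rewrite <- E. apply sep_refl. }
      split; [reflexivity|]. apply (live_start p' K' (o1 y)); auto.
Qed.

End TwoWalks.
End Arms.
Arguments arm_Sp {V adj Sp EB sp p K o}.
Arguments arm_step {V adj Sp EB sp p K o}.
Arguments arm_contig {V adj Sp EB sp p K o}.
Arguments arm_inj {V adj Sp EB sp p K o}.
Arguments arm_lim {V adj Sp EB sp p K o}.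

(* The spine vertices visited by the second track, in the order from time [1] to time [0]. *)
Record track {V : Type} (adj : V -> V -> Prop) (Sp : V -> Prop) (p : V -> R) (K : R -> Prop)
    (EB : V -> V -> Prop) (sp : V -> V) (s : Z -> V) (J : Z -> Prop) : Prop := {
  track_0 : J 0%Z;
  track_convex : forall m k n, J m -> J n -> (m <= k <= n)%Z -> J k;
  track_Sp : forall n, J n -> Sp (s n);
  track_inj : forall m n, J m -> J n -> s m = s n -> m = n;
  track_step : forall n, J n -> J (n + 1)%Z -> EB (s n) (s (n + 1)%Z) \/
    (link V adj sp (s n) (s (n + 1)%Z) /\ sep V p K (s n) (s (n + 1)%Z));
  track_contig : forall m n, J m -> J n -> (m < n)%Z -> ~ sep V p K (s m) (s n) ->
    forall k, (m <= k < n)%Z -> ~ sep V p K (s k) (s (k + 1)%Z);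
  track_top : forall n, J n -> ~ J (n + 1)%Z -> p (s n) = 0;
  track_bot : forall n, J n -> ~ J (n - 1)%Z -> p (s n) = 1;
  track_lim0 : (forall n, (0 <= n)%Z -> J n) ->
    forall e, 0 < e -> exists N, forall n, (N <= n)%Z -> p (s n) < e;
  track_lim1 : (forall n, (n <= 0)%Z -> J n) ->
    forall e, 0 < e -> exists N, forall n, (n <= N)%Z -> 1 - e < p (s n)
}.
Arguments track_0 {V adj Sp p K EB sp s J}.
Arguments track_convex {V adj Sp p K EB sp s J}.
Arguments track_Sp {V adj Sp p K EB sp s J}.
Arguments track_inj {V adj Sp p K EB sp s J}.
Arguments track_step {V adj Sp p K EB sp s J}.
Arguments track_contig {V adj Sp p K EB sp s J}.
Arguments track_top {V adj Sp p K EB sp s J}.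
Arguments track_bot {V adj Sp p K EB sp s J}.
Arguments track_lim0 {V adj Sp p K EB sp s J}.
Arguments track_lim1 {V adj Sp p K EB sp s J}.

(** * Joining the two arms into one sequence *)

Section Track.
Variables (V : Type) (adj : V -> V -> Prop) (Sp : V -> Prop) (EB : V -> V -> Prop) (sp : V -> V).
Variables (p : V -> R) (K : R -> Prop).
Hypothesis Hsym : symmetric_rel adj.
Hypothesis L : line Sp p K EB.
Variables (a b : nat -> V).
Hypothesis Hab : arms_ok V adj Sp EB sp p K a b.

(** Indices from 0 upwards follow the arm to time 0, negative ones the arm to time 1. [J] ends each
    arm at its first arrival, beyond which it may repeat itself. *)
Let s (n : Z) : V := if Z_le_dec 0 n then a (Z.to_nat n) else b (Z.to_nat (- n)).
Let J (n : Z) : Prop :=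
  (forall m, (Z.of_nat m < n)%Z -> p (a m) <> 0) /\ (forall m, (Z.of_nat m < - n)%Z -> 1 - p (b m) <> 0).

Let sa n : s (Z.of_nat n) = a n.
Proof. unfold s. destruct Z_le_dec; [|lia]. rewrite Nat2Z.id. reflexivity. Qed.

Let sb n : s (- Z.of_nat n) = b n.
Proof.
  unfold s. destruct Z_le_dec as [Q|Q].
  - assert (n = 0%nat) as -> by lia. apply Hab.
  - replace (- - Z.of_nat n)%Z with (Z.of_nat n) by lia. rewrite Nat2Z.id. reflexivity.
Qed.

Lemma Z_sign (n : Z) : (exists i, n = Z.of_nat i) \/ (exists i, n = (- Z.of_nat (S i))%Z).
Proof.
  destruct (Z_le_dec 0 n).
  - left. exists (Z.to_nat n). lia.
  - right. exists (Z.to_nat (- n) - 1)%nat. lia.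
Qed.

Let sbS i : s (- Z.of_nat (S i) + 1) = b i.
Proof. replace (- Z.of_nat (S i) + 1)%Z with (- Z.of_nat i)%Z by lia. apply sb. Qed.

Let saS i : s (Z.of_nat i + 1) = a (S i).
Proof. replace (Z.of_nat i + 1)%Z with (Z.of_nat (S i)) by lia. apply sa. Qed.

Lemma arms_track : exists s J, track adj Sp p K EB sp s J.
Proof.
  destruct Hab as (E0 & A & B & Hx & Hi).
  assert (fl : forall x y, ~ sep V (fun v => 1 - p v) (fun t => K (1 - t)) x y -> ~ sep V p K x y).
  { intros x y Q Z. apply Q, sep_flip, Z. }
  assert (fl' : forall x y, ~ sep V p K x y -> ~ sep V (fun v => 1 - p v) (fun t => K (1 - t)) x y).
  { intros x y Q Z. apply Q, sep_flip, Z. }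
  exists s, J. constructor.
  - split; intros m Hm; lia.
  - intros m k n [H1 H2] [H3 H4] Hk. split; intros q Hq; [apply H3|apply H2]; lia.
  - intros n _. destruct (Z_sign n) as [[i ->]|[i ->]].
    + rewrite sa. apply (arm_Sp A).
    + rewrite sb. apply (arm_Sp B).
  - assert (aa : forall i j, (i < j)%nat -> J (Z.of_nat j) -> a i <> a j).
    { intros i j Hij [Hj _] E. apply (Hj i); [lia|].
      apply (arm_inj A i j); assumption. }
    assert (bb : forall i j, (i < j)%nat -> J (- Z.of_nat j)%Z -> b i <> b j).
    { intros i j Hij [_ Hj] E. apply (Hj i); [lia|].
      apply (arm_inj B i j); assumption. }
    assert (ab : forall i j, J (Z.of_nat i) -> J (- Z.of_nat j)%Z -> a i = b j -> i = 0%nat /\ j = 0%nat).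
    { intros i j [H1 _] [_ H2] E. apply Hi; [| |assumption]; intros m Hm; [apply H1|apply H2]; lia. }
    intros m n Jm Jn E.
    destruct (Z_sign m) as [[i ->]|[i ->]]; destruct (Z_sign n) as [[j ->]|[j ->]];
      rewrite ?sa, ?sb in E.
    + destruct (Nat.lt_trichotomy i j) as [Q|[Q|Q]]; [|subst; reflexivity|]; exfalso.
      * apply (aa i j); assumption.
      * apply (aa j i); auto.
    + exfalso. destruct (ab i (S j)); auto. discriminate.
    + exfalso. destruct (ab j (S i)); auto. discriminate.
    + destruct (Nat.lt_trichotomy i j) as [Q|[Q|Q]]; [|subst; reflexivity|]; exfalso.
      * apply (bb (S i) (S j)); auto. lia.
      * apply (bb (S j) (S i)); auto. lia.
  - intros n Jn Jn1. destruct (Z_sign n) as [[i ->]|[i ->]].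
    + rewrite sa, saS. apply (arm_step A). apply Jn1. lia.
    + rewrite sb, sbS. destruct (arm_step B i) as [Q|[Q1 Q2]].
      * apply (proj2 Jn). lia.
      * left. apply (line_sym L), Q.
      * right. split; [apply link_sym; assumption|]. apply sep_sym, sep_flip, Q2.
  - intros m n Jm Jn Hmn S k Hk.
    assert (bk : forall i, ~ sep V p K (b i) (b (Datatypes.S i)) ->
               ~ sep V p K (s (- Z.of_nat (Datatypes.S i))) (s (- Z.of_nat (Datatypes.S i) + 1))).
    { intros i Q. rewrite sb, sbS. intro Z. apply Q, sep_sym, Z. }
    destruct (Z_sign m) as [[i ->]|[i ->]]; destruct (Z_sign n) as [[j ->]|[j ->]]; try lia.
    + rewrite !sa in S. destruct (Z_sign k) as [[q ->]|[q ->]]; [|lia]. rewrite sa, saS.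
      apply (arm_contig A i j); auto; lia.
    + rewrite sa, sb in S. destruct (Hx j (Datatypes.S i)) as [X Y].
      { intro Z. apply S, sep_sym, Z. }
      destruct (Z_sign k) as [[q ->]|[q ->]].
      * rewrite sa, saS. apply X. lia.
      * apply bk, Y. lia.
    + rewrite !sb in S. destruct (Z_sign k) as [[q ->]|[q ->]]; [lia|]. apply bk, fl.
      apply (arm_contig B (Datatypes.S j) (Datatypes.S i)); try lia.
      apply fl'. intro Z. apply S, sep_sym, Z.
  - intros n Jn Nn. destruct (Z_sign n) as [[i ->]|[i ->]].
    + rewrite sa. apply NNPP; intro Q. apply Nn. split; [|intros m Hm; lia].
      intros m Hm. destruct (Nat.eq_dec m i) as [->|]; [assumption|]. apply (proj1 Jn). lia.
    + exfalso. apply Nn. split; [intros m Hm; lia|]. intros m Hm. apply (proj2 Jn). lia.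
  - intros n Jn Nn. destruct (Z_le_dec n 0) as [Q|Q].
    + destruct (Z.opp_nonneg_nonpos n) as [_ Q']. specialize (Q' Q).
      remember (Z.to_nat (- n)) as i eqn:Hi'. assert (n = (- Z.of_nat i)%Z) by lia. subst n.
      rewrite sb. apply NNPP; intro Z. apply Nn. split; [intros m Hm; lia|].
      intros m Hm. destruct (Nat.eq_dec m i) as [->|]; [lra|]. apply (proj2 Jn). lia.
    + exfalso. apply Nn. split; [|intros m Hm; lia]. intros m Hm. apply (proj1 Jn). lia.
  - intros _ e He. destruct (arm_lim A e He) as [N HN]. exists (Z.of_nat N).
    intros n Hn. destruct (Z_sign n) as [[i ->]|[i ->]]; [|lia]. rewrite sa. apply HN. lia.
  - intros _ e He. destruct (arm_lim B e He) as [N HN]. exists (- Z.of_nat (S N))%Z.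
    intros n Hn. destruct (Z_sign n) as [[i ->]|[i ->]]; [lia|]. rewrite sb.
    specialize (HN (S i) ltac:(lia)). simpl in HN. lra.
Qed.

End Track.

(** * Walks of the graph towards the extremities *)

Lemma spine_flip V (adj : V -> V -> Prop) Sp p K EB sp w : spine adj Sp p K EB sp w ->
  spine adj Sp (fun v => 1 - p v) (fun t => K (1 - t)) EB sp (fun t => w (1 - t)).
Proof.
  intros [H1 H2 H3 H4 H5 H6 H7 H8 H9 H10].
  assert (ab : forall x k, Rabs (1 - x - k) = Rabs (x - (1 - k))).
  { intros x k. rewrite <- Rabs_Ropp. f_equal. ring. }
  constructor; auto.
  - apply line_flip, H1.
  - intros v Hv Hp. apply H6; [assumption|lra].
  - intros k k' Hk Hk' E. apply H8 in E; auto. lra.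
  - intros k S c Hk Hc. destruct (H9 (1 - k) S c Hk Hc) as (d & Hd & A & B).
    exists d. split; [assumption|]. split.
    + intros v Hv. rewrite ab. apply A, Hv.
    + intros k' Hk' Q. apply B; [assumption|]. replace (1 - k' - (1 - k)) with (- (k' - k)) by ring.
      rewrite Rabs_Ropp. assumption.
  - intros k d Hk Hd. destruct (H10 (1 - k) d Hk Hd) as (S & c & A & B). exists S, c.
    split; [assumption|]. intros v Hv Q. rewrite ab. apply B; assumption.
Qed.

Lemma walk_prefix V (adj : V -> V -> Prop) u (W : nat -> V) :
  clos_refl_trans V adj u (W 0%nat) ->
  (forall n, W n = W (S n) \/ adj (W n) (W (S n))) ->
  exists W' k, W' 0%nat = u /\ (forall n, W' n = W' (S n) \/ adj (W' n) (W' (S n))) /\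
    forall n, W' (k + n)%nat = W n.
Proof.
  intros Hp Hst. apply clos_rt_rt1n in Hp. remember (W 0%nat) as v eqn:Ev.
  induction Hp as [v|u x v Hux Hp IH].
  - exists W, 0%nat. auto.
  - destruct (IH Ev) as (W' & k & A & B & C).
    exists (fun n => match n with O => u | S n => W' n end), (S k).
    split; [reflexivity|]. split; [|assumption].
    intros [|n]; [|apply B]. right. rewrite A. assumption.
Qed.

Section Walk.
Variables (V : Type) (adj : V -> V -> Prop) (Sp : V -> Prop) (EB : V -> V -> Prop) (sp : V -> V).
Hypothesis Hsym : symmetric_rel adj.
Hypothesis Hlf : locally_finite adj.
Hypothesis Hconn : connected_graph adj.

Lemma neighbours_of_list (S : list V) : exists S', incl S S' /\
  forall x y, In x S -> adj x y -> In y S'.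
Proof.
  induction S as [|a S (S' & I & H)].
  - exists []. split; [apply incl_refl|]. intros x y [].
  - destruct (Hlf a) as [l Hl]. exists (a :: l ++ S'). split.
    + intros x [->|Hx]; [left; reflexivity|right]. apply in_or_app. right. apply I, Hx.
    + intros x y [<-|Hx] A; right; apply in_or_app; [left; apply Hl, A|right; apply (H x); assumption].
Qed.

(** If time 0 is a vertex, a constant walk has the right limit; this is why walks may pause. If it
    is an end, one of its rays is followed. Connectedness supplies the initial piece from [v0]. *)
Lemma walk_to_start p K w v0 : spine adj Sp p K EB sp w ->
  exists W : nat -> V, W 0%nat = v0 /\ (forall n, W n = W (S n) \/ adj (W n) (W (S n))) /\
    forall e, 0 < e -> exists N, forall n, (N <= n)%nat -> p (sp (W n)) < e.
Proof.
  intro H.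
  assert (Q : exists W : nat -> V, (forall n, W n = W (S n) \/ adj (W n) (W (S n))) /\
    forall e, 0 < e -> exists N, forall n, (N <= n)%nat -> p (sp (W n)) < e).
  { destruct (good_lo (line_good (spine_line H))) as [(a & Ha & Ea)|K0].
    - exists (fun _ => a). split; [auto|]. intros e He. exists 0%nat. intros _ _.
      rewrite (spine_id H a Ha). lra.
    - destruct (end_rep V adj (w 0) (spine_end H 0 K0)) as (r & Hr & Er & _).
      exists r. split; [intro n; right; apply Hr|]. intros e He.
      destruct (spine_open H 0 e K0 He) as (S & c & Hc & Hd).
      (* When the ray also avoids the neighbours of [S], the spine vertex of a leaf on the ray is
         outside [S] and hence in the same component. *)
      destruct (neighbours_of_list S) as (S' & I & HS').
      destruct (eventually_and _ _ (Hc r Er) (ray_leaves_list V adj r Hr S')) as [N HN].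
      exists N. intros n Hn. destruct (HN n Hn) as [C NS].
      assert (Rabs (p (sp (r n)) - 0) < e) as D; [|apply Rabs_def2 in D; lra].
      apply Hd; [apply (spine_Sp H)|].
      destruct (classic (Sp (r n))) as [Q|Q].
      + rewrite (spine_id H _ Q). assumption.
      + pose proof (spine_adj H _ Q) as A.
        apply (compS_adj adj S c (r n)); [assumption| |assumption|].
        * intro Z. apply NS, I, Z.
        * intro Z. apply NS. apply (HS' _ _ Z). apply Hsym, A. }
  destruct Q as (W & Hst & Hlim).
  destruct (walk_prefix V adj v0 W (Hconn _ _) Hst) as (W' & k & A & B & C).
  exists W'. split; [assumption|]. split; [assumption|]. intros e He.
  destruct (Hlim e He) as [N HN]. exists (k + N)%nat. intros n Hn.
  replace n with (k + (n - k))%nat by lia. rewrite C. apply HN. lia.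
Qed.

Theorem spine_track p K w (v0 : V) : spine adj Sp p K EB sp w ->
  exists s J, track adj Sp p K EB sp s J.
Proof.
  intro H. pose proof (spine_line H) as L.
  destruct (walk_to_start p K w v0 H) as (W0 & A0 & B0 & C0).
  destruct (walk_to_start _ _ _ v0 (spine_flip _ _ _ _ _ _ _ _ H)) as (W1 & A1 & B1 & C1).
  destruct (arms_exist V adj Sp EB sp p K L (spine_Sp H) W0 W1) as (a & b & Hab); auto.
  { congruence. }
  apply (arms_track V adj Sp EB sp p K Hsym L a b Hab).
Qed.

End Walk.

(** * Ends of the square of a graph *)

Section Square.
Variables (V : Type) (adj : V -> V -> Prop).
Hypothesis Hsym : symmetric_rel adj.
Hypothesis Hirr : irreflexive_rel adj.
Hypothesis Hlf : locally_finite adj.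
Notation sq := (square adj).

Lemma square_sym : symmetric_rel sq.
Proof. intros u v (N & [A|(x & A & B)]); split; auto. right. exists x. auto. Qed.

Lemma square_irr : irreflexive_rel sq.
Proof. intros v (N & _). apply N. reflexivity. Qed.

Lemma adj_square u v : adj u v -> sq u v.
Proof. intro A. split; [|auto]. intros ->. apply (Hirr v A). Qed.

Lemma square_locally_finite : locally_finite sq.
Proof.
  intro v. destruct (Hlf v) as [l Hl]. destruct (neighbours_of_list V adj Hlf l) as (l' & I & Hl').
  exists l'. intros x (_ & [A|(y & A & B)]).
  - apply I, Hl, A.
  - apply (Hl' y); auto.
Qed.

Lemma compS_square S S' c x : incl S S' -> compS adj S' c x -> compS sq S c x.
Proof.
  intros I [Hc Hx]. split; [intro Q; apply Hc, I, Q|].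
  clear Hc. induction Hx as [u v (A & B & C)| |u v y _ IH1 _ IH2].
  - apply rt_step. split; [apply adj_square, A|]. split; intro Q; [apply B|apply C]; apply I, Q.
  - apply rt_refl.
  - eapply rt_trans; eassumption.
Qed.

(** If the middle vertex of a new edge were in [S], both endpoints of that edge would be in [S'].
    Together with [compS_square] this shows that finite separators of the graph and of its square
    control each other, so both have the same ends. *)
Lemma square_compS S S' c x : incl S S' -> (forall a b, In a S -> adj a b -> In b S') ->
  compS sq S' c x -> compS adj S c x.
Proof.
  intros I HS' [Hc Hx]. split; [intro Q; apply Hc, I, Q|].
  clear Hc. induction Hx as [u v ((_ & A) & B & C)| |u v y _ IH1 _ IH2].
  - assert (Nu : ~ In u S) by (intro Q; apply B, I, Q).
    assert (Nv : ~ In v S) by (intro Q; apply C, I, Q).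
    destruct A as [A|(z & A1 & A2)]; [apply rt_step; split; auto|].
    assert (Nz : ~ In z S) by (intro Q; apply C, (HS' z); auto).
    eapply rt_trans; apply rt_step; split; eauto.
  - apply rt_refl.
  - eapply rt_trans; eassumption.
Qed.

Lemma rays_equiv_square r1 r2 : rays_equiv adj r1 r2 -> rays_equiv sq r1 r2.
Proof.
  intros E S. destruct (E S) as (c & A & B). exists c.
  split; [revert A|revert B]; apply eventually_imp; intros m; apply compS_square, incl_refl.
Qed.

Lemma square_rays_equiv r1 r2 : rays_equiv sq r1 r2 -> rays_equiv adj r1 r2.
Proof.
  intros E S. destruct (neighbours_of_list V adj Hlf S) as (S' & I & HS').
  destruct (E S') as (c & A & B). exists c.
  split; [revert A|revert B]; apply eventually_imp; intros m; apply square_compS; assumption.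
Qed.

Lemma ray_square r : ray adj r -> ray sq r.
Proof. intros [A B]. split; [assumption|]. intro n. apply adj_square, B. Qed.

(** The corresponding end of the square may contain further rays that use new edges, so the class
    [e] has to be enlarged to become an end there. *)
Definition sqend (e : (nat -> V) -> Prop) (r : nat -> V) : Prop :=
  ray sq r /\ exists r0, e r0 /\ rays_equiv sq r0 r.

Lemma sqend_end e : is_end adj e -> is_end sq (sqend e).
Proof.
  intro He. destruct (end_rep V adj e He) as (r0 & Hr0 & E0 & Hall).
  exists r0. split; [apply ray_square, Hr0|]. intro r. split.
  - intros (Hr & r1 & E1 & Q). split; [assumption|].
    apply (rays_equiv_trans V sq square_sym r0 r1); [|assumption].
    apply rays_equiv_square, Hall, E1.
  - intros (Hr & Q). split; [assumption|]. eauto.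
Qed.

Lemma sqend_in e r : is_end adj e -> e r -> sqend e r.
Proof.
  intros He Er. destruct (end_rep V adj e He) as (r0 & Hr0 & E0 & Hall).
  destruct (Hall r Er) as [Rr Q]. split; [apply ray_square, Rr|]. exists r0.
  split; [assumption|]. apply rays_equiv_square, Q.
Qed.

Lemma sqend_inj e e' : is_end adj e -> is_end adj e' -> sqend e = sqend e' -> e = e'.
Proof.
  intros He He' E. pose proof He as (r & Hr & Er). pose proof He' as (r' & Hr' & Er').
  destruct (end_rep V adj e He) as (r0 & Hr0 & E0 & Hall).
  pose proof (sqend_in e r0 He E0) as Q. rewrite E in Q. destruct Q as (_ & r1 & E1 & Q).
  apply square_rays_equiv in Q. apply Er in E0. apply Er' in E1.
  assert (R : rays_equiv adj r r').
  { apply (rays_equiv_trans V adj Hsym r r0); [apply E0|].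
    apply (rays_equiv_trans V adj Hsym r0 r1); [apply rays_equiv_sym, Q|apply rays_equiv_sym, E1]. }
  extensionality q. apply propositional_extensionality. rewrite Er, Er'.
  split; intros [A B]; split; auto.
  - apply (rays_equiv_trans V adj Hsym r' r); [apply rays_equiv_sym, R|assumption].
  - apply (rays_equiv_trans V adj Hsym r r'); assumption.
Qed.

(** The set [S'] contains the neighbours of [S], so a leaf whose spine vertex is outside [S'] avoids
    [S]. This extends convergence from spine vertices to all vertices of the fibres. *)
Lemma spine_square_cont Sp p K EB sp w : spine adj Sp p K EB sp w -> forall k S c, K k ->
  (forall r, sqend (w k) r -> Defs.eventually (fun m => compS sq S c (r m))) ->
  exists d, 0 < d /\ (forall x, Rabs (p (sp x) - k) < d -> compS sq S c x) /\
    (forall k', K k' -> Rabs (k' - k) < d -> region V sq S c (EndP (sqend (w k')))).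
Proof.
  intros H k S c Kk Hc. pose proof (spine_end H k Kk) as He.
  destruct (neighbours_of_list V adj Hlf S) as (S' & I & HS').
  destruct (end_compS V adj Hsym (w k) He S') as [c' Hc'].
  destruct (spine_cont H k S' c' Kk Hc') as (d & Hd & A & B).
  assert (tr : forall x, compS adj S' c' x -> compS sq S c x).
  { destruct (end_rep V adj (w k) He) as (r0 & Hr0 & E0 & _).
    destruct (eventually_ex _ (eventually_and _ _ (Hc' r0 E0) (Hc r0 (sqend_in _ _ He E0))))
      as (m & Q1 & Q2).
    intros x Hx. apply (compS_trans V sq S c (r0 m) x Q2).
    apply (compS_trans V sq S (r0 m) c').
    - apply (compS_sym V sq square_sym), (compS_square S S'); assumption.
    - apply (compS_square S S'); assumption. }
  exists d. split; [assumption|]. split.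
  - intros x Hx. pose proof (A (sp x) (spine_Sp H x) Hx) as Q.
    destruct (classic (Sp x)) as [Sx|Sx].
    + rewrite (spine_id H x Sx) in Q. apply tr, Q.
    + pose proof (spine_adj H x Sx) as Ax.
      apply (compS_adj sq S c (sp x)).
      * apply tr, Q.
      * intro Z. apply (compS_notin _ _ _ _ Q), I, Z.
      * apply adj_square, Hsym, Ax.
      * intro Z. apply (compS_notin _ _ _ _ Q). apply (HS' x); assumption.
  - intros k' Kk' Hk'. destruct (B k' Kk' Hk') as [E' R']. split; [apply sqend_end, E'|].
    intros r (Hr & r0 & E0 & Q). apply (rays_equiv_compS V sq square_sym r0); [assumption|].
    specialize (R' r0 E0). revert R'. apply eventually_imp. intro m. apply tr.
Qed.

End Square.

(** * Positions of the blocks *)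

(** An increasing copy of the integers in the open unit interval, accumulating only at 0 and 1; both
    formulas are halves of reciprocals, meeting around [phi 0 = 1 / 2]. *)
Definition phi (n : Z) : R :=
  if Z_le_dec 0 n then 1 - / (2 * (IZR n + 1)) else / (2 * (1 - IZR n)).

Lemma phi_range n : 0 < phi n < 1.
Proof.
  unfold phi. destruct Z_le_dec as [H|H].
  - apply IZR_le in H. assert (/ (2 * (IZR n + 1)) <= / 2) by (apply Rinv_le_contravar; lra).
    assert (0 < / (2 * (IZR n + 1))) by (apply Rinv_0_lt_compat; lra). lra.
  - assert (IZR n <= 0) by (apply IZR_le; lia).
    assert (/ (2 * (1 - IZR n)) <= / 2) by (apply Rinv_le_contravar; lra).
    assert (0 < / (2 * (1 - IZR n))) by (apply Rinv_0_lt_compat; lra). lra.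
Qed.

Lemma phi_succ n : phi n < phi (n + 1).
Proof.
  unfold phi. rewrite plus_IZR. destruct Z_le_dec as [H|H], Z_le_dec as [H'|H']; try lia.
  - apply IZR_le in H. enough (/ (2 * (IZR n + 1 + 1)) < / (2 * (IZR n + 1))) by lra.
    apply Rinv_lt_contravar; nra.
  - assert (n = (-1)%Z) as -> by lia. replace (/ (2 * (1 - -1))) with (1 / 4) by field.
    replace (/ (2 * (-1 + 1 + 1))) with (1 / 2) by field. lra.
  - assert (IZR n <= -2) by (apply IZR_le; lia).
    apply Rinv_lt_contravar; nra.
Qed.

Lemma phi_lt m n : (m < n)%Z -> phi m < phi n.
Proof.
  intro H. remember (Z.to_nat (n - m - 1)) as d eqn:Hd.
  replace n with (m + 1 + Z.of_nat d)%Z by lia. clear H Hd. induction d as [|d IH].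
  - rewrite Z.add_0_r. apply phi_succ.
  - eapply Rlt_trans; [exact IH|]. replace (m + 1 + Z.of_nat (S d))%Z with (m + 1 + Z.of_nat d + 1)%Z by lia.
    apply phi_succ.
Qed.

Lemma phi_lt_inv m n : phi m < phi n -> (m < n)%Z.
Proof.
  intro H. destruct (Z_lt_ge_dec m n) as [|Q]; [assumption|exfalso].
  destruct (Z.eq_dec m n) as [->|]; [lra|]. pose proof (phi_lt n m ltac:(lia)). lra.
Qed.

Lemma phi_inj m n : phi m = phi n -> m = n.
Proof.
  intro H. destruct (Z.lt_trichotomy m n) as [Q|[Q|Q]]; [|assumption|];
    apply phi_lt in Q; lra.
Qed.

Lemma phi_near_1 e : 0 < e -> exists n, (0 <= n)%Z /\ 1 - e < phi n.
Proof.
  intro He. exists (Z.max 0 (up (/ e))). split; [lia|].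
  destruct (archimed (/ e)) as [A _]. assert (0 < / e) by (apply Rinv_0_lt_compat; assumption).
  assert (IZR (up (/ e)) <= IZR (Z.max 0 (up (/ e)))) by (apply IZR_le; lia).
  unfold phi. destruct Z_le_dec; [|lia].
  enough (/ (2 * (IZR (Z.max 0 (up (/ e))) + 1)) < e) by lra.
  apply Rlt_le_trans with (/ / e); [|rewrite Rinv_inv; lra].
  apply Rinv_lt_contravar; [apply Rmult_lt_0_compat|]; lra.
Qed.

Lemma phi_near_0 e : 0 < e -> exists n, (n < 0)%Z /\ phi n < e.
Proof.
  intro He. exists (- Z.max 1 (up (/ e)))%Z. split; [lia|].
  destruct (archimed (/ e)) as [A _]. assert (0 < / e) by (apply Rinv_0_lt_compat; assumption).
  assert (IZR (up (/ e)) <= IZR (Z.max 1 (up (/ e)))) by (apply IZR_le; lia).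
  unfold phi. destruct Z_le_dec; [lia|]. rewrite opp_IZR.
  apply Rlt_le_trans with (/ / e); [|rewrite Rinv_inv; lra].
  apply Rinv_lt_contravar; [apply Rmult_lt_0_compat|]; lra.
Qed.

Lemma phi_iso t : 0 < t < 1 -> exists d, 0 < d /\ forall n, Rabs (phi n - t) < d -> phi n = t.
Proof.
  intro Ht. destruct (phi_near_1 ((1 - t) / 2) ltac:(lra)) as (b & _ & Hb).
  destruct (phi_near_0 (t / 2) ltac:(lra)) as (a & _ & Ha).
  destruct (list_isolated (map (fun i => phi (a + Z.of_nat i)) (seq 0 (Z.to_nat (b - a)))) t)
    as (d & Hd & Hl).
  exists (Rmin d (Rmin ((1 - t) / 2) (t / 2))). split; [repeat apply Rmin_pos; lra|].
  intros n Hn.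
  assert (Rabs (phi n - t) < d /\ Rabs (phi n - t) < (1 - t) / 2 /\ Rabs (phi n - t) < t / 2)
    as (H1 & H2 & H3).
  { revert Hn. generalize (Rabs (phi n - t)). intro z. unfold Rmin; repeat destruct Rle_dec; lra. }
  apply Hl; [|assumption]. apply Rabs_def2 in H2, H3.
  assert (a < n)%Z by (apply phi_lt_inv; lra). assert (n < b)%Z by (apply phi_lt_inv; lra).
  apply in_map_iff. exists (Z.to_nat (n - a)). split; [f_equal; lia|]. apply in_seq. lia.
Qed.

(** * Distributing the vertices over the two tracks *)

Definition eqdec {A : Type} (x y : A) : {x = y} + {x <> y} := excluded_middle_informative (x = y).

Section Distribute.
Variables (V : Type) (adj : V -> V -> Prop) (Sp : V -> Prop) (p : V -> R) (K : R -> Prop).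
Variables (EB : V -> V -> Prop) (sp : V -> V) (w : R -> (nat -> V) -> Prop).
Variables (s : Z -> V) (J : Z -> Prop).
Hypothesis Hsym : symmetric_rel adj.
Hypothesis Hirr : irreflexive_rel adj.
Hypothesis Hlf : locally_finite adj.
Hypothesis HS : spine adj Sp p K EB sp w.
Hypothesis HT : track adj Sp p K EB sp s J.

Let L : line Sp p K EB := spine_line HS.
Let spSp : forall v, Sp (sp v) := spine_Sp HS.
Let spid : forall v, Sp v -> sp v = v := spine_id HS.
Let sJ : forall n, J n -> Sp (s n) := track_Sp HT.
Notation sep := (sep V p K).

Lemma near_sp x : x = sp x \/ adj x (sp x).
Proof.
  destruct (classic (Sp x)) as [H|H]; [left; symmetry; auto|right].
  apply (spine_adj HS); assumption.
Qed.

Lemma near_sp' x : sp x = x \/ adj (sp x) x.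
Proof. destruct (near_sp x); [left; auto|right; apply Hsym; assumption]. Qed.

Lemma sq_two a b c : a <> c -> a = b \/ adj a b -> b = c \/ adj b c -> square adj a c.
Proof.
  intros N [->|A] [->|B]; split; auto; [contradiction|]. right. eauto.
Qed.

Lemma sq_same x y : x <> y -> sp x = sp y -> square adj x y.
Proof.
  intros N E. apply (sq_two x (sp x) y N (near_sp x)). rewrite E. apply near_sp'.
Qed.

(** Leaves of adjacent spine vertices may have distance 3. With one of the two on the spine the
    distance drops to 2, and every block is ordered to achieve this. *)
Lemma sq_near x y : adj (sp x) (sp y) -> x = sp x \/ y = sp y -> square adj x y.
Proof.
  intros A H. assert (N : x <> y) by (intros ->; apply (Hirr _ A)).
  destruct H as [E|E].
  - apply (sq_two x (sp y) y N); [right; rewrite E; assumption|apply near_sp'].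
  - apply (sq_two x (sp x) y N (near_sp x)). right. rewrite E. assumption.
Qed.

Definition leaves (v : V) : list V :=
  nodup eqdec (filter (fun x => if excluded_middle_informative (~ Sp x /\ sp x = v) then true else false)
    (epsilon (inhabits []) (fun l => forall x, adj v x -> In x l))).

Lemma leaves_NoDup v : NoDup (leaves v).
Proof. apply NoDup_nodup. Qed.

Lemma leaves_spec v x : In x (leaves v) <-> ~ Sp x /\ sp x = v.
Proof.
  unfold leaves. rewrite nodup_In, filter_In.
  destruct excluded_middle_informative as [H|H]; [|split; [intros [_ Q]; discriminate|tauto]].
  split; [tauto|]. intros _. split; [|reflexivity].
  apply (epsilon_spec (inhabits []) (fun l => forall x, adj v x -> In x l) (Hlf v)).
  destruct H as [H <-]. apply Hsym, (spine_adj HS), H.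
Qed.

Lemma leaves_not_self v : Sp v -> ~ In v (leaves v).
Proof. intros Hv H. apply leaves_spec in H. tauto. Qed.

Lemma not_leaf_self v x : sp x = v -> ~ In x (leaves v) -> x = v.
Proof.
  intros E N. destruct (classic (Sp x)) as [H|H]; [rewrite <- E; symmetry; auto|].
  exfalso. apply N, leaves_spec. auto.
Qed.

(** A discrete intermediate value property: no spine vertex lies between the endpoints of a spine
    edge, so a run of such edges cannot step over [v]. *)
Lemma track_cross d : forall i v, Sp v ->
  (forall k, (i <= k < i + Z.of_nat d)%Z -> EB (s k) (s (k + 1)%Z)) ->
  (forall k, (i <= k <= i + Z.of_nat d)%Z -> J k) ->
  (p (s i) <= p v <= p (s (i + Z.of_nat d)%Z) \/ p (s (i + Z.of_nat d)%Z) <= p v <= p (s i)) ->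
  exists k, (i <= k <= i + Z.of_nat d)%Z /\ s k = v.
Proof.
  induction d as [|d IH]; intros i v Hv Hst HJ Hp.
  - exists i. split; [lia|]. rewrite Z.add_0_r in Hp.
    apply (line_inj L); [apply sJ, HJ; lia|assumption|lra].
  - destruct (Req_dec (p (s i)) (p v)) as [E|N].
    { exists i. split; [lia|]. apply (line_inj L); auto. apply sJ, HJ; lia. }
    pose proof (EB_between L _ _ v (Hst i ltac:(lia)) Hv) as B. unfold betw in B.
    destruct (IH (i + 1)%Z v Hv) as (k & Hk & Ek).
    + intros k Hk. apply Hst. lia.
    + intros k Hk. apply HJ. lia.
    + replace (i + 1 + Z.of_nat d)%Z with (i + Z.of_nat (S d))%Z by lia. lra.
    + exists k. split; [lia|assumption].
Qed.

Lemma track_run m n : J m -> J n -> (m <= n)%Z -> ~ sep (s m) (s n) ->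
  forall k, (m <= k < n)%Z -> EB (s k) (s (k + 1)%Z).
Proof.
  intros Jm Jn Hmn S k Hk.
  assert (C : forall q, (m <= q <= n)%Z -> J q) by (intros q Hq; apply (track_convex HT m q n); auto).
  pose proof (track_contig HT m n Jm Jn ltac:(lia) S k Hk) as N.
  destruct (track_step HT k (C k ltac:(lia)) (C (k + 1)%Z ltac:(lia))) as [E|[_ E]];
    [assumption|contradiction].
Qed.

Lemma track_between m n v : J m -> J n -> Sp v -> ~ sep (s m) (s n) ->
  p (s m) <= p v <= p (s n) -> exists k, J k /\ s k = v.
Proof.
  intros Jm Jn Hv S Hp.
  assert (main : forall a b, J a -> J b -> (a <= b)%Z -> ~ sep (s a) (s b) ->
     p (s a) <= p v <= p (s b) \/ p (s b) <= p v <= p (s a) -> exists k, J k /\ s k = v).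
  { intros a b Ja Jb Hab Sab Hv'.
    assert (C : forall q, (a <= q <= b)%Z -> J q) by (intros q Hq; apply (track_convex HT a q b); auto).
    destruct (track_cross (Z.to_nat (b - a)) a v Hv) as (k & Hk & Ek).
    - intros k Hk. apply (track_run a b); auto. lia.
    - intros k Hk. apply C. lia.
    - replace (a + Z.of_nat (Z.to_nat (b - a)))%Z with b by lia. assumption.
    - exists k. split; [apply C; lia|assumption]. }
  destruct (Z_le_dec m n) as [Q|Q].
  - apply (main m n); auto.
  - apply (main n m); auto; [lia|]. intro Z. apply S, sep_sym, Z.
Qed.

Lemma EB_same_side v x y : EB v x -> EB v y ->
  (p v < p x /\ p v < p y) \/ (p x < p v /\ p y < p v) -> x = y.
Proof.
  intros Ex Ey Hs. pose proof (EB_Sp L _ _ Ex) as [_ Sx].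
  pose proof (EB_Sp L _ _ Ey) as [_ Sy].
  pose proof (EB_between L _ _ y Ex Sy) as Bx.
  pose proof (EB_between L _ _ x Ey Sx) as By. unfold betw in *.
  apply (line_inj L); auto. lra.
Qed.

Lemma EB_pne u v : EB u v -> p u <> p v.
Proof.
  intros E Q. pose proof (line_edge L _ _ E) as (A & B & N & _).
  apply N, (line_inj L); auto.
Qed.

(** Otherwise [s (m + 1)] and [s n] are the spine neighbours of [s m] on opposite sides, and the run
    from one to the other would pass [s m] again. *)
Lemma track_adjacent m n : J m -> J n -> (m < n)%Z -> EB (s m) (s n) -> n = (m + 1)%Z.
Proof.
  intros Jm Jn Hmn E. apply NNPP; intro N.
  pose proof (sep_EB L _ _ E) as S.
  assert (C : forall q, (m <= q <= n)%Z -> J q) by (intros q Hq; apply (track_convex HT m q n); auto).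
  pose proof (track_run m n Jm Jn ltac:(lia) S m ltac:(lia)) as E1.
  assert (N1 : s (m + 1)%Z <> s n).
  { intro Q. apply (track_inj HT) in Q; auto. apply C; lia. }
  pose proof (EB_pne _ _ E). pose proof (EB_pne _ _ E1).
  destruct (track_cross (Z.to_nat (n - (m + 1))) (m + 1) (s m)) as (k & Hk & Ek).
  - apply sJ, Jm.
  - intros k Hk. apply (track_run m n); auto; lia.
  - intros k Hk. apply C; lia.
  - replace (m + 1 + Z.of_nat (Z.to_nat (n - (m + 1))))%Z with n by lia.
    destruct (Rlt_dec (p (s m)) (p (s n))), (Rlt_dec (p (s m)) (p (s (m + 1)%Z))); try lra;
      exfalso; apply N1; apply (EB_same_side (s m)); auto; lra.
  - apply (track_inj HT) in Ek; auto; [lia|]. apply C; lia.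
Qed.

(** * Runs of the second track and their parity *)

Definition entry (n : Z) : Prop := J n /\ (~ J (n - 1)%Z \/ sep (s (n - 1)%Z) (s n)).

(* The blocks of a run alternate between giving the spine vertex and giving the leaves to
   the second track, and each run starts by giving the spine vertex. *)
Definition typeS (n : Z) : Prop :=
  (exists m, entry m /\ (m <= n)%Z /\ ~ sep (s m) (s n) /\ Z.even (n - m) = true) \/
  ((forall m, entry m -> (m <= n)%Z -> sep (s m) (s n)) /\ Z.even n = true).

Lemma typeS_entry n : entry n -> typeS n.
Proof.
  intro H. left. exists n. split; [assumption|]. split; [lia|]. split; [apply sep_refl|].
  rewrite Z.sub_diag. reflexivity.
Qed.

(** A second entry into the component would be a change of component inside a stretch that
    [track_contig] makes free of such changes. *)
Lemma entry_unique m m' n : J n -> entry m -> entry m' -> (m <= n)%Z -> (m' <= n)%Z ->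
  ~ sep (s m) (s n) -> ~ sep (s m') (s n) -> m = m'.
Proof.
  assert (main : forall a b, J n -> entry a -> entry b -> (b <= n)%Z -> (a < b)%Z ->
            ~ sep (s a) (s n) -> False).
  { intros a b Jn [Ja _] [Jb Hb] Hbn Hab S.
    pose proof (track_contig HT a n Ja Jn ltac:(lia) S (b - 1) ltac:(lia)) as Q.
    replace (b - 1 + 1)%Z with b in Q by lia.
    destruct Hb as [Hb|Hb]; [|contradiction]. apply Hb.
    apply (track_convex HT a (b - 1) b); auto. lia. }
  intros Jn H H' Hm Hm' S S'. destruct (Z.lt_trichotomy m m') as [Q|[Q|Q]]; [|assumption|]; exfalso.
  - apply (main m m'); auto.
  - apply (main m' m); auto.
Qed.

(** A run without an entry extends infinitely backwards and is counted by the parity of the index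
    itself. A step along a spine edge creates no entry and so stays in the same case. *)
Lemma typeS_succ n : J n -> J (n + 1)%Z -> EB (s n) (s (n + 1)%Z) -> (typeS (n + 1) <-> ~ typeS n).
Proof.
  intros Jn Jn1 E. pose proof (sep_EB L _ _ E) as S.
  assert (par : forall k, Z.even (k + 1) = negb (Z.even k)).
  { intro k. rewrite Z.even_add. destruct (Z.even k); reflexivity. }
  assert (ne : ~ entry (n + 1)%Z).
  { intros [_ Q]. replace (n + 1 - 1)%Z with n in Q by lia. tauto. }
  assert (tr : forall m, J m -> (sep (s m) (s n) <-> sep (s m) (s (n + 1)%Z))).
  { intros m Jm. split; intro Q.
    - destruct (sep_mid L _ _ _ (sJ _ Jn1) Q) as [|Z]; [assumption|].
      exfalso. apply S, sep_sym, Z.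
    - destruct (sep_mid L _ _ _ (sJ _ Jn) Q) as [|Z]; [assumption|contradiction]. }
  destruct (classic (exists m, entry m /\ (m <= n)%Z /\ ~ sep (s m) (s n))) as [(m & Hm & Hmn & Sm)|N].
  - assert (A : forall q, entry q -> (q <= n)%Z -> ~ sep (s q) (s n) -> q = m).
    { intros q Hq Hqn Sq. apply (entry_unique q m n); auto. }
    assert (T0 : typeS n <-> Z.even (n - m) = true).
    { split.
      - intros [(q & Hq & Hqn & Sq & Eq)|[Q _]].
        + rewrite <- (A q Hq Hqn Sq). assumption.
        + exfalso. apply Sm, Q; assumption.
      - intro Q. left. eauto. }
    assert (T1 : typeS (n + 1) <-> Z.even (n + 1 - m) = true).
    { split.
      - intros [(q & Hq & Hqn & Sq & Eq)|[Q _]].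
        + assert (q <> n + 1)%Z by (intros ->; contradiction).
          rewrite <- (A q Hq); [assumption|lia|]. rewrite (tr q (proj1 Hq)). assumption.
        + exfalso. apply Sm. apply (tr m (proj1 Hm)), Q; [assumption|lia].
      - intro Q. left. exists m. repeat split; auto; [apply Hm|apply Hm|lia|].
        rewrite <- (tr m (proj1 Hm)). assumption. }
    rewrite T0, T1. replace (n + 1 - m)%Z with (n - m + 1)%Z by lia. rewrite par.
    destruct (Z.even (n - m)); simpl; intuition congruence.
  - assert (T0 : typeS n <-> Z.even n = true).
    { split.
      - intros [(q & Hq & Hqn & Sq & Eq)|[_ Q]]; [exfalso; eauto|assumption].
      - intro Q. right. split; [|assumption]. intros m Hm Hmn. apply NNPP; intro. eauto. }
    assert (T1 : typeS (n + 1) <-> Z.even (n + 1) = true).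
    { split.
      - intros [(q & Hq & Hqn & Sq & Eq)|[_ Q]]; [exfalso|assumption].
        assert (q <> n + 1)%Z by (intros ->; contradiction).
        apply N. exists q. split; [assumption|]. split; [lia|]. rewrite (tr q (proj1 Hq)). assumption.
      - intro Q. right. split; [|assumption]. intros m Hm Hmn.
        assert (m <> n + 1)%Z by (intros ->; contradiction).
        apply (tr m (proj1 Hm)). apply NNPP; intro. apply N. exists m. repeat split; auto; [apply Hm|apply Hm|lia]. }
    rewrite T0, T1, par. destruct (Z.even n); simpl; intuition congruence.
Qed.

(** * The shares of the two tracks at a spine vertex *)

Definition jmp (n : Z) : Prop := J n /\ J (n + 1)%Z /\ sep (s n) (s (n + 1)%Z).

(** The edge of the graph behind the jump from [s n] to [s (n + 1)], with endpoints attached to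
    these two spine vertices. *)
Definition yx (n : Z) : V * V := epsilon (inhabits (s n, s n)) (fun q =>
  sp (fst q) = s n /\ sp (snd q) = s (n + 1)%Z /\ adj (fst q) (snd q)).
Definition yout (n : Z) : V := fst (yx n).
Definition xin (n : Z) : V := snd (yx (n - 1)).

Lemma yx_spec n : jmp n -> sp (yout n) = s n /\ sp (xin (n + 1)) = s (n + 1)%Z /\
  adj (yout n) (xin (n + 1)).
Proof.
  intros (Jn & Jn1 & S). unfold yout, xin. replace (n + 1 - 1)%Z with n by lia.
  unfold yx. apply epsilon_spec.
  destruct (track_step HT n Jn Jn1) as [E|[(y & x & A) _]].
  - exfalso. apply (sep_EB L _ _ E), S.
  - exists (y, x). assumption.
Qed.

(** A jump may land on a leaf. The second track then takes this leaf before the spine vertex, and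
    the first track loses it. *)
Definition pre (n : Z) : list V :=
  if excluded_middle_informative (jmp (n - 1)) then
    if eqdec (xin n) (s n) then [] else [xin n]
  else [].

(** If a jump starts from a leaf, that leaf is moved to the end of its block. If it starts from the
    spine vertex, any last leaf is adjacent to the start. *)
Definition rot (n : Z) : list V :=
  if excluded_middle_informative (jmp n /\ yout n <> s n) then
    remove eqdec (yout n) (leaves (s n)) ++ [yout n]
  else leaves (s n).

Definition blkP (n : Z) : list V :=
  if excluded_middle_informative (typeS n) then pre n ++ [s n] else rot n.

Definition idx (v : V) : Z := epsilon (inhabits 0%Z) (fun n => J n /\ s n = v).
Definition facing (v : V) : Prop := exists n, J n /\ p v < p (s n) /\ ~ sep v (s n).

(** The visited vertices of a component form an interval of the spine. An unvisited spine vertex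
    keeps its leaves on the side away from that interval, so a spine vertex is next to it; in an
    unvisited component one common order is used. *)
Definition blkA (v : V) : list V :=
  if excluded_middle_informative (exists n, J n /\ s n = v) then
    if excluded_middle_informative (typeS (idx v)) then
      filter (fun x => if in_dec eqdec x (pre (idx v)) then false else true) (leaves v)
    else [v]
  else if excluded_middle_informative (facing v) then leaves v ++ [v] else v :: leaves v.

Lemma idx_s n : J n -> idx (s n) = n.
Proof.
  intro Jn. unfold idx.
  destruct (epsilon_spec (inhabits 0%Z) (fun m => J m /\ s m = s n)) as [A B]; [eauto|].
  apply (track_inj HT); assumption.
Qed.

Lemma blkA_visited n : J n -> blkA (s n) =
  if excluded_middle_informative (typeS n) then
    filter (fun x => if in_dec eqdec x (pre n) then false else true) (leaves (s n))
  else [s n].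
Proof.
  intro Jn. unfold blkA. rewrite (idx_s n Jn).
  destruct (excluded_middle_informative (exists m, J m /\ s m = s n)) as [_|Q]; [reflexivity|].
  exfalso; eauto.
Qed.

Lemma in_pre n x : J n -> In x (pre n) -> jmp (n - 1) /\ x = xin n /\ In x (leaves (s n)).
Proof.
  intros Jn. unfold pre. destruct excluded_middle_informative as [H|H]; [|intros []].
  destruct eqdec as [E|E]; [intros []|]. intros [<-|[]]. split; [assumption|]. split; [reflexivity|].
  destruct (yx_spec _ H) as (_ & A & _). replace (n - 1 + 1)%Z with n in A by lia.
  apply NNPP; intro Q. apply E. apply not_leaf_self; assumption.
Qed.

Lemma pre_length n : pre n = [] \/ exists x, pre n = [x].
Proof.
  unfold pre. destruct excluded_middle_informative; [|auto]. destruct eqdec; eauto.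
Qed.

Lemma in_rot n x : J n -> In x (rot n) <-> In x (leaves (s n)).
Proof.
  intros Jn. unfold rot. destruct excluded_middle_informative as [[H N]|H]; [|reflexivity].
  destruct (yx_spec _ H) as (A & _).
  assert (Y : In (yout n) (leaves (s n))).
  { apply NNPP; intro Q. apply N, not_leaf_self; assumption. }
  rewrite in_app_iff. split.
  - intros [Q|[<-|[]]]; [|assumption]. apply in_remove in Q. tauto.
  - intro Q. destruct (eqdec x (yout n)) as [->|Nx]; [right; left; reflexivity|left].
    apply in_in_remove; assumption.
Qed.

Lemma NoDup_snoc (l : list V) x : NoDup l -> ~ In x l -> NoDup (l ++ [x]).
Proof.
  intros Hl Hx. apply NoDup_app; [assumption|apply NoDup_cons; [tauto|apply NoDup_nil]|].
  intros y Hy [<-|[]]. contradiction.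
Qed.

Lemma NoDup_remove_eq (l : list V) x : NoDup l -> NoDup (remove eqdec x l).
Proof.
  intro Hl. induction Hl as [|a l Ha Hl IH]; [apply NoDup_nil|]. simpl.
  destruct (eqdec x a); [assumption|]. apply NoDup_cons; [|assumption].
  intro Q. apply in_remove in Q. tauto.
Qed.

Lemma blkP_sp n x : J n -> In x (blkP n) -> sp x = s n.
Proof.
  intros Jn. unfold blkP. destruct excluded_middle_informative as [H|H].
  - rewrite in_app_iff. intros [Q|[<-|[]]]; [|apply spid, sJ, Jn].
    apply in_pre in Q; [|assumption]. destruct Q as (_ & _ & Q). apply leaves_spec in Q. tauto.
  - rewrite in_rot by assumption. intro Q. apply leaves_spec in Q. tauto.
Qed.

Lemma blkA_sp v x : Sp v -> In x (blkA v) -> sp x = v.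
Proof.
  intro Hv. unfold blkA. assert (lv : In x (leaves v) -> sp x = v) by (intro Q; apply leaves_spec in Q; tauto).
  destruct excluded_middle_informative.
  - destruct excluded_middle_informative.
    + rewrite filter_In. tauto.
    + intros [<-|[]]. auto.
  - destruct excluded_middle_informative.
    + rewrite in_app_iff. intros [Q|[<-|[]]]; auto.
    + intros [<-|Q]; auto.
Qed.

Lemma blkP_NoDup n : J n -> NoDup (blkP n).
Proof.
  intro Jn. unfold blkP. destruct excluded_middle_informative.
  - apply NoDup_snoc.
    + destruct (pre_length n) as [-> | [x ->]]; [apply NoDup_nil|].
      apply NoDup_cons; [tauto|apply NoDup_nil].
    + intro Q. apply in_pre in Q; [|assumption]. apply (leaves_not_self (s n) (sJ n Jn)). tauto.
  - unfold rot. destruct excluded_middle_informative; [|apply leaves_NoDup].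
    apply NoDup_snoc; [apply NoDup_remove_eq, leaves_NoDup|apply remove_In].
Qed.

Lemma blkA_NoDup v : Sp v -> NoDup (blkA v).
Proof.
  intro Hv. unfold blkA. destruct excluded_middle_informative.
  - destruct excluded_middle_informative.
    + apply NoDup_filter, leaves_NoDup.
    + apply NoDup_cons; [tauto|apply NoDup_nil].
  - destruct excluded_middle_informative.
    + apply NoDup_snoc; [apply leaves_NoDup|apply leaves_not_self, Hv].
    + apply NoDup_cons; [apply leaves_not_self, Hv|apply leaves_NoDup].
Qed.

Lemma blk_disjoint n x : J n -> In x (blkP n) -> In x (blkA (s n)) -> False.
Proof.
  intros Jn. rewrite blkA_visited by assumption. unfold blkP.
  destruct excluded_middle_informative as [H|H].
  - rewrite in_app_iff, filter_In. intros [Q|[<-|[]]] [A B].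
    + destruct in_dec; [discriminate|contradiction].
    + apply (leaves_not_self (s n) (sJ n Jn) A).
  - rewrite in_rot by assumption. intros Q [<-|[]]. apply (leaves_not_self (s n) (sJ n Jn) Q).
Qed.

Lemma blk_cover x : (exists n, J n /\ In x (blkP n)) \/ In x (blkA (sp x)).
Proof.
  assert (C : x = sp x \/ In x (leaves (sp x))).
  { destruct (classic (In x (leaves (sp x)))); [auto|left]. apply not_leaf_self; auto. }
  destruct (classic (exists n, J n /\ s n = sp x)) as [(n & Jn & En)|N].
  - rewrite <- En, blkA_visited by assumption. rewrite <- En in C.
    destruct excluded_middle_informative as [H|H].
    + destruct C as [C|C].
      * left. exists n. split; [assumption|]. unfold blkP.
        destruct excluded_middle_informative; [|contradiction]. rewrite in_app_iff.
        right. left. auto.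
      * destruct (in_dec eqdec x (pre n)) as [I|I].
        -- left. exists n. split; [assumption|]. unfold blkP.
           destruct excluded_middle_informative; [|contradiction]. rewrite in_app_iff. auto.
        -- right. rewrite filter_In. split; [assumption|]. destruct in_dec; [contradiction|reflexivity].
    + destruct C as [C|C]; [right; left; auto|left].
      exists n. split; [assumption|]. unfold blkP.
      destruct excluded_middle_informative; [contradiction|]. apply in_rot; assumption.
  - right. unfold blkA. destruct excluded_middle_informative; [contradiction|].
    destruct excluded_middle_informative.
    + rewrite in_app_iff. destruct C as [C|C]; [right; left; auto|auto].
    + destruct C as [C|C]; [left; auto|right; auto].
Qed.

Definition visS (v : V) : Prop := exists n, J n /\ s n = v /\ typeS n.
Definition endsR (v : V) : Prop := exists l, blkA v = l ++ [v].
Definition startsL (v : V) : Prop := exists l, blkA v = v :: l.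

Lemma typeS_adjacent m n : J m -> J n -> EB (s m) (s n) -> (typeS m <-> ~ typeS n).
Proof.
  intros Jm Jn E. destruct (Z.lt_trichotomy m n) as [Q|[Q|Q]].
  - pose proof (track_adjacent m n Jm Jn Q E). subst n.
    pose proof (typeS_succ m Jm Jn E). destruct (classic (typeS m)); tauto.
  - exfalso. subst n. apply (EB_pne _ _ E). reflexivity.
  - apply (line_sym L) in E. pose proof (track_adjacent n m Jn Jm Q E). subst m.
    apply typeS_succ; assumption.
Qed.

Lemma blkA_U n : J n -> ~ typeS n -> blkA (s n) = [s n].
Proof.
  intros Jn N. rewrite blkA_visited by assumption. destruct excluded_middle_informative; tauto.
Qed.

Lemma blkA_facing v : ~ (exists n, J n /\ s n = v) -> facing v -> blkA v = leaves v ++ [v].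
Proof.
  intros N F. unfold blkA. destruct excluded_middle_informative; [contradiction|].
  destruct excluded_middle_informative; [reflexivity|contradiction].
Qed.

Lemma blkA_not_facing v : ~ (exists n, J n /\ s n = v) -> ~ facing v -> blkA v = v :: leaves v.
Proof.
  intros N F. unfold blkA. destruct excluded_middle_informative; [contradiction|].
  destruct excluded_middle_informative; [contradiction|reflexivity].
Qed.

Lemma blkA_empty v : blkA v = [] -> visS v.
Proof.
  intro E. destruct (classic (exists n, J n /\ s n = v)) as [(n & Jn & <-)|N].
  - exists n. split; [assumption|]. split; [reflexivity|]. apply NNPP; intro Q.
    rewrite (blkA_U n Jn Q) in E. discriminate.
  - exfalso. destruct (classic (facing v)) as [F|F].
    + rewrite (blkA_facing v N F) in E. symmetry in E. apply app_cons_not_nil in E. assumption.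
    + rewrite (blkA_not_facing v N F) in E. discriminate.
Qed.

(** At every spine edge one of the facing block ends is the spine vertex, as [sq_near] demands. If
    one block is of the type that may be empty, the other one faces it with its spine vertex, so
    that it can be skipped. *)
Lemma blkA_face v x : EB v x -> p v < p x ->
  (endsR v \/ startsL x) /\ (visS x -> endsR v) /\ (visS v -> startsL x).
Proof.
  intros E Hp. destruct (EB_Sp L _ _ E) as [Hv Hx].
  pose proof (sep_EB L _ _ E) as NS.
  destruct (classic (exists n, J n /\ s n = v)) as [(m & Jm & Em)|Nv];
  destruct (classic (exists n, J n /\ s n = x)) as [(n & Jn & En)|Nx].
  - subst v x. pose proof (typeS_adjacent m n Jm Jn E) as T.
    destruct (classic (typeS m)) as [Q|Q].
    + assert (SL : startsL (s n)) by (exists []; apply blkA_U; tauto).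
      split; [auto|]. split; [|auto]. intros (q & Jq & Eq & Tq).
      apply (track_inj HT) in Eq; auto. subst q. tauto.
    + assert (ER : endsR (s m)) by (exists []; apply blkA_U; tauto).
      split; [auto|]. split; [auto|]. intros (q & Jq & Eq & Tq).
      apply (track_inj HT) in Eq; auto. subst q. tauto.
  - assert (SL : startsL x).
    { exists (leaves x). apply blkA_not_facing; [assumption|]. intros (q & Jq & Pq & Sq).
      apply Nx. apply (track_between m q); auto.
      - rewrite Em. apply (same_trans L v x); assumption.
      - rewrite Em. lra. }
    split; [auto|]. split; [|auto]. intros (q & Jq & Eq & _). exfalso. eauto.
  - assert (ER : endsR v).
    { exists (leaves v). apply blkA_facing; [assumption|]. exists n. rewrite En. auto. }
    split; [auto|]. split; [auto|]. intros (q & Jq & Eq & _). exfalso. eauto.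
  - split; [|split; intros (q & Jq & Eq & _); exfalso; eauto].
    destruct (classic (facing v)) as [F|F].
    + left. exists (leaves v). apply blkA_facing; assumption.
    + right. exists (leaves x). apply blkA_not_facing; [assumption|].
      intros (q & Jq & Pq & Sq). apply F. exists q. split; [assumption|]. split; [lra|].
      apply (same_trans L v x); assumption.
Qed.

Lemma endsR_last v l x : endsR v -> blkA v = l ++ [x] -> x = v.
Proof. intros [l' E] E'. rewrite E in E'. apply app_inj_tail in E'. symmetry. apply E'. Qed.

Lemma startsL_first v l x : startsL v -> blkA v = x :: l -> x = v.
Proof. intros [l' E] E'. rewrite E in E'. injection E' as -> _. reflexivity. Qed.

Lemma blkA_two v x : EB v x -> p v < p x -> blkA v = [] -> blkA x = [] -> False.
Proof.
  intros E Hp Ev Ex. destruct (blkA_face v x E Hp) as (_ & A & _).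
  destruct (A (blkA_empty x Ex)) as [l El]. rewrite Ev in El. destruct l; discriminate.
Qed.

Lemma blkA_next v x l a b l' : EB v x -> p v < p x -> blkA v = l ++ [a] -> blkA x = b :: l' ->
  square adj a b.
Proof.
  intros E Hp Ea Eb. destruct (EB_Sp L _ _ E) as [Hv Hx].
  assert (Sa : sp a = v) by (apply blkA_sp; auto; rewrite Ea; apply in_or_app; simpl; auto).
  assert (Sb : sp b = x) by (apply blkA_sp; auto; rewrite Eb; simpl; auto).
  apply sq_near.
  - rewrite Sa, Sb. apply (spine_EB HS), E.
  - rewrite Sa, Sb. destruct (proj1 (blkA_face v x E Hp)) as [Q|Q].
    + left. eapply endsR_last; eauto.
    + right. eapply startsL_first; eauto.
Qed.

Lemma blkA_skip v x y l a b l' : EB v x -> EB x y -> p v < p x -> p x < p y ->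
  blkA x = [] -> blkA v = l ++ [a] -> blkA y = b :: l' -> square adj a b.
Proof.
  intros E1 E2 H1 H2 Ex Ea Eb. pose proof (blkA_empty x Ex) as Sx.
  destruct (blkA_face v x E1 H1) as (_ & A & _). destruct (blkA_face x y E2 H2) as (_ & _ & B).
  rewrite (endsR_last v l a (A Sx) Ea), (startsL_first y l' b (B Sx) Eb).
  apply (sq_two v x y).
  - intros ->. lra.
  - right. apply (spine_EB HS), E1.
  - right. apply (spine_EB HS), E2.
Qed.

Lemma blkP_S n : typeS n -> blkP n = pre n ++ [s n].
Proof. intro H. unfold blkP. destruct excluded_middle_informative; tauto. Qed.

Lemma blkP_U n : ~ typeS n -> blkP n = rot n.
Proof. intro H. unfold blkP. destruct excluded_middle_informative; tauto. Qed.

Lemma pre_nil n : ~ jmp (n - 1) -> pre n = [].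
Proof. intro H. unfold pre. destruct excluded_middle_informative; tauto. Qed.

Lemma step_cases n : J n -> J (n + 1)%Z ->
  (EB (s n) (s (n + 1)%Z) /\ ~ jmp n) \/ (jmp n /\ entry (n + 1)%Z).
Proof.
  intros Jn Jn1. destruct (track_step HT n Jn Jn1) as [E|[_ S]].
  - left. split; [assumption|]. intros (_ & _ & Q). apply (sep_EB L _ _ E Q).
  - right. split; [split; auto|]. split; [assumption|]. right.
    replace (n + 1 - 1)%Z with n by lia. assumption.
Qed.

Lemma rot_nil n : J n -> rot n = [] -> leaves (s n) = [].
Proof.
  intros Jn E. destruct (leaves (s n)) as [|x l] eqn:El; [reflexivity|exfalso].
  assert (In x (rot n)) as Q by (apply in_rot; [assumption|rewrite El; left; reflexivity]).
  rewrite E in Q. destruct Q.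
Qed.

(** An empty block is not of the type [typeS]. After it comes either the opposite type along a spine
    edge or an entry, and entries are of the type [typeS]. *)
Lemma blkP_two n : J n -> J (n + 1)%Z -> blkP n = [] -> blkP (n + 1) = [] -> False.
Proof.
  intros Jn Jn1 E1 E2.
  assert (NS : forall m, blkP m = [] -> ~ typeS m).
  { intros m Em Q. rewrite (blkP_S m Q) in Em. symmetry in Em.
    apply app_cons_not_nil in Em. assumption. }
  destruct (step_cases n Jn Jn1) as [[E _]|[_ E]].
  - apply (NS _ E2). apply (typeS_succ n Jn Jn1 E). apply NS, E1.
  - apply (NS _ E2), typeS_entry, E.
Qed.

Lemma blkP_first n b l : J n -> J (n + 1)%Z -> blkP (n + 1) = b :: l ->
  (jmp n /\ b = xin (n + 1)) \/
  (EB (s n) (s (n + 1)%Z) /\ ~ jmp n /\ typeS (n + 1) /\ b = s (n + 1)%Z) \/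
  (EB (s n) (s (n + 1)%Z) /\ ~ jmp n /\ ~ typeS (n + 1)).
Proof.
  intros Jn Jn1 Eb. destruct (step_cases n Jn Jn1) as [[E NJ]|[Jm En]].
  - right. destruct (classic (typeS (n + 1))) as [Q|Q]; [left|right; auto].
    repeat split; auto. rewrite (blkP_S _ Q), pre_nil in Eb.
    + injection Eb as -> _. reflexivity.
    + replace (n + 1 - 1)%Z with n by lia. assumption.
  - left. split; [assumption|]. rewrite (blkP_S _ (typeS_entry _ En)) in Eb.
    unfold pre in Eb. destruct excluded_middle_informative as [Q|Q].
    + destruct eqdec as [E|E]; simpl in Eb; injection Eb as <- _; auto.
    + exfalso. apply Q. replace (n + 1 - 1)%Z with n by lia. assumption.
Qed.

Lemma snoc_inj (l l' : list V) a b : l ++ [a] = l' ++ [b] -> a = b.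
Proof. intro E. apply app_inj_tail in E. apply E. Qed.

(** Across a jump the last vertex of the block equals [yout n] or is adjacent to it, so the jump
    costs at most one more step. Along a spine edge the alternation puts a spine vertex on one
    side. *)
Lemma blkP_next n l a b l' : J n -> J (n + 1)%Z -> blkP n = l ++ [a] -> blkP (n + 1) = b :: l' ->
  square adj a b.
Proof.
  intros Jn Jn1 Ea Eb.
  assert (Sa : sp a = s n) by (apply blkP_sp; auto; rewrite Ea; apply in_or_app; simpl; auto).
  assert (Sb : sp b = s (n + 1)%Z) by (apply blkP_sp; auto; rewrite Eb; simpl; auto).
  assert (N : a <> b).
  { intro Q. subst b. rewrite Sa in Sb. apply (track_inj HT) in Sb; auto. lia. }
  assert (La : typeS n -> a = s n) by (intro Q; rewrite (blkP_S n Q) in Ea; apply snoc_inj in Ea; auto).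
  destruct (blkP_first n b l' Jn Jn1 Eb) as [[Jm ->]|[(E & NJ & T & ->)|(E & NJ & T)]].
  - destruct (yx_spec n Jm) as (A & B & C).
    assert (Q : a = yout n \/ adj a (yout n)); [|apply (sq_two a (yout n)); auto].
    destruct (classic (typeS n)) as [T|T].
    + rewrite (La T), <- A. apply near_sp'.
    + rewrite (blkP_U n T) in Ea. unfold rot in Ea.
      destruct excluded_middle_informative as [Q|Q].
      * left. apply snoc_inj in Ea. auto.
      * assert (yout n = s n) as -> by (apply NNPP; intro; tauto).
        rewrite <- Sa. apply near_sp.
  - apply sq_near; [rewrite Sa, Sb; apply (spine_EB HS), E|]. right. auto.
  - apply sq_near; [rewrite Sa, Sb; apply (spine_EB HS), E|]. left.
    rewrite Sa. apply La. apply NNPP; intro Q. apply T, (typeS_succ n Jn Jn1 E), Q.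
Qed.

(** The skipped spine vertex [s (n + 1)] has no leaves, so a jump from it starts at the vertex
    itself. It serves as the middle vertex between [a] and [b]. *)
Lemma blkP_skip n l a b l' : J n -> J (n + 1)%Z -> J (n + 1 + 1)%Z -> blkP (n + 1) = [] ->
  blkP n = l ++ [a] -> blkP (n + 1 + 1) = b :: l' -> square adj a b.
Proof.
  intros Jn Jn1 Jn2 E1 Ea Eb.
  assert (T1 : ~ typeS (n + 1)).
  { intro Q. rewrite (blkP_S _ Q) in E1. symmetry in E1. apply app_cons_not_nil in E1. assumption. }
  rewrite (blkP_U _ T1) in E1. apply rot_nil in E1; [|assumption].
  destruct (step_cases n Jn Jn1) as [[E _]|[_ En]]; [|exfalso; apply T1, typeS_entry, En].
  assert (T0 : typeS n) by (apply NNPP; intro Q; apply T1, (typeS_succ n Jn Jn1 E), Q).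
  assert (Sb : sp b = s (n + 1 + 1)%Z) by (apply blkP_sp; auto; rewrite Eb; simpl; auto).
  assert (a = s n) as ->.
  { rewrite (blkP_S n T0) in Ea. apply snoc_inj in Ea. auto. }
  assert (N : s n <> b).
  { intros <-. rewrite (spid _ (sJ n Jn)) in Sb.
    apply (track_inj HT) in Sb; auto. lia. }
  apply (sq_two (s n) (s (n + 1)%Z) b N); [right; apply (spine_EB HS), E|right].
  destruct (blkP_first (n + 1) b l' Jn1 Jn2 Eb) as [[Jm ->]|[(E' & _ & _ & ->)|(E' & _ & T)]].
  - destruct (yx_spec _ Jm) as (A & B & C).
    rewrite <- (not_leaf_self _ _ A); [assumption|]. rewrite E1. intros [].
  - apply (spine_EB HS), E'.
  - exfalso. apply T, (typeS_succ (n + 1) Jn1 Jn2 E'), T1.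
Qed.

(** This keeps blocks nonempty where the curve passes from one track to the other: on the second
    track at time 0 and on the first track at time 1. *)
Lemma leaves_end n : J n -> p (s n) = 0 \/ p (s n) = 1 -> leaves (s n) <> [].
Proof.
  intros Jn Hp E. destruct (spine_leaf HS (s n) (sJ n Jn) Hp) as (x & A & B).
  assert (In x (leaves (s n))) as Q by (apply leaves_spec; auto). rewrite E in Q. destruct Q.
Qed.

Lemma blkP_top_ne n : J n -> p (s n) = 0 -> blkP n <> [].
Proof.
  intros Jn Hp E. destruct (classic (typeS n)) as [Q|Q].
  - rewrite (blkP_S n Q) in E. symmetry in E. apply app_cons_not_nil in E. assumption.
  - rewrite (blkP_U n Q) in E. apply rot_nil in E; [|assumption].
    apply (leaves_end n Jn); auto.
Qed.

Lemma blk_turn n l a b l' : J n -> blkP n = l ++ [a] -> blkA (s n) = b :: l' -> square adj a b.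
Proof.
  intros Jn Ea Eb.
  assert (Ia : In a (blkP n)) by (rewrite Ea; apply in_or_app; simpl; auto).
  assert (Ib : In b (blkA (s n))) by (rewrite Eb; simpl; auto).
  apply sq_same.
  - intros ->. apply (blk_disjoint n b); assumption.
  - rewrite (blkP_sp n a Jn Ia), (blkA_sp (s n) b (sJ n Jn) Ib). reflexivity.
Qed.

Lemma blk_turn_skip n x l a b l' : J n -> EB (s n) x -> p (s n) < p x -> blkA (s n) = [] ->
  blkP n = l ++ [a] -> blkA x = b :: l' -> square adj a b.
Proof.
  intros Jn E Hp E0 Ea Eb. pose proof (blkA_empty _ E0) as VS.
  pose proof VS as (q & Jq & Eq & Tq). apply (track_inj HT) in Eq; auto. subst q.
  destruct (blkA_face _ _ E Hp) as (_ & _ & B). rewrite (startsL_first x l' b (B VS) Eb).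
  rewrite (blkP_S n Tq) in Ea. apply snoc_inj in Ea. subst a.
  pose proof (spine_EB HS _ _ E) as A. split; [|left; assumption].
  intro Q. rewrite Q in Hp. lra.
Qed.

(** The first index is an entry without a preceding jump, so the second track takes the spine vertex
    alone and leaves all its leaves to the first. This vertex is where the curve closes. *)
Lemma blk_bottom n : J n -> ~ J (n - 1)%Z -> blkP n = [s n] /\ blkA (s n) <> [] /\
  forall l a, blkA (s n) = l ++ [a] -> square adj a (s n).
Proof.
  intros Jn Jn1.
  assert (T : typeS n) by (apply typeS_entry; split; auto).
  assert (Pn : pre n = []) by (apply pre_nil; intros [Q _]; contradiction).
  assert (EP : blkP n = [s n]) by (rewrite (blkP_S n T), Pn; reflexivity).
  split; [assumption|].
  assert (EA : blkA (s n) = leaves (s n)).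
  { rewrite blkA_visited by assumption. destruct excluded_middle_informative; [|contradiction].
    rewrite Pn. induction (leaves (s n)) as [|x l IH]; [reflexivity|]. cbn [filter].
    destruct (in_dec eqdec x []) as [[]|]. rewrite IH. reflexivity. }
  split.
  - rewrite EA. apply (leaves_end n Jn). right. apply (track_bot HT); assumption.
  - intros l a E. assert (Ia : In a (blkA (s n))) by (rewrite E; apply in_or_app; simpl; auto).
    rewrite EA in Ia. apply leaves_spec in Ia as [A B]. apply sq_same.
    + intros ->. apply A, sJ, Jn.
    + rewrite B. symmetry. apply spid, sJ, Jn.
Qed.

(** * Existence of a first and a last index of the track *)

Lemma boundary_down n : J 0%Z -> (n <= 0)%Z -> ~ J n -> exists m, J m /\ ~ J (m - 1)%Z.
Proof.
  intros J0 Hn Nn. remember (Z.to_nat (- n)) as d eqn:Hd.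
  revert n Hn Nn Hd. induction d as [|d IH]; intros n Hn Nn Hd.
  - exfalso. apply Nn. replace n with 0%Z by lia. assumption.
  - destruct (classic (J (n + 1)%Z)) as [Q|Q].
    + exists (n + 1)%Z. split; [assumption|]. replace (n + 1 - 1)%Z with n by lia. assumption.
    + apply (IH (n + 1)%Z); auto; lia.
Qed.

Lemma boundary_up n : J 0%Z -> (0 <= n)%Z -> ~ J n -> exists m, J m /\ ~ J (m + 1)%Z.
Proof.
  intros J0 Hn Nn. remember (Z.to_nat n) as d eqn:Hd.
  revert n Hn Nn Hd. induction d as [|d IH]; intros n Hn Nn Hd.
  - exfalso. apply Nn. replace n with 0%Z by lia. assumption.
  - destruct (classic (J (n - 1)%Z)) as [Q|Q].
    + exists (n - 1)%Z. split; [assumption|]. replace (n - 1 + 1)%Z with n by lia. assumption.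
    + apply (IH (n - 1)%Z); auto; lia.
Qed.

Let J0 : J 0%Z := track_0 HT.

Lemma track_unbounded0 : K 0 -> forall n, (0 <= n)%Z -> J n.
Proof.
  intros K0 n Hn. apply NNPP; intro Q. destruct (boundary_up n J0 Hn Q) as (m & A & B).
  apply (p_neq_K L (s m) 0 (sJ m A) K0). apply (track_top HT m A B).
Qed.

Lemma track_unbounded1 : K 1 -> forall n, (n <= 0)%Z -> J n.
Proof.
  intros K1 n Hn. apply NNPP; intro Q. destruct (boundary_down n J0 Hn Q) as (m & A & B).
  apply (p_neq_K L (s m) 1 (sJ m A) K1). apply (track_bot HT m A B).
Qed.

(** Otherwise infinitely many distinct track vertices would converge to time 0, which is no
    accumulation point of spine vertices. *)
Lemma track_max : ~ K 0 -> exists m, J m /\ ~ J (m + 1)%Z.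
Proof.
  intro NK. destruct (classic (exists n, (0 <= n)%Z /\ ~ J n)) as [(n & Hn & Q)|Q].
  { apply (boundary_up n J0 Hn Q). }
  assert (A : forall n, (0 <= n)%Z -> J n) by (intros n Hn; apply NNPP; eauto).
  exfalso. destruct (good_iso (line_good L) 0 ltac:(lra) NK) as (d & Hd & Hs).
  destruct (track_lim0 HT A d Hd) as [N HN].
  assert (Z0 : forall n, (0 <= n)%Z -> (N <= n)%Z -> p (s n) = 0).
  { intros n Hn HNn. apply NNPP; intro Z.
    pose proof (p_range L _ (sJ n (A n Hn))). specialize (HN n HNn).
    apply (proj1 (Hs (p (s n)) ltac:(apply Rabs_def1; lra) Z)). exists (s n). auto. }
  set (n := Z.max 0 N). assert (n = n + 1)%Z; [|lia].
  apply (track_inj HT); [apply A; lia|apply A; lia|].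
  apply (line_inj L); [apply sJ, A; lia|apply sJ, A; lia|].
  rewrite !Z0 by lia. reflexivity.
Qed.

Lemma track_min : ~ K 1 -> exists m, J m /\ ~ J (m - 1)%Z.
Proof.
  intro NK. destruct (classic (exists n, (n <= 0)%Z /\ ~ J n)) as [(n & Hn & Q)|Q].
  { apply (boundary_down n J0 Hn Q). }
  assert (A : forall n, (n <= 0)%Z -> J n) by (intros n Hn; apply NNPP; eauto).
  exfalso. destruct (good_iso (line_good L) 1 ltac:(lra) NK) as (d & Hd & Hs).
  destruct (track_lim1 HT A d Hd) as [N HN].
  assert (Z1 : forall n, (n <= 0)%Z -> (n <= N)%Z -> p (s n) = 1).
  { intros n Hn HNn. apply NNPP; intro Z.
    pose proof (p_range L _ (sJ n (A n Hn))). specialize (HN n HNn).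
    apply (proj1 (Hs (p (s n)) ltac:(apply Rabs_def1; lra) Z)). exists (s n). auto. }
  set (n := Z.min 0 N). assert (n = n - 1)%Z; [|lia].
  apply (track_inj HT); [apply A; lia|apply A; lia|].
  apply (line_inj L); [apply sJ, A; lia|apply sJ, A; lia|].
  rewrite !Z1 by lia. reflexivity.
Qed.

(** Meaningful only if time 1 of the spine is a vertex; if it is an end, the track has no least
    index. *)
Definition nmin : Z := epsilon (inhabits 0%Z) (fun m => J m /\ ~ J (m - 1)%Z).

Lemma nmin_spec : ~ K 1 -> J nmin /\ ~ J (nmin - 1)%Z.
Proof. intro H. unfold nmin. apply epsilon_spec, track_min, H. Qed.

Lemma nmin_least n : ~ K 1 -> J n -> (nmin <= n)%Z.
Proof.
  intros NK Jn. destruct (nmin_spec NK) as [A B]. apply Znot_gt_le. intro Q. apply B.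
  apply (track_convex HT n (nmin - 1) nmin); auto. lia.
Qed.

Lemma nmin_p : ~ K 1 -> p (s nmin) = 1.
Proof.
  intro NK. destruct (nmin_spec NK) as [A B]. apply (track_bot HT); assumption.
Qed.

(* The closed curve runs through the second track on [(0, 1)], through the spine on [[1, 2]],
   and, if the spine ends in a vertex, returns to that vertex at time 3. *)
Definition PP (t : R) : Prop :=
  (exists n, J n /\ t = phi n) \/ (exists v, Sp v /\ t = 1 + p v) \/ (~ K 1 /\ t = 3).
Definition KK (t : R) : Prop := (K 1 /\ t = 0) \/ K (t - 1).
Definition start : R := if excluded_middle_informative (K 1) then 0 else phi nmin.
Definition finish : R := if excluded_middle_informative (K 1) then 2 else 3.

Lemma K_range k : K k -> 0 <= k <= 1.
Proof. apply (good_K (line_good L)). Qed.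

Lemma PP_cases t : PP t -> (exists n, J n /\ t = phi n /\ 0 < t < 1) \/
  (exists v, Sp v /\ t = 1 + p v /\ 1 <= t <= 2) \/ (~ K 1 /\ t = 3).
Proof.
  intros [(n & Jn & ->)|[(v & Hv & ->)|Q]].
  - left. exists n. auto using phi_range.
  - right. left. exists v. pose proof (p_range L v Hv). repeat split; auto; lra.
  - right. right. assumption.
Qed.

Lemma KK_cases t : KK t -> (K 1 /\ t = 0) \/ (K (t - 1) /\ 1 <= t <= 2).
Proof. intros [Q|Q]; [left; assumption|right]. pose proof (K_range _ Q). split; [assumption|lra]. Qed.

Lemma start_cases : (K 1 /\ start = 0 /\ finish = 2) \/
  (~ K 1 /\ start = phi nmin /\ finish = 3).
Proof. unfold start, finish. destruct excluded_middle_informative; auto. Qed.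

Lemma PP_KK t : PP t -> KK t -> False.
Proof.
  intros HP HK. destruct (KK_cases t HK) as [[Q ->]|[Q Ht]].
  - destruct (PP_cases 0 HP) as [(n & _ & _ & ?)|[(v & _ & _ & ?)|[_ ?]]]; lra.
  - destruct (PP_cases t HP) as [(n & _ & _ & ?)|[(v & Hv & E & _)|[_ ?]]]; try lra.
    apply (p_neq_K L v (t - 1) Hv Q). lra.
Qed.

Lemma PP_iso t : start <= t <= finish -> ~ KK t -> exists d, 0 < d /\
  forall q, Rabs (q - t) < d -> q <> t -> ~ PP q /\ ~ KK q.
Proof.
  intros Ht NK.
  destruct (Rlt_dec t 1) as [L1|L1]; [|destruct (Rle_dec t 2) as [L2|L2]].
  - assert (0 < t).
    { destruct start_cases as [(K1 & E & _)|(K1 & E & _)]; rewrite E in Ht.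
      - destruct (Req_dec t 0) as [->|]; [|lra]. exfalso. apply NK. left. auto.
      - pose proof (phi_range nmin). lra. }
    destruct (phi_iso t ltac:(lra)) as (d & Hd & Hl).
    exists (Rmin d (Rmin t (1 - t))). split; [repeat apply Rmin_pos; lra|].
    intros q Hq Nq.
    assert (Rabs (q - t) < d /\ Rabs (q - t) < t /\ Rabs (q - t) < 1 - t) as (H1 & H2 & H3).
    { revert Hq. generalize (Rabs (q - t)). intro z. unfold Rmin; repeat destruct Rle_dec; lra. }
    apply Rabs_def2 in H2, H3. split.
    + intro Q. destruct (PP_cases q Q) as [(n & _ & -> & _)|[(v & _ & _ & ?)|[_ ?]]]; try lra. auto.
    + intro Q. destruct (KK_cases q Q) as [[_ ->]|[_ ?]]; lra.
  (* Only [t = 1] is delicate: there time 0 of the spine is a vertex, so the second track has a last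
     block and stays away from [t]. *)
  - assert (exists d0, 0 < d0 /\ forall n, J n -> phi n <= t - d0) as (d0 & Hd0 & Hphi).
    { destruct (Req_dec t 1) as [->|N1].
      - destruct track_max as (m & A & B).
        { intro Q. apply NK. right. replace (1 - 1) with 0 by ring. assumption. }
        exists (1 - phi m). pose proof (phi_range m). split; [lra|]. intros n Jn.
        assert (n <= m)%Z.
        { apply Znot_gt_le. intro Q. apply B.
          apply (track_convex HT m (m + 1) n); auto. lia. }
        destruct (Z.eq_dec n m) as [->|]; [lra|]. pose proof (phi_lt n m ltac:(lia)). lra.
      - exists (t - 1). split; [lra|]. intros n _. pose proof (phi_range n). lra. }
    destruct (good_iso (line_good L) (t - 1) ltac:(lra)) as (d & Hd & Hs).
    { intro Q. apply NK. right. assumption. }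
    exists (Rmin d (Rmin d0 (1 / 2))). split; [repeat apply Rmin_pos; lra|].
    intros q Hq Nq.
    assert (Rabs (q - t) < d /\ Rabs (q - t) < d0 /\ Rabs (q - t) < 1 / 2) as (H1 & H2 & H3).
    { revert Hq. generalize (Rabs (q - t)). intro z. unfold Rmin; repeat destruct Rle_dec; lra. }
    apply Rabs_def2 in H2, H3.
    destruct (Hs (q - 1)) as [A B]; [replace (q - 1 - (t - 1)) with (q - t) by ring; assumption|lra|].
    split.
    + intro Q. destruct (PP_cases q Q) as [(n & Jn & -> & _)|[(v & Hv & E & ?)|[_ ?]]]; try lra.
      * specialize (Hphi n Jn). lra.
      * apply A. exists v. split; [assumption|lra].
    + intro Q. destruct (KK_cases q Q) as [[_ ->]|[? _]]; [lra|contradiction].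
  - destruct start_cases as [(K1 & _ & E)|(K1 & _ & E)]; [lra|].
    assert (exists d, 0 < d /\ d <= t - 2 /\ forall q, Rabs (q - t) < d -> q <> t -> q <> 3)
      as (d & Hd & Hd2 & Hq3).
    { destruct (Req_dec t 3) as [->|N3].
      - exists (1 / 2). repeat split; try lra. auto.
      - exists (Rmin (t - 2) (3 - t)). split; [apply Rmin_pos; lra|].
        split; [apply Rmin_l|]. intros q Hq _ ->. pose proof (Rmin_r (t - 2) (3 - t)).
        apply Rabs_def2 in Hq. lra. }
    exists d. split; [assumption|]. intros q Hq Nq. pose proof (Hq3 q Hq Nq).
    apply Rabs_def2 in Hq. split.
    + intro Q. destruct (PP_cases q Q) as [(n & _ & _ & ?)|[(v & _ & _ & ?)|[_ ?]]]; lra.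
    + intro Q. destruct (KK_cases q Q) as [[_ ->]|[_ ?]]; lra.
Qed.

Lemma good_PP : good start finish PP KK.
Proof.
  pose proof (line_good L) as G.
  assert (PS : forall n, J n -> PP (phi n)) by (intros n Jn; left; eauto).
  assert (AS : forall v, Sp v -> PP (1 + p v)) by (intros v Hv; right; left; eauto).
  constructor.
  - destruct start_cases as [(_ & -> & ->)|(_ & -> & ->)]; [lra|].
    pose proof (phi_range nmin). lra.
  - intros t HP. destruct start_cases as [(K1 & -> & ->)|(K1 & -> & ->)];
      destruct (PP_cases t HP) as [(n & Jn & E & ?)|[(v & _ & _ & ?)|[? ?]]]; try lra; try contradiction.
    + pose proof (nmin_least n K1 Jn). destruct (Z.eq_dec nmin n) as [<-|]; [lra|].
      pose proof (phi_lt nmin n ltac:(lia)). lra.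
    + pose proof (phi_range nmin). lra.
    + pose proof (phi_range nmin). lra.
  - intros t HK. destruct start_cases as [(K1 & -> & ->)|(K1 & -> & ->)];
      destruct (KK_cases t HK) as [[? ->]|[? ?]]; try lra; try contradiction.
    pose proof (phi_range nmin). lra.
  - apply PP_KK.
  - destruct start_cases as [(K1 & -> & _)|(K1 & -> & _)].
    + right. left. auto.
    + left. apply PS, nmin_spec, K1.
  - destruct start_cases as [(K1 & _ & ->)|(K1 & _ & ->)].
    + right. right. replace (2 - 1) with 1 by ring. assumption.
    + left. right. right. auto.
  - intros t Ht NK. apply PP_iso; assumption.
  - intros k e HK Hk He. destruct (KK_cases k HK) as [[K1 ->]|[Kk Hr]].
    + destruct (phi_near_0 e He) as (n & Hn & Hp). exists (phi n). pose proof (phi_range n).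
      split; [apply PS, track_unbounded1; [assumption|lia]|lra].
    + assert (k - 1 < 1).
      { destruct (Req_dec k 2) as [->|]; [|lra]. exfalso. replace (2 - 1) with 1 in Kk by ring.
        destruct start_cases as [(K1 & _ & E)|(K1 & _ & E)]; [lra|contradiction]. }
      destruct (good_accr G (k - 1) e Kk ltac:(lra) He) as (q & (v & Hv & <-) & Hq).
      exists (1 + p v). split; [apply AS, Hv|lra].
  - intros k e HK Hk He. destruct (KK_cases k HK) as [[K1 ->]|[Kk Hr]].
    + exfalso. destruct start_cases as [(_ & E & _)|(NK & _)]; [lra|contradiction].
    + destruct (Req_dec k 1) as [->|N1].
      * destruct (phi_near_1 e He) as (n & Hn & Hp). exists (phi n). pose proof (phi_range n).
        split; [|lra]. apply PS, track_unbounded0; [|assumption].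
        replace 0 with (1 - 1) by ring. assumption.
      * destruct (good_accl G (k - 1) e Kk ltac:(lra) He) as (q & (v & Hv & <-) & Hq).
        exists (1 + p v). split; [apply AS, Hv|lra].
Qed.

Lemma PP_consec r r' : consec PP KK r r' ->
  (exists n, J n /\ J (n + 1)%Z /\ r = phi n /\ r' = phi (n + 1)) \/
  (exists n, J n /\ p (s n) = 0 /\ r = phi n /\ r' = 1 + p (s n)) \/
  (exists v x, EB v x /\ p v < p x /\ r = 1 + p v /\ r' = 1 + p x) \/
  (~ K 1 /\ r = 1 + p (s nmin) /\ r' = 3).
Proof.
  intros (Hr & Hr' & Hlt & Hn).
  assert (PS : forall n, J n -> PP (phi n)) by (intros n Jn; left; eauto).
  assert (AS : forall v, Sp v -> PP (1 + p v)) by (intros v Hv; right; left; eauto).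
  assert (no : forall q, PP q -> r < q -> q < r' -> False).
  { intros q Pq A B. exact (proj1 (Hn q (conj A B)) Pq). }
  destruct (PP_cases r Hr) as [(n & Jn & -> & Bn)|[(v & Hv & -> & Bv)|[? ?]]];
  destruct (PP_cases r' Hr') as [(m & Jm & -> & Bm)|[(x & Hx & -> & Bx)|[NK ->]]]; try lra.
  - left. apply phi_lt_inv in Hlt. exists n.
    assert (J (n + 1)%Z) by (apply (track_convex HT n (n + 1) m); auto; lia).
    repeat split; auto. destruct (Z.eq_dec m (n + 1)) as [->|]; [reflexivity|exfalso].
    apply (no (phi (n + 1))); auto; apply phi_lt; lia.
  - right. left. exists n.
    assert (p (s n) = 0) as E0.
    { apply (track_top HT n Jn). intro Q.
      apply (no (phi (n + 1))); auto; [apply phi_lt; lia|].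
      pose proof (phi_range (n + 1)). lra. }
    assert (p x = 0).
    { apply NNPP; intro Q. apply (no (1 + p (s n))); [apply AS, sJ, Jn|lra|].
      pose proof (p_range L x Hx). lra. }
    repeat split; auto. lra.
  - exfalso. apply (no (1 + p (s n))); [apply AS, sJ, Jn| |];
      pose proof (p_range L _ (sJ n Jn)); lra.
  - right. right. left. exists v.
    pose proof (p_range L x Hx).
    destruct (line_next L v Hv ltac:(lra)) as (y & E & Ly).
    assert (Hy : Sp y) by apply (EB_Sp L _ _ E).
    assert (y = x); [|subst y; exists x; repeat split; auto].
    apply (line_inj L); auto.
    pose proof (EB_between L _ _ x E Hx) as B. unfold betw in B.
    destruct (Rlt_dec (p y) (p x)); [|lra]. exfalso. apply (no (1 + p y)); [apply AS, Hy|lra|lra].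
  - right. right. right. split; [assumption|]. split; [|reflexivity].
    destruct (nmin_spec NK) as [Jm _]. pose proof (nmin_p NK) as Em.
    destruct (Req_dec (p v) 1) as [E|N]; [lra|]. exfalso.
    apply (no (1 + p (s nmin))); [apply AS, sJ, Jm|lra|lra].
Qed.

(** * Blocks along the closed curve *)

Definition blk (r : R) : list V :=
  if Rlt_dec r 1 then blkP (epsilon (inhabits 0%Z) (fun n => J n /\ r = phi n))
  else if Rle_dec r 2 then blkA (epsilon (inhabits (s 0%Z)) (fun v => Sp v /\ r = 1 + p v))
  else [s nmin].

Lemma blk_phi n : J n -> blk (phi n) = blkP n.
Proof.
  intro Jn. unfold blk. pose proof (phi_range n). destruct Rlt_dec; [|lra]. f_equal.
  destruct (epsilon_spec (inhabits 0%Z) (fun m => J m /\ phi n = phi m)) as [_ E]; [eauto|].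
  symmetry. apply phi_inj, E.
Qed.

Lemma blk_p v : Sp v -> blk (1 + p v) = blkA v.
Proof.
  intro Hv. unfold blk. pose proof (p_range L v Hv).
  destruct Rlt_dec; [lra|]. destruct Rle_dec; [|lra]. f_equal.
  destruct (epsilon_spec (inhabits (s 0%Z)) (fun x => Sp x /\ 1 + p v = 1 + p x)) as [A E]; [eauto|].
  apply (line_inj L); auto. lra.
Qed.

Lemma blk_3 : blk 3 = [s nmin].
Proof. unfold blk. destruct Rlt_dec; [lra|]. destruct Rle_dec; [lra|reflexivity]. Qed.

Lemma blk_two_PP r r' : consec PP KK r r' -> blk r = [] -> blk r' = [] -> False.
Proof.
  intros C E E'. destruct (PP_consec r r' C) as
    [(n & Jn & Jn1 & -> & ->)|[(n & Jn & E0 & -> & ->)|[(v & x & Evx & Lt & -> & ->)|(NK & -> & ->)]]].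
  - rewrite blk_phi in E, E' by assumption. apply (blkP_two n); assumption.
  - rewrite blk_phi in E by assumption. apply (blkP_top_ne n); assumption.
  - destruct (EB_Sp L _ _ Evx) as [Hv Hx].
    rewrite blk_p in E, E' by assumption. apply (blkA_two v x); assumption.
  - rewrite blk_3 in E'. discriminate.
Qed.

Lemma blk_next_PP r r' l a b l' : consec PP KK r r' -> blk r = l ++ [a] -> blk r' = b :: l' ->
  square adj a b.
Proof.
  intros C E E'. destruct (PP_consec r r' C) as
    [(n & Jn & Jn1 & -> & ->)|[(n & Jn & E0 & -> & ->)|[(v & x & Evx & Lt & -> & ->)|(NK & -> & ->)]]].
  - rewrite blk_phi in E, E' by assumption. apply (blkP_next n l a b l'); assumption.
  - rewrite blk_phi in E by assumption. rewrite blk_p in E' by (apply sJ; assumption).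
    apply (blk_turn n l a b l'); assumption.
  - destruct (EB_Sp L _ _ Evx) as [Hv Hx].
    rewrite blk_p in E, E' by assumption. apply (blkA_next v x l a b l'); assumption.
  - destruct (nmin_spec NK) as [Jm Nm]. rewrite blk_3 in E'. injection E' as <- _.
    rewrite blk_p in E by (apply sJ; assumption). eapply blk_bottom; eauto.
Qed.

Lemma blk_skip_PP r r' r'' l a b l' : consec PP KK r r' -> consec PP KK r' r'' ->
  blk r = l ++ [a] -> blk r' = [] -> blk r'' = b :: l' -> square adj a b.
Proof.
  intros C C' Ea E0 Eb.
  destruct (PP_consec r r' C) as
    [(n & Jn & Jn1 & -> & ->)|[(n & Jn & P0 & -> & ->)|[(v & x & Evx & Lt & -> & ->)|(NK & -> & ->)]]].
  - rewrite blk_phi in Ea, E0 by assumption. pose proof (phi_range (n + 1)) as Rn.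
    destruct (PP_consec _ r'' C') as
      [(m & Jm & Jm1 & Em & ->)|[(m & Jm & P0 & Em & ->)|[(v & x & Evx & Lt & Em & ->)|(NK & Em & ->)]]].
    + apply phi_inj in Em. subst m. rewrite blk_phi in Eb by assumption.
      apply (blkP_skip n l a b l'); assumption.
    + apply phi_inj in Em. subst m. exfalso. apply (blkP_top_ne (n + 1)); assumption.
    + exfalso. pose proof (p_range L v (proj1 (EB_Sp L _ _ Evx))). lra.
    + exfalso. pose proof (nmin_p NK). lra.
  - rewrite blk_phi in Ea by assumption. rewrite blk_p in E0 by (apply sJ; assumption).
    destruct (PP_consec _ r'' C') as
      [(m & Jm & Jm1 & Em & ->)|[(m & Jm & P0' & Em & ->)|[(v & x & Evx & Lt & Em & ->)|(NK & Em & ->)]]].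
    + exfalso. pose proof (phi_range m). lra.
    + exfalso. pose proof (phi_range m). lra.
    + destruct (EB_Sp L _ _ Evx) as [Hv Hx].
      assert (v = s n) by (apply (line_inj L); [assumption|apply sJ; assumption|lra]). subst v.
      rewrite blk_p in Eb by assumption. apply (blk_turn_skip n x l a b l'); assumption.
    + exfalso. pose proof (nmin_p NK). lra.
  - destruct (EB_Sp L _ _ Evx) as [Hv Hx].
    pose proof (p_range L x Hx) as Rx.
    rewrite blk_p in Ea, E0 by assumption.
    destruct (PP_consec _ r'' C') as
      [(m & Jm & Jm1 & Em & ->)|[(m & Jm & P0' & Em & ->)|[(v' & y & Evy & Lt' & Em & ->)|(NK & Em & ->)]]].
    + exfalso. pose proof (phi_range m). lra.
    + exfalso. pose proof (phi_range m). lra.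
    + destruct (EB_Sp L _ _ Evy) as [Hv' Hy].
      assert (v' = x) by (apply (line_inj L); auto; lra). subst v'.
      rewrite blk_p in Eb by assumption. apply (blkA_skip v x y l a b l'); assumption.
    + destruct (nmin_spec NK) as [Jm Nm].
      assert (x = s nmin) by (apply (line_inj L); [assumption|apply sJ; assumption|lra]).
      subst x. exfalso. destruct (blk_bottom nmin Jm Nm) as (_ & Q & _). contradiction.
  - rewrite blk_3 in E0. discriminate.
Qed.

Lemma blk_sp r x : PP r -> In x (blk r) ->
  (exists n, J n /\ r = phi n /\ sp x = s n /\ In x (blkP n)) \/
  (r = 1 + p (sp x) /\ In x (blkA (sp x))) \/ (~ K 1 /\ r = 3 /\ x = s nmin).
Proof.
  intros HP. destruct (PP_cases r HP) as [(n & Jn & -> & _)|[(v & Hv & -> & _)|[NK ->]]].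
  - rewrite blk_phi by assumption. intro I. left. exists n. repeat split; auto.
    apply blkP_sp; assumption.
  - rewrite blk_p by assumption. intro I. right. left.
    pose proof (blkA_sp v x Hv I) as E. rewrite E. auto.
  - rewrite blk_3. intros [<-|[]]. auto.
Qed.

Lemma blk_NoDup r : PP r -> NoDup (blk r).
Proof.
  intros HP. destruct (PP_cases r HP) as [(n & Jn & -> & _)|[(v & Hv & -> & _)|[NK ->]]].
  - rewrite blk_phi by assumption. apply blkP_NoDup; assumption.
  - rewrite blk_p by assumption. apply blkA_NoDup; assumption.
  - rewrite blk_3. apply NoDup_cons; [tauto|apply NoDup_nil].
Qed.

(** Time 3 is excluded because its block repeats [s nmin] in order to close the curve. *)
Lemma blk_unique r r' x : PP r -> PP r' -> r <> 3 -> r' <> 3 -> In x (blk r) -> In x (blk r') -> r = r'.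
Proof.
  intros HP HP' N N' I I'.
  destruct (blk_sp r x HP I) as [(n & Jn & -> & En & In1)|[[-> I1]|(_ & Q & _)]]; [| |contradiction];
  destruct (blk_sp r' x HP' I') as [(m & Jm & -> & Em & Im1)|[[-> I2]|(_ & Q & _)]]; try contradiction.
  - f_equal. apply (track_inj HT); auto. congruence.
  - exfalso. rewrite En in I2. apply (blk_disjoint n x); assumption.
  - exfalso. rewrite Em in I1. apply (blk_disjoint m x); assumption.
  - reflexivity.
Qed.

Lemma blk_in r j x y : PP r -> nth_error (blk r) j = Some x -> nth_error (blk r) (S j) = Some y ->
  square adj x y.
Proof.
  intros HP Hx Hy. assert (N : x <> y).
  { intros ->. pose proof (proj1 (NoDup_nth_error (blk r)) (blk_NoDup r HP) j (S j)) as Q.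
    enough (j = S j) by lia. apply Q; [apply nth_error_Some; congruence|congruence]. }
  pose proof (nth_error_In _ _ Hx) as Ix. pose proof (nth_error_In _ _ Hy) as Iy.
  apply sq_same; [assumption|].
  destruct (PP_cases r HP) as [(n & Jn & -> & _)|[(v & Hv & -> & _)|[NK ->]]].
  - rewrite blk_phi in Ix, Iy by assumption.
    rewrite (blkP_sp n x Jn Ix), (blkP_sp n y Jn Iy). reflexivity.
  - rewrite blk_p in Ix, Iy by assumption.
    rewrite (blkA_sp v x Hv Ix), (blkA_sp v y Hv Iy). reflexivity.
  - rewrite blk_3 in Ix, Iy. destruct Ix as [<-|[]], Iy as [<-|[]]. reflexivity.
Qed.

Lemma blk_all x : exists r, PP r /\ In x (blk r).
Proof.
  destruct (blk_cover x) as [(n & Jn & I)|I].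
  - exists (phi n). rewrite blk_phi by assumption. split; [left; eauto|assumption].
  - exists (1 + p (sp x)). rewrite blk_p by apply spSp. split; [|assumption].
    right. left. exists (sp x). auto.
Qed.

Lemma blk_start : PP start -> blk start = [s nmin] /\ ~ K 1 /\ start = phi nmin.
Proof.
  intro HP. destruct start_cases as [(K1 & E & _)|(NK & E & _)]; rewrite E in *.
  - exfalso. apply (PP_KK 0 HP). left. auto.
  - destruct (nmin_spec NK) as [Jm Nm]. rewrite blk_phi by assumption.
    split; [apply blk_bottom; assumption|auto].
Qed.

Lemma blk_finish : PP finish -> blk finish = [s nmin] /\ ~ K 1 /\ finish = 3.
Proof.
  intro HP. destruct start_cases as [(K1 & _ & E)|(NK & _ & E)]; rewrite E in *.
  - exfalso. apply (PP_KK 2 HP). right. replace (2 - 1) with 1 by ring. assumption.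
  - split; [apply blk_3|auto].
Qed.

(** The conditional translates curve time into spine time: if time 1 of the spine is an end, it is
    met at the curve times 0 and 2. The bound 1/2 keeps the end at 0 apart from those between 1 and
    2. *)
Lemma near_end k d0 : KK k -> 0 < d0 -> exists d, 0 < d /\ d <= 1 / 2 /\ d <= d0 /\
  forall r x, PP r -> In x (blk r) -> Rabs (r - k) < d ->
    Rabs (p (sp x) - (if Req_dec_T k 0 then 1 else k - 1)) < d0.
Proof.
  intros Kk Hd0. destruct (KK_cases k Kk) as [[K1 E]|[Kk1 Hk]].
  - subst k. destruct Req_dec_T; [|contradiction].
    destruct (track_lim1 HT (track_unbounded1 K1) d0 Hd0) as [N HN].
    pose proof (phi_range N).
    exists (Rmin (phi N) (Rmin (1 / 2) d0)). split; [repeat apply Rmin_pos; lra|].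
    pose proof (Rmin_l (phi N) (Rmin (1 / 2) d0)). pose proof (Rmin_r (phi N) (Rmin (1 / 2) d0)).
    pose proof (Rmin_l (1 / 2) d0). pose proof (Rmin_r (1 / 2) d0).
    split; [lra|]. split; [lra|]. intros r x HP I Hr. apply Rabs_def2 in Hr.
    destruct (blk_sp r x HP I) as [(n & Jn & -> & En & _)|[[E _]|(NK & _)]].
    + rewrite En. assert (n <= N)%Z by (assert (n < N)%Z by (apply phi_lt_inv; lra); lia).
      specialize (HN n ltac:(assumption)). pose proof (p_range L _ (sJ n Jn)).
      apply Rabs_def1; lra.
    + exfalso. pose proof (p_range L _ (spSp x)). lra.
    + contradiction.
  - destruct Req_dec_T as [Q0|Q0]; [lra|].
    assert (exists d1, 0 < d1 /\ forall n, J n -> k - d1 < phi n -> p (s n) < d0 /\ k = 1) as (d1 & Hd1 & H1).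
    { destruct (Req_dec k 1) as [->|N1].
      - assert (K0 : K 0) by (replace 0 with (1 - 1) by ring; assumption).
        destruct (track_lim0 HT (track_unbounded0 K0) d0 Hd0) as [N HN].
        exists (1 - phi N). pose proof (phi_range N). split; [lra|]. intros n Jn Hn.
        split; [|reflexivity]. apply HN. assert (N < n)%Z by (apply phi_lt_inv; lra). lia.
      - exists (k - 1). split; [lra|]. intros n _ Hn. pose proof (phi_range n). lra. }
    exists (Rmin d1 (Rmin (1 / 2) d0)). split; [repeat apply Rmin_pos; lra|].
    pose proof (Rmin_l d1 (Rmin (1 / 2) d0)). pose proof (Rmin_r d1 (Rmin (1 / 2) d0)).
    pose proof (Rmin_l (1 / 2) d0). pose proof (Rmin_r (1 / 2) d0).
    split; [lra|]. split; [lra|]. intros r x HP I Hr. apply Rabs_def2 in Hr.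
    destruct (blk_sp r x HP I) as [(n & Jn & -> & En & _)|[[-> _]|(NK & -> & _)]].
    + rewrite En. destruct (H1 n Jn ltac:(lra)) as [A ->].
      pose proof (p_range L _ (sJ n Jn)). apply Rabs_def1; lra.
    + apply Rabs_def1; lra.
    + exfalso. lra.
Qed.

Definition eend (t : R) : (nat -> V) -> Prop :=
  sqend V adj (w (if Req_dec_T t 0 then 1 else t - 1)).

Hypothesis Hthree : exists a b c : V, a <> b /\ b <> c /\ a <> c.

Theorem track_hamiltonian : hamiltonian (square adj).
Proof.
  pose proof good_PP as G.
  assert (B_hi : PP finish -> length (blk finish) = 1%nat).
  { intro Q. destruct (blk_finish Q) as [-> _]. reflexivity. }
  assert (B_lo : PP start -> blk start <> []).
  { intro Q. destruct (blk_start Q) as [-> _]. discriminate. }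
  set (x0 := s 0%Z).
  pose proof (good_member V start finish PP KK blk G blk_two_PP B_lo B_hi) as GM.
  set (M := member V PP KK blk) in *. set (lb := lab V PP KK blk x0).
  assert (lbs : forall r j x, PP r -> nth_error (blk r) j = Some x -> lb (slot V PP KK blk r j) = x).
  { intros r j x HP Hx. exact (lab_slot V start finish PP KK blk G B_hi x0 r j x HP Hx). }
  assert (lbm : forall t, M t -> exists r j, PP r /\ t = slot V PP KK blk r j /\
            nth_error (blk r) j = Some (lb t)).
  { intros t Mt. exact (member_lab V start finish PP KK blk G B_hi x0 t Mt). }
  assert (lbx : forall x, exists t, M t /\ lb t = x).
  { intro x. destruct (blk_all x) as (r & HP & I). apply In_nth_error in I as [j Hj].
    exists (slot V PP KK blk r j). split; [|apply lbs; assumption].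
    exists r, j. split; [assumption|]. split; [|reflexivity]. apply nth_error_Some. congruence. }
  assert (Kend : forall t, KK t -> K (if Req_dec_T t 0 then 1 else t - 1)).
  { intros t HK. destruct (KK_cases t HK) as [[K1 ->]|[Kt Ht]]; destruct Req_dec_T; auto; lra. }
  assert (Wend : forall t, KK t -> is_end adj (w (if Req_dec_T t 0 then 1 else t - 1))).
  { intros t HK. apply (spine_end HS), Kend, HK. }
  assert (fin3 : PP 3 -> finish = 3).
  { intro Q. destruct (PP_cases 3 Q) as [(n & _ & _ & ?)|[(v & _ & _ & ?)|[NK _]]]; try lra.
    destruct start_cases as [(K1 & _)|(_ & _ & ->)]; [contradiction|reflexivity]. }
  assert (len3 : forall r j x, PP r -> nth_error (blk r) j = Some x ->
            slot V PP KK blk r j < finish -> r <> 3).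
  { intros r j x HP Hx Hlt ->. rewrite (fin3 HP) in Hlt. rewrite blk_3 in Hx.
    destruct j as [|[|j]]; try discriminate. rewrite slot_0 in Hlt. lra. }
  assert (CC : closed_curve (square adj) start finish (curve V M KK lb eend)).
  { apply curve_closed.
    - apply square_sym, Hsym.
    - apply square_irr.
    - exact GM.
    - destruct start_cases as [(_ & -> & ->)|(_ & -> & ->)]; [lra|]. pose proof (phi_range nmin). lra.
    - intros r r' C. exact (member_adj V start finish PP KK blk (square adj) G blk_two_PP B_hi x0
        blk_in blk_next_PP blk_skip_PP r r' C).
    - intros q t Mq Mt Hq Ht E.
      destruct (lbm q Mq) as (r & j & HP & -> & Hj). destruct (lbm t Mt) as (r' & j' & HP' & -> & Hj').
      pose proof (len3 r j _ HP Hj Hq) as N3. pose proof (len3 r' j' _ HP' Hj' Ht) as N3'.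
      rewrite <- E in Hj'.
      assert (r = r') as <-.
      { apply (blk_unique r r' (lb (slot V PP KK blk r j))); auto; eapply nth_error_In; eassumption. }
      assert (j = j') as <-; [|reflexivity].
      apply (proj1 (NoDup_nth_error (blk r)) (blk_NoDup r HP)); [|congruence].
      apply nth_error_Some. congruence.
    - intros t HK. apply (sqend_end V adj Hsym Hirr), Wend, HK.
    - intros q t Kq Kt Hq Ht E. apply (sqend_inj V adj Hsym Hirr Hlf) in E; auto.
      apply (spine_end_inj HS) in E; auto.
      (* The only end met twice has curve times 0 and 2, and 2 is then the excluded right
         endpoint. *)
      assert (two : forall z, KK z -> z = 2 -> z < finish -> False).
      { intros z Kz -> Hz. destruct (KK_cases 2 Kz) as [[_ ?]|[K1 _]]; [lra|].
        replace (2 - 1) with 1 in K1 by ring.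
        destruct start_cases as [(_ & _ & Q)|(NK & _)]; [lra|contradiction]. }
      destruct (Req_dec_T q 0) as [Eq|Nq], (Req_dec_T t 0) as [Et|Nt]; try lra; exfalso.
      + apply (two t); auto. lra.
      + apply (two q); auto. lra.
    - destruct start_cases as [(K1 & E1 & E2)|(NK & E1 & E2)]; [right|left].
      + rewrite E1, E2. split; [left; auto|]. split.
        * right. replace (2 - 1) with 1 by ring. assumption.
        * unfold eend. destruct (Req_dec_T 0 0); [|lra]. destruct (Req_dec_T 2 0); [lra|].
          replace (2 - 1) with 1 by ring. reflexivity.
      + destruct (nmin_spec NK) as [Jm Nm].
        assert (PS : PP start) by (rewrite E1; left; eauto).
        assert (PF : PP finish) by (rewrite E2; right; right; auto).
        destruct (blk_start PS) as (BS & _). destruct (blk_finish PF) as (BF & _).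
        assert (first : forall r, PP r -> blk r = [s nmin] -> M r /\ lb r = s nmin).
        { intros r HP Br. split.
          - exists r, 0%nat. rewrite slot_0, Br. simpl. auto.
          - rewrite <- (slot_0 V PP KK blk r). apply lbs; [assumption|]. rewrite Br. reflexivity. }
        destruct (first start PS BS) as [A1 A2]. destruct (first finish PF BF) as [A3 A4].
        split; [assumption|]. split; [assumption|]. congruence.
    - intros x y. destruct (third_vertex V Hthree x y) as (z & Nx & Ny).
      destruct (lbx z) as (t & Mt & <-). exists t. auto.
    - intros k S c HK Hc. unfold eend in Hc.
      destruct (spine_square_cont V adj Hsym Hirr Hlf Sp p K EB sp w HS _ S c (Kend k HK) Hc)
        as (d0 & Hd0 & A & B).
      destruct (near_end k d0 HK Hd0) as (d & Hd & Hd2 & Hd3 & Hn).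
      (* A slot within [d / 2] of [k] belongs to a mark within [d], by [slot_near]. *)
      exists (d / 2). split; [lra|]. split.
      + intros t Mt Ht. destruct (lbm t Mt) as (r & j & HP & Et & Hj).
        apply A, (Hn r); [assumption|eapply nth_error_In; eassumption|].
        replace d with (2 * (d / 2)) by field. rewrite Et in Ht.
        apply (slot_near V start finish PP KK blk G B_hi r j); auto.
        apply nth_error_Some. congruence.
      + intros t HKt Ht. unfold eend. apply B; [apply Kend, HKt|].
        apply Rabs_def2 in Ht.
        destruct (KK_cases k HK) as [[_ Ek]|[_ Hk]]; destruct (KK_cases t HKt) as [[_ Et]|[_ Htr]];
          destruct (Req_dec_T t 0), (Req_dec_T k 0); try lra; apply Rabs_def1; lra. }
  exists (fun q => exists t, start <= t <= finish /\ curve V M KK lb eend t = q). split.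
  - apply closed_curve_circle; [apply square_sym, Hsym|apply square_locally_finite, Hlf|assumption].
  - intro v. destruct (lbx v) as (t & Mt & Et). exists (vpt v). split; [apply is_vpt_vpt|].
    exists t. split; [apply (good_P GM), Mt|].
    rewrite (curve_P V start finish M KK lb eend GM t Mt), Et. reflexivity.
Qed.

End Distribute.

Theorem theorem1p5 (V : Type) (adj : V -> V -> Prop) :
  symmetric_rel adj -> irreflexive_rel adj ->
  locally_finite adj -> connected_graph adj ->
  (exists a b c : V, a <> b /\ b <> c /\ a <> c) ->
  (exists (VT : V -> Prop) (ET : V -> V -> Prop),
      spanning_topological_caterpillar adj VT ET) ->
  hamiltonian (square adj).
Proof.
  intros Hsym Hirr Hlf Hconn Hthree (VT & ET & ([Hsub _] & Htree & Harc) & Hspan).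
  (* Taking the closure adds ends only, so a caterpillar whose closure contains all vertices has
     them all in its forest. *)
  assert (Hall : forall v, VT v).
  { intro v. destruct (Hspan v) as (f & Hf & Hcl). apply closure_inner in Hcl; [|assumption].
    rewrite (is_vpt_eq _ _ _ Hf) in Hcl. destruct Hcl as [(u & Hu & Eu)|(u & x & _ & He)].
    - apply is_vpt_eq, vpt_inj in Eu. congruence.
    - exfalso. destruct He as (_ & Pu & Px & E & _).
      destruct (vpt_01 _ v u), (vpt_01 _ v x); lra. }
  destruct (caterpillar_spine V adj VT ET Hsym Hirr Hthree Hsub Htree Hall Harc)
    as (Sp & p & K & EB & sp & w & HS).
  pose proof Hthree as (v0 & _).
  destruct (spine_track V adj Sp EB sp Hsym Hlf Hconn p K w v0 HS) as (s & J & HT).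
  exact (track_hamiltonian V adj Sp p K EB sp w s J Hsym Hirr Hlf HS HT Hthree).
Qed.
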